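(* Let $f\in H^{-1}(\Omega)$ and $y_d\in L^2(\Omega)$. Let $(A_0,y_0)\in\Xi$ be an optimal pair, i.e. $I(A_0,y_0)=\inf_{(A,y)\in\Xi}I(A,y)$ with $I(A,y)=\|y-y_d\|^2_{L^2(\Omega)}+\int_\Omega(\nabla y,A^{sym}\nabla y)_{\mathbb{R}^N}dx$, and assume $y_0\in D(A^\ast)$. Assume moreover: (i) $D(A)\supseteq D(A^\ast)$ for every $A\in\mathfrak{A}_{ad}$. (ii) For every $\widehat A\in\mathfrak{A}_{ad}$, putting $A_\theta=A_0+\theta(\widehat A-A_0)$ for $\theta\in[0,1]$, there exist weak solutions $y(A_\theta)$ of the boundary value problem $-\mathrm{div}(A_\theta\nabla y)=f$ in $\Omega$, $y=0$ on $\partial\Omega$, such that $y(A_\theta)\rightharpoonup y_0$ weakly in $H^1_0(\Omega)$ as $\theta\to0$ and $y(A_\theta)\in D(A^\ast)$ for $\theta$ small enough. (iii) For every $\widehat A\in\mathfrak{A}_{ad}$, with $A_\theta$ and $y(A_\theta)$ as in (ii), every $\lambda\in\mathbb{R}_+$ and every choice of $\varepsilon_\theta\in[0,1]$ ($\theta\in[0,1]$), there exist quasi-adjoint states $\psi_\theta$ to $y_0$ (see context) such that for each $\theta\in[0,1]$ there is $\gamma\in(0,\infty]$ with $$\nabla\psi_\theta\in L^\infty(\Omega;\mathbb{R}^N)\quad\text{or}\quad\left[A^\ast\in L^{2+\frac4\gamma}(\Omega;\mathbb{S}^N_{skew})\ \text{and}\ \nabla\psi_\theta\in L^{2+\gamma}(\Omega;\mathbb{R}^N)\right],$$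 and $\{\psi_\theta\}_{\theta\to0}$ is relatively compact in the strong topology of $H^1_0(\Omega)$. Then there exist $\lambda\in\mathbb{R}_+$ and $\overline\psi\in H^1_0(\Omega)$, not both zero, such that $$\int_\Omega(\nabla\varphi,A_0\nabla y_0)_{\mathbb{R}^N}dx=\langle f,\varphi\rangle_{H^{-1}(\Omega);H^1_0(\Omega)}\quad\forall\varphi\in C_0^\infty(\Omega),$$ $$\int_\Omega(\nabla\varphi,A_0^t\nabla\overline\psi)_{\mathbb{R}^N}dx=-2\lambda\int_\Omega(y_0-y_d)\varphi\,dx-2\lambda\int_\Omega(\nabla\varphi,A_0^{sym}\nabla y_0)_{\mathbb{R}^N}dx\quad\forall\varphi\in C_0^\infty(\Omega),$$ $$\int_\Omega\big(\nabla y_0,(A^{sym}-A_0^{sym})(\lambda\nabla y_0+\nabla\overline\psi)\big)_{\mathbb{R}^N}dx\ge[y_0,\overline\psi]_{A_0}-[y_0,\overline\psi]_A\quad\forall A\in\mathfrak{A}_{ad}.$$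
   Context: $\Omega\subset\mathbb{R}^N$ ($N\ge2$) is a bounded open connected set with Lipschitz boundary. $\mathbb{M}^N$, $\mathbb{S}^N_{sym}$, $\mathbb{S}^N_{skew}$ are the real $N\times N$ matrices, symmetric matrices, skew-symmetric matrices. Each $A\in L^2(\Omega;\mathbb{M}^N)$ is written $A=A^{sym}+A^{skew}$ with $A^{sym}=\frac12(A+A^t)$, $A^{skew}=\frac12(A-A^t)$. $H^1_0(\Omega)$ carries the norm $(\int_\Omega|\nabla y|^2dx)^{1/2}$; $\mathbb{R}_+=[0,\infty)$. The set $D(A)$ (also for $A=A^\ast$, whose skew part is itself): $y\in H^1_0(\Omega)$ belongs to $D(A)$ if there is a constant $c=c(y,A^{skew})$ with $\left|\int_\Omega(\nabla\varphi,A^{skew}\nabla y)_{\mathbb{R}^N}dx\right|\le c\left(\int_\Omega|\nabla\varphi|^2dx\right)^{1/2}$ for all $\varphi\in C_0^\infty(\Omega)$. For $y\in D(A)$, $[y,\varphi]_A:=\int_\Omega(\nabla\varphi,A^{skew}\nabla y)_{\mathbb{R}^N}dx$ for $\varphi\in C_0^\infty(\Omega)$, extended by continuity to all $\varphi\in H^1_0(\Omega)$. Admissible controls: fix constants $0<\alpha\le\beta<\infty$ and $c>0$, a nonzero $A^\ast\in L^2(\Omega;\mathbb{S}^N_{skew})$, and a nonempty convex compact subset $Q$ of $L^2(\Omega;\mathbb{S}^N_{skew})$ containing the zero matrix. For skew-symmetric $B$, $B\preceq A^\ast$ means $|b_{ij}(x)|\le|a^\ast_{ij}(x)|$ for a.e.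 $x\in\Omega$ and all $i<j$. $\mathfrak{A}_{ad,1}$ is the set of $A\in L^\infty(\Omega;\mathbb{S}^N_{sym})$ with $\alpha I\le A(x)\le\beta I$ a.e. (as quadratic forms) and total variation $TV(a_{ij})=\sup\{\int_\Omega a_{ij}\,\mathrm{div}\,\varphi\,dx:\varphi\in C^1_0(\Omega;\mathbb{R}^N),|\varphi|\le1\}\le c$ for $1\le i\le j\le N$. $\mathfrak{A}_{ad,2}=\{B\in Q: B\preceq A^\ast\}$. $\mathfrak{A}_{ad}=\{A\in L^2(\Omega;\mathbb{M}^N):A^{sym}\in\mathfrak{A}_{ad,1},A^{skew}\in\mathfrak{A}_{ad,2}\}$. A weak solution of $-\mathrm{div}(A\nabla y)=f$ in $\Omega$, $y=0$ on $\partial\Omega$ is $y\in H^1_0(\Omega)$ with $\int_\Omega(\nabla\varphi,A\nabla y)_{\mathbb{R}^N}dx=\langle f,\varphi\rangle$ for all $\varphi\in C_0^\infty(\Omega)$. $\Xi$ is the set of pairs $(A,y)$ with $A\in\mathfrak{A}_{ad}$ and $y\in D(A)$ a weak solution for $A$. Quasi-adjoint state: given $\lambda\in\mathbb{R}_+$, $\theta\in[0,1]$, $\varepsilon_\theta\in[0,1]$, $A_\theta\in\mathfrak{A}_{ad}$ and a weak solution $y(A_\theta)$, put $y_\theta=y_0+\varepsilon_\theta(y(A_\theta)-y_0)$; $\psi_\theta\in H^1_0(\Omega)$ is a quasi-adjoint state to $y_0$ if $$\int_\Omega(\nabla\varphi,A_\theta^{sym}\nabla\psi_\theta-A_\theta^{skew}\nabla\psi_\theta)_{\mathbb{R}^N}dx=-2\lambda\int_\Omega(y_\theta-y_d)\varphi\,dx-2\lambda\int_\Omega(\nabla\varphi,A_\theta^{sym}\nabla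 y_\theta)_{\mathbb{R}^N}dx\quad\forall\varphi\in H^1_0(\Omega).$$ *)

(* Defs.v *)
From HB Require Import structures.
From mathcomp Require Import all_boot all_order all_algebra.
From mathcomp Require Import all_classical all_reals all_analysis.
Import Order.TTheory GRing.Theory Num.Theory.
Import numFieldNormedType.Exports.

Set Implicit Arguments.
Unset Strict Implicit.
Unset Printing Implicit Defensive.

Local Open Scope classical_set_scope.
Local Open Scope ring_scope.

(* The Borel sets of R^n, as the sigma-algebra generated by the coordinates. *)
Section measurable_rV.
Context (R : realType) (n : nat).

Let coord (i : 'I_n) (x : 'rV[R]_n) : R := x 0 i.

Let rV_set0 : g_sigma_preimage coord set0.
Proof. exact: sigma_algebra0. Qed.

Let rV_setC A : g_sigma_preimage coord A -> g_sigma_preimage coord (~` A).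
Proof. exact: sigma_algebraC. Qed.

Let rV_bigcup (F : _^nat) : (forall i, g_sigma_preimage coord (F i)) ->
  g_sigma_preimage coord (\bigcup_i (F i)).
Proof. exact: sigma_algebra_bigcup. Qed.

HB.instance Definition _ := @isMeasurable.Build default_measure_display
  'rV[R]_n (g_sigma_preimage coord) rV_set0 rV_setC rV_bigcup.

End measurable_rV.

Section lebesgue_rV.
Context (R : realType).

Lemma measurable_coord n (i : 'I_n) :
  measurable_fun [set: 'rV[R]_n] (fun x : 'rV[R]_n => x 0 i).
Proof.
move=> _ Y mY; rewrite setTI; apply: sub_sigma_algebra => /=.
rewrite -bigcup_seq/=; exists i => /=; first by rewrite mem_index_enum.
by exists Y => //; rewrite setTI.
Qed.

Lemma measurable_rVP d (T : measurableType d) n (f : T -> 'rV[R]_n) :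
  (forall i, measurable_fun [set: T] (fun t => f t 0 i)) ->
  measurable_fun [set: T] f.
Proof.
move=> mf _ A mA; rewrite setTI.
suff : measurable `<=` [set A | measurable (f @^-1` A)] by apply.
apply: smallest_sub.
  split => [|B|F] /=.
  - by rewrite preimage_set0.
  - by move=> mB; rewrite setTD preimage_setC; exact: measurableC.
  - by move=> mF; rewrite preimage_bigcup; exact: bigcup_measurable.
move=> B; rewrite -bigcup_seq /= => -[i _ [Y mY <-]] /=.
by rewrite setTI -comp_preimage -[X in measurable X]setTI; exact: mf.
Qed.

Definition rV_cons n (p : R * 'rV[R]_n) : 'rV[R]_n.+1 :=
  row_mx (p.1)%:M p.2.

Definition rV_uncons n (v : 'rV[R]_n.+1) : R * 'rV[R]_n :=
  (v 0 0, \row_i v 0 (lift 0 i)).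

Lemma rV_uncons_cons n : cancel (@rV_cons n) (@rV_uncons n).
Proof.
case=> a v; rewrite /rV_cons /rV_uncons /=; congr pair.
  by rewrite mxE; case: splitP => // j _; rewrite (ord1 j) mxE eqxx mulr1n.
apply/rowP => i; rewrite !mxE; case: splitP => [j|k /= /eqP].
  by rewrite (ord1 j).
by rewrite /bump /= !add1n eqSS => /eqP/val_inj ->.
Qed.

Lemma rV_consE0 n p : @rV_cons n p 0 0 = p.1.
Proof. by have := rV_uncons_cons p; case: p => a v [->]. Qed.

Lemma rV_consES n p i : @rV_cons n p 0 (lift 0 i) = p.2 0 i.
Proof.
by have := rV_uncons_cons p; case: p => a v [_ /rowP/(_ i)]; rewrite mxE.
Qed.

Lemma rV_cons_uncons n : cancel (@rV_uncons n) (@rV_cons n).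
Proof.
move=> v; apply/rowP => i; case: (unliftP 0 i) => [j|] ->.
  by rewrite rV_consES mxE.
by rewrite rV_consE0.
Qed.

Lemma measurable_rV_cons n : measurable_fun setT (@rV_cons n).
Proof.
apply: measurable_rVP => i; case: (unliftP 0 i) => [j|] ->.
- under eq_fun do rewrite rV_consES.
  by apply: (measurableT_comp (measurable_coord j)); exact: measurable_snd.
- under eq_fun do rewrite rV_consE0.
  exact: measurable_fst.
Qed.

Lemma measurable_rV_uncons n : measurable_fun setT (@rV_uncons n).
Proof.
apply/measurable_fun_pair; first exact: measurable_coord.
apply: measurable_rVP => i; under eq_fun do rewrite mxE.
exact: measurable_coord.
Qed.

Definition rV_prod n (m : {sigma_finite_measure set 'rV[R]_n -> \bar R}) :
    set 'rV[R]_n.+1 -> \bar R :=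
  pushforward (@lebesgue_measure R \x m)%E (@rV_cons n).

Section rV_prod_measure.
Context n (m : {sigma_finite_measure set 'rV[R]_n -> \bar R}).
Local Open Scope ereal_scope.

Let mcons A : measurable A -> measurable (@rV_cons n @^-1` A).
Proof.
by move=> mA; rewrite -[X in measurable X]setTI; exact: measurable_rV_cons.
Qed.

Let rV_prod0 : rV_prod m set0 = 0.
Proof. by rewrite /rV_prod /pushforward preimage_set0 measure0. Qed.

Let rV_prod_ge0 A : 0 <= rV_prod m A.
Proof. by rewrite /rV_prod /pushforward. Qed.

Let rV_prod_sigma_additive : semi_sigma_additive (rV_prod m).
Proof.
move=> F mF tF mUF; rewrite /rV_prod /pushforward preimage_bigcup.
apply: measure_semi_sigma_additive.
- by move=> k; exact: mcons.
- apply/trivIsetP => /= i j _ _ ij; rewrite -preimage_setI.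
  by move/trivIsetP : tF => /(_ _ _ _ _ ij) ->//; rewrite preimage_set0.
- by rewrite -preimage_bigcup; exact: mcons.
Qed.

HB.instance Definition _ := isMeasure.Build _ _ _ (rV_prod m)
  rV_prod0 rV_prod_ge0 rV_prod_sigma_additive.

Let rV_prod_sigma_finite : sigma_finite setT (rV_prod m).
Proof.
have /sigma_finiteP[F [TF ndF Foo]] := sigma_finiteT (@lebesgue_measure R).
have /sigma_finiteP[G [TG ndG Goo]] := sigma_finiteT m.
exists (fun k => @rV_uncons n @^-1` (F k `*` G k)).
  rewrite -preimage_bigcup (_ : \bigcup_k _ = setT) ?preimage_setT//.
  rewrite -setXTT TF TG predeqE => -[x y]; split.
    by move=> [k _ []/= ? ?]; split; exists k.
  move=> [/= [i _ Fix] [k _ Gky]]; exists (maxn i k) => //; split.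
  - by move: x Fix; exact/subsetPset/ndF/leq_maxl.
  - by move: y Gky; exact/subsetPset/ndG/leq_maxr.
move=> k; have [? ?] := Foo k; have [? ?] := Goo k; split.
  rewrite -[X in measurable X]setTI; apply: measurable_rV_uncons => //.
  exact: measurableX.
rewrite /rV_prod /pushforward -comp_preimage.
have -> : @rV_uncons n \o @rV_cons n = id.
  by apply/funext => p; exact: rV_uncons_cons.
by rewrite preimage_id product_measure1E// lte_mul_pinfty// ge0_fin_numE.
Qed.

HB.instance Definition _ := Measure_isSigmaFinite.Build _ _ _ (rV_prod m)
  rV_prod_sigma_finite.

End rV_prod_measure.

(* Lebesgue measure on R^n, as the n-fold product of the one on R. *)
Fixpoint lebesgue_rV n : {sigma_finite_measure set 'rV[R]_n -> \bar R} :=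
  match n with
  | 0 => dirac (0 : 'rV[R]_0)
  | n'.+1 => rV_prod (lebesgue_rV n')
  end.

Lemma lebesgue_rV_box n (A : 'I_n -> set R) :
  (forall i, measurable (A i)) ->
  lebesgue_rV n [set x | forall i, A i (x 0 i)] =
  (\prod_(i < n) lebesgue_measure (A i))%E.
Proof.
elim: n A => [|n IH] A mA /=.
  rewrite big_ord0 /dirac/= indicE mem_set// => -[]//.
have mbox : measurable [set x : 'rV[R]_n | forall i, A (lift 0 i) (x 0 i)].
  rewrite (_ : [set _ | _] = \bigcap_(i in [set: 'I_n])
     ((fun x : 'rV[R]_n => x 0 i) @^-1` A (lift 0 i))).
    apply: fin_bigcap_measurable => // i _.
    by rewrite -[X in measurable X]setTI; exact: measurable_coord.
  by apply/seteqP; split=> x /= h i; [move=> _; exact: h | exact: h].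
rewrite big_ord_recl -IH// -product_measure1E//; last exact: mA.
rewrite /rV_prod /pushforward.
congr (_ _); apply/seteqP; split=> -[a v] /= h.
- split=> /= [|i]; first by have := h 0; rewrite rV_consE0.
  by have := h (lift 0 i); rewrite rV_consES.
- case: h => /= h0 h1 i; case: (unliftP 0 i) => [j|] ->.
    by rewrite rV_consES.
  by rewrite rV_consE0.
Qed.

End lebesgue_rV.

Section domains.
Context (R : realType) (N : nat).
Implicit Types (Omega : set 'rV[R]_N).

(* Near each boundary point, after an orthogonal change of coordinates, Omega
   is the strict epigraph, in some coordinate direction k, of a Lipschitz
   function of the remaining coordinates. *)
Definition lipschitz_boundary Omega :=
  forall x, (closure Omega `\` Omega°) x ->
  exists (P : 'M[R]_N) (k : 'I_N) (g : 'rV[R]_N.-1 -> R),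
    [/\ P *m P^T = 1%:M,
        lipschitz g &
        \forall z \near x,
          Omega z <-> g (col' k (z *m P)) < (z *m P) 0 k].

Definition lipschitz_domain Omega :=
  [/\ open Omega, connected Omega, bounded_set Omega &
      lipschitz_boundary Omega].

End domains.

Section calculus.
Context (R : realType) (N : nat).

Definition partial (i : 'I_N) (u : 'rV[R]_N -> R) : 'rV[R]_N -> R :=
  fun x => 'D_(delta_mx 0 i) u x.

Definition grad (u : 'rV[R]_N -> R) : 'rV[R]_N -> 'cV[R]_N :=
  fun x => \col_i partial i u x.

Definition divergence (v : 'rV[R]_N -> 'cV[R]_N) : 'rV[R]_N -> R :=
  fun x => \sum_i partial i (fun z => v z i 0) x.

Definition C1 (u : 'rV[R]_N -> R) :=
  (forall x, differentiable u x) /\ (forall i, continuous (partial i u)).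

(* All iterated partial derivatives are differentiable, hence continuous. *)
Definition smooth (u : 'rV[R]_N -> R) :=
  forall (s : seq 'I_N) x, differentiable (foldr partial u s) x.

Definition compact_support_in (V : nmodType) (Omega : set 'rV[R]_N)
    (u : 'rV[R]_N -> V) :=
  compact (closure [set x | u x != 0]) /\ closure [set x | u x != 0] `<=` Omega.

Definition C0infty (Omega : set 'rV[R]_N) : set ('rV[R]_N -> R) :=
  [set phi | smooth phi /\ compact_support_in Omega phi].

Definition C01_vec (Omega : set 'rV[R]_N) : set ('rV[R]_N -> 'cV[R]_N) :=
  [set v | (forall i, C1 (fun x => v x i 0)) /\ compact_support_in Omega v].

Definition dot (u v : 'cV[R]_N) : R := \sum_i u i 0 * v i 0.

Definition enorm (u : 'cV[R]_N) : R := Num.sqrt (dot u u).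

End calculus.

Section spaces.
Context (R : realType) (N : nat) (Omega : set 'rV[R]_N).
Local Notation mu := (lebesgue_rV R N).
Local Notation scalar_field := ('rV[R]_N -> R).
Local Notation vector_field := ('rV[R]_N -> 'cV[R]_N).
Local Notation matrix_field := ('rV[R]_N -> 'M[R]_N).

Definition ae_in (P : 'rV[R]_N -> Prop) :=
  {ae mu, forall x, Omega x -> P x}.

(* Elements of Lebesgue spaces are represented by functions on R^N; only their
   values almost everywhere in Omega matter. *)
Definition Lp (p : \bar R) : set scalar_field :=
  [set u | u \_ Omega \in Lfun mu p].

Definition Lp_vec (p : \bar R) : set vector_field :=
  [set v | forall i, Lp p (fun x => v x i 0)].

Definition Lp_mx (p : \bar R) : set matrix_field :=
  [set A | forall i j, Lp p (fun x => A x i j)].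

Definition L2norm (u : scalar_field) : R :=
  Num.sqrt (\int[mu]_(x in Omega) (u x ^+ 2)).

Definition L2norm_mx (A : matrix_field) : R :=
  Num.sqrt (\int[mu]_(x in Omega) (\sum_i \sum_j A x i j ^+ 2)).

Definition L2_skew : set matrix_field :=
  [set A | Lp_mx 2%:E A /\ ae_in (fun x => (A x)^T = - A x)].

Definition Linfty_sym : set matrix_field :=
  [set A | Lp_mx +oo A /\ ae_in (fun x => (A x)^T = A x)].

End spaces.

(* The L^2 topology on matrix fields: U is open if it contains an L^2 ball
   (within L^2) around each of its elements that lie in L^2. *)
Definition L2_fields (R : realType) (N : nat) (Omega : set 'rV[R]_N) : Type :=
  'rV[R]_N -> 'M[R]_N.

Section L2_topology.
Context (R : realType) (N : nat) (Omega : set 'rV[R]_N).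

Definition L2_open (U : set (L2_fields Omega)) :=
  forall A, U A -> Lp_mx Omega 2%:E A ->
  exists2 e : R, 0 < e &
    forall B, Lp_mx Omega 2%:E B -> L2norm_mx Omega (B - A) < e -> U B.

Let L2_openT : L2_open setT.
Proof. by move=> A _ _; exists 1. Qed.

Let L2_openI : setI_closed L2_open.
Proof.
move=> U V oU oV A [UA VA] A2.
have [e e0 eU] := oU A UA A2; have [d d0 dV] := oV A VA A2.
exists (Num.min e d); first by rewrite lt_min e0 d0.
by move=> B B2; rewrite lt_min => /andP[Be Bd]; split; [exact: eU | exact: dV].
Qed.

Let L2_open_bigU (I : Type) (U : I -> set (L2_fields Omega)) :
  (forall i, L2_open (U i)) -> L2_open (\bigcup_i U i).
Proof.
move=> oU A [i _ UA] A2; have [e e0 eU] := oU i A UA A2.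
by exists e => // B B2 Be; exists i => //; exact: eU.
Qed.

HB.instance Definition _ := Choice.on (L2_fields Omega).
HB.instance Definition _ := Pointed.on (L2_fields Omega).
HB.instance Definition _ :=
  isOpenTopological.Build (L2_fields Omega) L2_openT L2_openI L2_open_bigU.

End L2_topology.

(* A Sobolev function u is represented by the pair (u.1, u.2) formed by the
   function and its weak gradient. *)
Notation sobolev R N :=
  (('rV[R]_N -> R) * ('rV[R]_N -> 'cV[R]_N))%type (only parsing).

Section sobolev_space.
Context (R : realType) (N : nat) (Omega : set 'rV[R]_N).
Local Notation mu := (lebesgue_rV R N).
Local Notation matrix_field := ('rV[R]_N -> 'M[R]_N).
Local Notation sobolev := (sobolev R N).
Implicit Types (u v y psi : sobolev) (A B : matrix_field).

Definition with_grad (phi : 'rV[R]_N -> R) : sobolev := (phi, grad phi).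

(* (int_Omega |grad u|^2)^(1/2) *)
Definition H10norm u : R :=
  Num.sqrt (\int[mu]_(x in Omega) (enorm (u.2 x) ^+ 2)).

(* The closure in L^2 x (L^2)^N of the pairs (phi, grad phi), for phi smooth
   with compact support in Omega. In particular u.2 is determined, up to a
   null set, by u.1 as its weak gradient. *)
Definition H10 : set sobolev :=
  [set u | [/\ Lp Omega 2%:E u.1, Lp_vec Omega 2%:E u.2 &
    exists phi : nat -> 'rV[R]_N -> R,
      [/\ forall n, C0infty Omega (phi n),
          (fun n => L2norm Omega (phi n - u.1)) @ \oo --> (0 : R) &
          (fun n => H10norm (with_grad (phi n) - u)) @ \oo --> (0 : R)]]].

(* H^{-1}(Omega), the dual of H^1_0(Omega) *)
Definition Hm1 : set (sobolev -> R) :=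
  [set f | (forall (a : R) u v, H10 u -> H10 v ->
              f (a *: u + v) = a * f u + f v) /\
           (exists C : R, forall u, H10 u -> `|f u| <= C * H10norm u)].

(* weak convergence in H^1_0(Omega) as theta -> 0+ *)
Definition weak_cvg0 (y : R -> sobolev) y0 :=
  forall f, Hm1 f -> f (y theta) @[theta --> 0^'+] --> f y0.

Definition relatively_compact0 (psi : R -> sobolev) :=
  forall t : nat -> R, (forall n, 0 < t n <= 1) -> t @ \oo --> (0 : R) ->
  exists (s : nat -> nat) (psibar : sobolev),
    [/\ {homo s : m n / (m < n)%N}, H10 psibar &
        (fun n => H10norm (psi (t (s n)) - psibar)) @ \oo --> (0 : R)].

Definition sym_part A : matrix_field := fun x => 2^-1 *: (A x + (A x)^T).
Definition skew_part A : matrix_field := fun x => 2^-1 *: (A x - (A x)^T).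

(* int_Omega (grad u, A grad v) *)
Definition bform A u v : R :=
  \int[mu]_(x in Omega) dot (u.2 x) (A x *m v.2 x).

Definition Dom A : set sobolev :=
  [set y | H10 y /\ exists c : R, forall phi, C0infty Omega phi ->
     `|bform (skew_part A) (with_grad phi) y| <= c * H10norm (with_grad phi)].

(* [y, phi]_A: the value at phi in H^1_0 of the continuous extension of the
   functional bform (skew_part A) _ y from the test functions *)
Definition bracket A y (phi : sobolev) : R :=
  xget 0 [set r : R | forall phin : nat -> 'rV[R]_N -> R,
    (forall n, C0infty Omega (phin n)) ->
    (fun n => H10norm (with_grad (phin n) - phi)) @ \oo --> (0 : R) ->
    (fun n => bform (skew_part A) (with_grad (phin n)) y) @ \oo --> r].

Definition weak_solution (f : sobolev -> R) A y :=
  H10 y /\ forall phi, C0infty Omega phi ->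
    bform A (with_grad phi) y = f (with_grad phi).

Definition TV (a : 'rV[R]_N -> R) : \bar R :=
  ereal_sup [set (\int[mu]_(x in Omega) (a x * divergence phi x))%:E |
    phi in C01_vec Omega `&` [set phi | forall x, enorm (phi x) <= 1]].

Definition preceq B A :=
  forall i j : 'I_N, (i < j)%N -> ae_in Omega (fun x => `|B x i j| <= `|A x i j|).

Definition Aad1 (alpha beta c : R) : set matrix_field :=
  [set A | [/\ Linfty_sym Omega A,
    ae_in Omega (fun x => forall xi : 'cV[R]_N,
      alpha * dot xi xi <= dot xi (A x *m xi) <= beta * dot xi xi) &
    forall i j : 'I_N, (i <= j)%N -> (TV (fun x => A x i j) <= c%:E)%E]].

Definition Aad2 (Astar : matrix_field) (Q : set matrix_field) :
    set matrix_field :=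
  [set B | Q B /\ preceq B Astar].

Definition Aad alpha beta c Astar Q : set matrix_field :=
  [set A | [/\ Lp_mx Omega 2%:E A,
    Aad1 alpha beta c (sym_part A) & Aad2 Astar Q (skew_part A)]].

(* Q is given as a set of functions, so it must be stable under modification
   on null sets to stand for a set of elements of L^2. *)
Definition admissible_Q (Q : set matrix_field) :=
  [/\ Q `<=` L2_skew Omega,
      forall A B, Q A -> L2_skew Omega B -> ae_in Omega (fun x => A x = B x) ->
        Q B,
      convex_set (Q : set (convex_lmodType matrix_field)),
      compact (Q : set (L2_fields Omega)) &
      Q (fun=> 0)].

Definition Xi (f : sobolev -> R) (ad : set matrix_field) :
    set (matrix_field * sobolev) :=
  [set p | [/\ ad p.1, Dom p.1 p.2 & weak_solution f p.1 p.2]].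

Definition cost (yd : 'rV[R]_N -> R) (p : matrix_field * sobolev) : R :=
  L2norm Omega (p.2.1 - yd) ^+ 2 + bform (sym_part p.1) p.2 p.2.

Definition quasi_adjoint (lambda : R) yd A y psi :=
  H10 psi /\ forall phi, H10 phi ->
    \int[mu]_(x in Omega)
      dot (phi.2 x) (sym_part A x *m psi.2 x - skew_part A x *m psi.2 x) =
    - 2 * lambda * (\int[mu]_(x in Omega) ((y.1 x - yd x) * phi.1 x))
    - 2 * lambda * bform (sym_part A) phi y.

End sobolev_space.

(* Main.v *)
Require Import Defs.
From HB Require Import structures.
From mathcomp Require Import all_boot all_order all_algebra.
From mathcomp Require Import all_classical all_reals all_analysis.
From mathcomp Require Import measurable_realfun ess_sup_inf ring lra.
Import Order.TTheory GRing.Theory Num.Theory.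
Import numFieldNormedType.Exports.
Local Open Scope classical_set_scope.
Local Open Scope ring_scope.
Set Implicit Arguments.
Unset Strict Implicit.
Unset Printing Implicit Defensive.

(** The integrability alternative in (iii) bounds the products of the entries of
    A* with all translates of the gradient of a quasi-adjoint state psi in L^2.
    Hence shifting psi into the domain, locally along the Lipschitz boundary,
    and mollifying produces test functions phi that approximate psi in H^1_0
    and for which moreover int (grad phi - grad psi, A^skew grad w) tends to 0,
    for every w in D(A). This identifies the abstract extension:
    [w, psi]_A = int (grad psi, A^skew grad w) = - int (grad w, A^skew grad psi).

    Take lambda = 1 and let psi be the state given by (iii) for A^ = A_0 at
    theta = 0. For A^ admissible put w = y(A_theta) - y_0. Let chi be the
    difference of the quasi-adjoint states at theta for eps = 1 and eps = 0;
    testing its equation with w and with chi gives ||w|| = O(theta). Testing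
    the equation of psi with w and the equation of w with psi turns
    I(A_0, y_0) <= I(A_theta, y(A_theta)) into 0 <= theta E + O(theta^2), where
    E is the difference of the two sides of the third conclusion. *)

(** * Lebesgue measure on R^n *)

(** The bracket [[w, w]_A] blocks the obvious energy estimate for the increment [w]: the skew part
    is unbounded, and for [w] merely in D(A) skew-symmetry does not make it vanish. Only against a
    state with a regular gradient is the bracket an integral in which the skew matrix can change
    sides. Hence the duality: the states for eps = 1 and eps = 0 solve adjoint equations whose data
    differ by exactly [w], so pairing their difference with [w] produces the energy of [w] without
    any bracket of [w] with itself.

    The approximation is delicate because A^skew grad w is only integrable. A shift moves the
    gradient of psi but not the weight it is multiplied with, so an L^2 bound on the product alone
    would not do, and one for all translates is carried along. Poincare's inequality, proved as a
    pointwise bound by averages along lines, gives psi itself such a bound, as the cutoff terms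
    require. Test functions close to psi in H^1_0 need not be close against A^skew grad w; averaging
    them with a kernel fixed beforehand turns their L^2 error into a uniform one. *)

Section rV_measurability.
Context (R : realType).

Lemma measurable_box n (q : 'rV[R]_n) (r : R) :
  measurable [set x : 'rV[R]_n | forall i, `|x 0 i - q 0 i| < r].
Proof.
rewrite (_ : [set _ | _] = \bigcap_(i in [set: 'I_n])
   ((fun x : 'rV[R]_n => x 0 i) @^-1` [set t | `|t - q 0 i| < r])).
  apply: fin_bigcap_measurable => // i _.
  rewrite -[X in measurable X]setTI; apply: measurable_coord => //.
  rewrite (_ : [set t | _] = `]q 0 i - r, q 0 i + r[%classic).
    exact: measurable_itv.
  by apply/seteqP; split=> t /=; rewrite in_itv/= ltr_distl.
by apply/seteqP; split=> x /= h i; [move=> _; exact: h | exact: h].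
Qed.

Lemma rV_normP n (x : 'rV[R]_n) (r : R) : 0 < r ->
  (`|x| < r) <-> (forall i, `|x 0 i| < r).
Proof.
move=> r0; split=> [xr i|h].
  apply: le_lt_trans xr; rewrite [leRHS]/Num.norm/= mx_normrE.
  by apply/bigmax_geP; right => /=; exists (0, i).
rewrite [ltLHS]/Num.norm/= mx_normrE; apply/bigmax_ltP; split => //= -[i j] _.
by rewrite ord1.
Qed.

Lemma rV_norm_leP n (x : 'rV[R]_n) (r : R) : 0 <= r ->
  (`|x| <= r) <-> (forall i, `|x 0 i| <= r).
Proof.
move=> r0; split=> [xr i|h].
  apply: le_trans xr; rewrite [leRHS]/Num.norm/= mx_normrE.
  by apply/bigmax_geP; right => /=; exists (0, i).
rewrite [leLHS]/Num.norm/= mx_normrE; apply/bigmax_leP; split => //= -[i j] _.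
by rewrite ord1.
Qed.

Lemma le_norm_coord n (x : 'rV[R]_n) i : `|x 0 i| <= `|x|.
Proof. by have /(rV_norm_leP x (normr_ge0 _)) := lexx `|x|; apply. Qed.

(** The measurable sets are generated by the coordinates, so an open set is written as the union of
    the countably many cubes with rational centre and radius that it contains. *)
Lemma open_measurable_rV n (U : set 'rV[R]_n) : open U -> measurable U.
Proof.
move=> oU.
pose box (p : 'rV[rat]_n * rat) : set 'rV[R]_n :=
  [set x | forall i, `|x 0 i - ratr (p.1 0 i)| < ratr p.2].
have mbox p : measurable (box p).
  have := measurable_box (\row_i (ratr (p.1 0 i) : R)) (ratr p.2).
  congr measurable; apply/seteqP; split=> x /= h i; have := h i; by rewrite mxE.
rewrite (_ : U = \bigcup_p if `[< box p `<=` U >] then box p else set0).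
  apply: countable_bigcupT_measurable => //.
  by move=> p; case: ifP.
apply/seteqP; split=> [x Ux|x [p _]]; last first.
  by case: ifPn => // /asboolP; apply.
have /nbhs_ballP[e /= e0 xe] := open_nbhs_nbhs (conj oU Ux).
(* A rational radius below [e / 2] and a rational centre within that radius of [x]: the cube
   contains [x] and stays in the ball of radius [e]. *)
have e2 : 0 < e / 2 by rewrite divr_gt0.
have [r /= ] := rat_in_itvoo e2; rewrite in_itv/= => /andP[r0 re].
have H i : exists q, x 0 i - ratr r < ratr q < x 0 i + ratr r.
  have [|q] := @rat_in_itvoo R (x 0 i - ratr r) (x 0 i + ratr r).
    by rewrite ltrBlDr -addrA ltrDl addr_gt0.
  by rewrite in_itv/=; exists q.
pose q : 'rV[rat]_n := \row_i sval (cid (H i)).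
have qx i : `|x 0 i - ratr (q 0 i)| < ratr r.
  rewrite mxE; case: cid => /= z /andP[z1 z2].
  by rewrite ltr_distl ltrBlDr z2 /= -ltrBlDr.
exists (q, r) => //; rewrite asboolT//.
move=> y yq; apply: xe; rewrite mx_norm_ball /ball_ /=.
apply/rV_normP => // i; rewrite !mxE.
rewrite (_ : _ - _ = x 0 i - ratr (q 0 i) - (y 0 i - ratr (q 0 i))); last by ring.
apply: (le_lt_trans (ler_normB _ _)).
have := ltrD (qx i) (yq i) => /lt_trans; apply.
by have := ltrD re re; rewrite -splitr.
Qed.

Lemma continuous_measurable_rV n (f : 'rV[R]_n -> R) :
  continuous f -> measurable_fun setT f.
Proof.
move=> /continuousP cf; apply: (measurability _ (RGenOpens.measurableE R)).
move=> _ [_ [a [b ->] <-]]; rewrite setTI; apply: open_measurable_rV.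
exact/cf/interval_open.
Qed.

Lemma measurable_shift_rV n (s : 'rV[R]_n) :
  measurable_fun setT (fun x : 'rV[R]_n => x + s).
Proof.
apply: measurable_rVP => i; under eq_fun do rewrite mxE.
by apply: measurable_funD => //; exact: measurable_coord.
Qed.

Lemma measurable_add_rV n :
  measurable_fun setT (fun p : 'rV[R]_n * 'rV[R]_n => p.1 + p.2).
Proof.
apply: measurable_rVP => i; under eq_fun do rewrite mxE.
apply: measurable_funD.
  exact: (measurableT_comp (measurable_coord i) measurable_fst).
exact: (measurableT_comp (measurable_coord i) measurable_snd).
Qed.

Lemma measurable_scale_rV n (v : 'rV[R]_n) :
  measurable_fun setT (fun t : R => t *: v).
Proof.
apply: measurable_rVP => i; under eq_fun do rewrite mxE.
by apply: measurable_funM.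
Qed.

(** Half-open intervals determine Lebesgue measure, and both measures agree on them. *)
Lemma lebesgue_measure_shift (s : R) (A : set R) : measurable A ->
  pushforward lebesgue_measure ((fun x => x + s) : R -> measurableTypeR R) A =
  lebesgue_measure A.
Proof.
have ms : measurable_fun setT ((fun x => x + s) : R -> measurableTypeR R).
  exact: measurable_funD.
pose m := isMeasurableFun.Build _ _ _ _ _ ms.
pose M : {mfun _ >-> _} := HB.pack ((fun x => x + s) : R -> measurableTypeR R) m.
move=> mA; apply/esym.
apply: (@lebesgue_measure_unique _ (pushforward lebesgue_measure M)) => //= _ [[a b]] _ <-.
rewrite /pushforward/= (_ : _ @^-1` _ = `]a - s, b - s]%classic); last first.
  by apply/seteqP; split=> t /=; rewrite !in_itv/= ltrBlDr lerBrDr.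
rewrite !lebesgue_measure_itv/= !lte_fin ltrD2r.
by case: ifP => // _; congr EFin; ring.
Qed.

(** Induction on the dimension through the product structure: the induction hypothesis treats each
    section, translation invariance on the line treats the base. *)
Lemma lebesgue_rV_shift n (s : 'rV[R]_n) (A : set 'rV[R]_n) : measurable A ->
  lebesgue_rV R n ((fun x => x + s) @^-1` A) = lebesgue_rV R n A.
Proof.
elim: n s A => [|n IH] s A mA.
  rewrite (_ : _ @^-1` _ = A)//; apply/seteqP.
  by split=> x /=; rewrite (_ : x + s = x)//; apply/rowP => -[].
rewrite /= /rV_prod /pushforward.
set B := @rV_cons R n @^-1` A.
have mB : measurable B.
  by rewrite -[X in measurable X]setTI; exact: measurable_rV_cons.
set s' : 'rV[R]_n := \row_i s 0 (lift 0 i).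
rewrite (_ : _ @^-1` _ = (fun p => (p.1 + s 0 0, p.2 + s')) @^-1` B); last first.
  apply/seteqP; split=> -[a v] /=; rewrite /B/=;
  rewrite (_ : rV_cons (_, _) + s = rV_cons (a + s 0 0, v + s'))//;
    apply/rowP => i; case: (unliftP 0 i) => [j|] ->;
    by rewrite mxE ?rV_consES ?rV_consE0/= ?mxE.
have m2 : measurable_fun setT (fun p : R * 'rV[R]_n => (p.1 + s 0 0, p.2 + s')).
  apply/measurable_fun_pair; first by apply: measurable_funD.
  exact: (measurableT_comp (measurable_shift_rV s') measurable_snd).
rewrite /product_measure1/=.
transitivity (\int[lebesgue_measure]_x
   ((lebesgue_rV R n \o xsection B) ((x : R) + s 0 0)%R))%E.
  apply: eq_integral => a _ /=.
  rewrite -(IH s' (xsection B _)); last exact: measurable_xsection.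
  congr (_ _).
set g := (lebesgue_rV R n \o xsection B).
have mg : measurable_fun setT g by exact: measurable_fun_xsection.
have ms : measurable_fun setT ((fun x => x + s 0 0) : R -> measurableTypeR R).
  exact: measurable_funD.
pose sh : R -> measurableTypeR R := fun x => x + s 0 0.
transitivity (\int[pushforward lebesgue_measure sh]_y g y)%E.
  by rewrite ge0_integral_pushforward.
apply: eq_measure_integral => C mC _.
exact: lebesgue_measure_shift.
Qed.

Lemma ge0_integral_shift_rV n (s : 'rV[R]_n) (f : 'rV[R]_n -> \bar R) :
  measurable_fun setT f -> (forall x, 0 <= f x)%E ->
  (\int[lebesgue_rV R n]_x f (x + s)%R = \int[lebesgue_rV R n]_x f x)%E.
Proof.
move=> mf f0.
pose sh (x : 'rV[R]_n) := x + s.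
transitivity (\int[pushforward (lebesgue_rV R n) sh]_y f y)%E.
  rewrite ge0_integral_pushforward//; exact: measurable_shift_rV.
apply: eq_measure_integral => [|msh C mC _]; first exact: measurable_shift_rV.
exact: lebesgue_rV_shift.
Qed.

Lemma measurable_ball_rV n (x : 'rV[R]_n) (r : R) : measurable (ball x r).
Proof. by apply: open_measurable_rV; exact: ball_open. Qed.

(** The norm is the sup norm, so balls are cubes of side [2 * r]. *)
Lemma lebesgue_rV_ball n (x : 'rV[R]_n) (r : R) : 0 < r ->
  lebesgue_rV R n (ball x r) = ((2 * r) ^+ n)%:E.
Proof.
move=> r0.
pose I i := `]x 0 i - r, x 0 i + r[%classic.
rewrite (_ : ball x r = [set y | forall i, I i (y 0 i)]).
  rewrite lebesgue_rV_box => [|i]; last exact: measurable_itv.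
  rewrite (eq_bigr (fun=> (2 * r)%:E)) => [|i _].
    by rewrite prodEFin prodr_const card_ord.
  rewrite lebesgue_measure_itv/= lte_fin ltrBlDr -addrA ltrDl addr_gt0//.
  by congr EFin; ring.
apply/seteqP; split=> y /=; rewrite mx_norm_ball /ball_/=.
  by move/rV_normP => /(_ r0) h i; have := h i; rewrite /I/= !mxE in_itv/= distrC ltr_distl.
by move=> h; apply/rV_normP => // i; have := h i; rewrite /I/= !mxE in_itv/= distrC ltr_distl.
Qed.

Lemma bounded_lebesgue_rV_fin n (A : set 'rV[R]_n) : measurable A ->
  bounded_set A -> (lebesgue_rV R n A < +oo)%E.
Proof.
move=> mA [M [_ /(_ (`|M| + 1))]]; rewrite (le_lt_trans (ler_norm M)) ?ltrDl//.
move=> /(_ isT) hA.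
apply: (@le_lt_trans _ _ (lebesgue_rV R n (ball 0 (`|M| + 2)))).
  apply: le_measure; rewrite ?inE//; first exact: measurable_ball_rV.
  move=> x /hA /=; rewrite mx_norm_ball /ball_/= sub0r normrN => /le_lt_trans.
  by apply; rewrite ltrD2l ltr1n.
by rewrite lebesgue_rV_ball ?ltry// ltr_wpDl.
Qed.

End rV_measurability.

(** * Averages against a nonnegative kernel *)

Section averaging.
Context (R : realType).
Local Open Scope ereal_scope.

(** Hölder's inequality with both exponents 2, kept in the extended reals so that it applies before
    anything is known to be finite. *)
Lemma le_sqr_integralM d (T : measurableType d) (nu : {measure set T -> \bar R})
    (f g : T -> R) : measurable_fun setT f -> measurable_fun setT g ->
  (\int[nu]_t `|f t * g t|%:E) ^+ 2 <=
  \int[nu]_t (f t ^+ 2)%:E * \int[nu]_t (g t ^+ 2)%:E.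
Proof.
move=> mf mg.
have N2 h : measurable_fun setT h ->
    'N[nu]_2%:E[EFin \o h] ^+ 2 = \int[nu]_t (h t ^+ 2)%:E.
  move=> mh; rewrite -[LHS](_ : 'N[nu]_2%:E[EFin \o h] `^ 2 = _).
    rewrite powR_Lnorm//; apply: eq_integral => t _ /=.
    by rewrite powR_mulrn// real_normK// num_real.
  have := Lnorm_ge0 nu 2%:E (EFin \o h).
  case: ('N[nu]_2%:E[EFin \o h]) => [r r0|_|//]; last first. by rewrite poweRyr// expe2 mulyy.
  by rewrite poweR_EFin powR_mulrn// EFin_expe.
rewrite -(N2 f)// -(N2 g)//.
have -> : \int[nu]_t `|f t * g t|%:E = 'N[nu]_1[EFin \o (f \* g)%R].
  by rewrite Lnorm1.
have h : 'N[nu]_1[EFin \o (f \* g)%R] <=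
    'N[nu]_2%:E[EFin \o f] * 'N[nu]_2%:E[EFin \o g].
  by apply: hoelder => //; rewrite [RHS]splitr !div1r.
rewrite !expe2 muleACA; apply: lee_pmul => //; exact: Lnorm_ge0.
Qed.

(** Tonelli moves the bound on each slice under the kernel. The bound is asked only where the kernel
    does not vanish, so that it can be a statement about small translations. *)
Lemma ge0_integral_kernel_le d1 d2 (X : measurableType d1) (T : measurableType d2)
    (mu : {sigma_finite_measure set X -> \bar R})
    (nu : {sigma_finite_measure set T -> \bar R})
    (kap : T -> R) (m C : R) (H : X * T -> R) :
  measurable_fun setT kap -> (forall t, (0 <= kap t)%R) ->
  \int[nu]_t (kap t)%:E = m%:E -> (0 <= C)%R ->
  measurable_fun setT H -> (forall p, (0 <= H p)%R) ->
  (forall t, kap t != 0%R -> \int[mu]_x (H (x, t))%:E <= C%:E) ->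
  \int[mu]_x \int[nu]_t (kap t * H (x, t))%:E <= (m * C)%:E.
Proof.
move=> mk k0 km C0 mH H0 HC.
pose F (p : X * T) := (kap p.2 * H p)%:E.
have F0 p : 0 <= F p by rewrite lee_fin mulr_ge0.
have mF : measurable_fun setT F.
  apply/measurable_EFinP; apply: measurable_funM => //.
  exact: (measurableT_comp mk measurable_snd).
rewrite (@fubini_tonelli _ _ _ _ _ _ _ F)//.
apply: (@le_trans _ _ (\int[nu]_t ((kap t)%:E * C%:E))).
  apply: ge0_le_integral => //.
  - by move=> t _; apply: integral_ge0 => x _.
  - exact: (@measurable_fun_fubini_tonelli_G _ _ _ _ _ _ F).
  - by apply: emeasurable_funM => //; exact/measurable_EFinP.
  - move=> t _; rewrite [leLHS](_ : _ = (kap t)%:E * \int[mu]_x (H (x, t))%:E).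
      have [->|kt] := eqVneq (kap t) 0%R; first by rewrite !mul0e.
      by rewrite lee_wpmul2l ?lee_fin// HC.
    rewrite -ge0_integralZl_EFin//.
    + by move=> x _; rewrite lee_fin.
    + by apply/measurable_EFinP; exact: measurableT_comp.
rewrite ge0_integralZr// ?km ?EFinM//.
- exact/measurable_EFinP.
- by move=> t _; rewrite lee_fin.
Qed.

(** With [kap] split into two square roots, Cauchy-Schwarz bounds the squared average by [m] times
    the average of the squares, and Tonelli does the rest. The weight [a] stays at the unaveraged
    point: bounds on the translates of a function against [a] thus pass to its averages. *)
Lemma ge0_sqr_integral_kernel_le d1 d2 (X : measurableType d1)
    (T : measurableType d2) (mu : {sigma_finite_measure set X -> \bar R})
    (nu : {sigma_finite_measure set T -> \bar R})
    (kap : T -> R) (m C : R) (a : X -> R) (H : X * T -> R) :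
  measurable_fun setT kap -> (forall t, (0 <= kap t)%R) ->
  \int[nu]_t (kap t)%:E = m%:E -> (0 <= C)%R ->
  measurable_fun setT a ->
  measurable_fun setT H -> (forall p, (0 <= H p)%R) ->
  (forall t, kap t != 0%R -> \int[mu]_x ((a x * H (x, t)) ^+ 2)%:E <= C%:E) ->
  \int[mu]_x ((a x ^+ 2)%:E * (\int[nu]_t (kap t * H (x, t))%:E) ^+ 2)
  <= (m ^+ 2 * C)%:E.
Proof.
move=> mk k0 km C0 ma mH H0 HC.
have m0 : (0 <= m)%R.
  by rewrite -lee_fin -km; apply: integral_ge0 => t _; rewrite lee_fin.
have mk2 : measurable_fun setT (fun p : X * T => kap p.2).
  exact: (measurableT_comp mk measurable_snd).
have ma1 : measurable_fun setT (fun p : X * T => a p.1).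
  exact: (measurableT_comp ma measurable_fst).
have mHx x : measurable_fun setT (fun t => H (x, t)) by exact: measurableT_comp.
have mI (h : X * T -> R) : (forall p, (0 <= h p)%R) -> measurable_fun setT h ->
    measurable_fun setT (fun x => \int[nu]_t (h (x, t))%:E).
  move=> h0 mh.
  apply: (measurable_fun_fubini_tonelli_F (m2 := nu) (EFin \o h)).
    exact/measurable_EFinP.
  by move=> p; rewrite lee_fin.
have mI1 : measurable_fun setT (fun x => \int[nu]_t (kap t * H (x, t))%:E).
  apply: (mI (fun p => kap p.2 * H p)%R) => //.
  - by move=> p; rewrite mulr_ge0.
  - exact: measurable_funM.
have ma2 : measurable_fun setT (fun x => (a x ^+ 2)%:E).
  by apply/measurable_EFinP; exact: measurable_funX.
have CS x : (\int[nu]_t (kap t * H (x, t))%:E) ^+ 2 <=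
    m%:E * \int[nu]_t (kap t * H (x, t) ^+ 2)%:E.
  have ms : measurable_fun setT (fun t => Num.sqrt (kap t)).
    have msq : measurable_fun setT (@Num.sqrt R).
      apply: continuous_measurable_fun; exact: sqrt_continuous.
    exact: (measurableT_comp msq mk).
  have := @le_sqr_integralM _ T nu (fun t => Num.sqrt (kap t))
    (fun t => Num.sqrt (kap t) * H (x, t))%R ms (measurable_funM ms (mHx x)).
  have -> : \int[nu]_t `|Num.sqrt (kap t) * (Num.sqrt (kap t) * H (x, t))|%:E
      = \int[nu]_t (kap t * H (x, t))%R%:E.
    apply: eq_integral => t _; rewrite mulrA -expr2 sqr_sqrtr//.
    by rewrite ger0_norm// mulr_ge0.
  have -> : \int[nu]_t (Num.sqrt (kap t) ^+ 2)%:E = m%:E.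
    by rewrite -km; apply: eq_integral => t _; rewrite sqr_sqrtr.
  have -> // : \int[nu]_t ((Num.sqrt (kap t) * H (x, t)) ^+ 2)%R%:E
      = \int[nu]_t (kap t * H (x, t) ^+ 2)%:E.
  by apply: eq_integral => t _; rewrite exprMn sqr_sqrtr.
pose G (p : X * T) := ((a p.1 * H p) ^+ 2)%R.
have mG : measurable_fun setT G.
  by apply: measurable_funX; exact: measurable_funM.
have G0 p : (0 <= G p)%R by exact: sqr_ge0.
have := @ge0_integral_kernel_le _ _ _ _ mu nu kap m C G mk k0 km C0 mG G0 HC.
rewrite expr2 -mulrA [(m * (m * C))%:E]EFinM => h.
apply: (@le_trans _ _ (m%:E * \int[mu]_x \int[nu]_t (kap t * G (x, t))%:E)); last first.
  by rewrite lee_wpmul2l ?lee_fin.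
have mIG : measurable_fun setT (fun x => \int[nu]_t (kap t * G (x, t))%:E).
  apply: (mI (fun p => kap p.2 * G p)%R) => //.
  - by move=> p; rewrite mulr_ge0.
  - exact: measurable_funM.
have IG0 x : 0 <= \int[nu]_t (kap t * G (x, t))%:E.
  by apply: integral_ge0 => t _; rewrite lee_fin mulr_ge0.
rewrite -ge0_integralZl_EFin//.
apply: ge0_le_integral => //.
- by move=> x _; rewrite mule_ge0// ?lee_fin ?sqr_ge0// sqre_ge0.
- apply: emeasurable_funM => //.
  by under eq_fun do rewrite expe2; apply: emeasurable_funM.
- exact: emeasurable_funM.
- move=> x _; apply: (@le_trans _ _ ((a x ^+ 2)%:E *
    (m%:E * \int[nu]_t (kap t * H (x, t) ^+ 2)%:E))).
    by apply: lee_pmul => //; rewrite ?lee_fin ?sqr_ge0// sqre_ge0.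
  rewrite muleCA lee_pmul// ?lee_fin//.
    rewrite mule_ge0// ?lee_fin ?sqr_ge0// integral_ge0// => t _.
    by rewrite lee_fin mulr_ge0// sqr_ge0.
  rewrite -ge0_integralZl_EFin// ?sqr_ge0//.
  + rewrite le_eqVlt; apply/orP; left; apply/eqP.
    by apply: eq_integral => t _; rewrite -EFinM /G exprMn mulrCA.
  + by move=> t _; rewrite lee_fin mulr_ge0// sqr_ge0.
  + apply/measurable_EFinP; apply: measurable_funM => //.
    exact: measurable_funX.
Qed.

End averaging.

(** * Smooth functions and mollification *)

Section smooth_functions.
Context (R : realType) (N : nat).
Local Notation rV := 'rV[R]_N.
Implicit Types (u f g : rV -> R) (x h : rV).

Lemma le_norm_sum_coord (c : 'I_N -> R) h (K : R) : (forall i, `|c i| <= K) ->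
  `|\sum_i c i * h 0 i| <= N%:R * K * `|h|.
Proof.
move=> cK; apply: (le_trans (ler_norm_sum _ _ _)).
apply: (@le_trans _ _ (\sum_(i < N) K * `|h|)).
  apply: ler_sum => i _; rewrite normrM ler_pM//; exact: le_norm_coord.
by rewrite sumr_const card_ord -mulrA mulr_natl.
Qed.

(** A quadratic remainder is [o(h)], so one estimate yields differentiability and the partial
    derivatives together; such an estimate can moreover be integrated against a kernel. *)
Lemma differentiable_le_sqr u x (c : 'I_N -> R) (K : R) :
  (forall h, `|u (x + h) - u x - \sum_i c i * h 0 i| <= K * `|h| ^+ 2) ->
  differentiable u x /\ forall i, partial i u x = c i.
Proof.
move=> uK.
pose l h : R := \sum_i c i * h 0 i.
have l_lin : linear l.
  move=> a h k; rewrite /l scaler_sumr -big_split/=; apply: eq_bigr => i _.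
  by rewrite !mxE mulrDr; congr (_ + _); rewrite mulrCA.
pose lm := GRing.isLinear.Build _ _ _ _ l l_lin.
pose df : {linear rV -> R} := HB.pack l lm.
have dfc : continuous df.
  move=> y; apply: differentiable_continuous.
  rewrite (_ : (df : rV -> R) = \sum_(i < N) (c i *: (fun h : rV => h 0 i))).
    apply: differentiable_sum => i; apply: differentiableZ.
    exact: differentiable_coord.
  by apply/funext => h; rewrite fct_sumE.
have o : u \o shift x = cst (u x) + df +o_ (0 : rV) id.
  apply/eqaddoP => e e0; near=> h.
  have -> : (u \o shift x - (cst (u x) + df)) h =
      u (x + h) - u x - \sum_i c i * h 0 i.
    by rewrite -[LHS]/(u (h + x) - (u x + l h)) [h + x]addrC opprD addrA.
  apply: (le_trans (uK h)); rewrite expr2 mulrA ler_wpM2r//.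
  apply: (@le_trans _ _ (`|K| * `|h|)).
    by rewrite ler_wpM2r// ler_norm.
  apply: (@le_trans _ _ ((`|K| + 1) * `|h|)); first by rewrite ler_wpM2r// lerDl.
  rewrite mulrC -ler_pdivlMr ?ltr_wpDl//.
  near: h.
  have d0 : 0 < e / (`|K| + 1) by rewrite divr_gt0// ltr_wpDl.
  apply: filterS (nbhsx_ballx (0 : rV) _ d0) => z.
  by rewrite mx_norm_ball /ball_/= sub0r normrN => /ltW.
have dE := diff_unique dfc o.
have d : differentiable u x.
  by apply/diff_locallyP; rewrite dE; split.
split => // i; rewrite /partial deriveE// dE /= /l (bigD1 i)//= big1 ?addr0.
  by rewrite mxE !eqxx mulr1.
by move=> j ji; rewrite mxE eqxx (negbTE ji) mulr0.
Unshelve. all: by end_near. Qed.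

Lemma smooth_partial u i : smooth u -> smooth (partial i u).
Proof. by move=> su s x; have := su (rcons s i) x; rewrite foldr_rcons. Qed.

Lemma smooth_differentiable u x : smooth u -> differentiable u x.
Proof. by move=> /(_ [::] x). Qed.

(** Coinduction: a class of differentiable functions stable under partial derivatives contains all
    iterated derivatives of its members. Peeling [s] from the right exposes the derivative taken
    first. *)
Lemma smooth_coind (P : (rV -> R) -> Prop) :
  (forall u, P u -> forall x, differentiable u x) ->
  (forall u, P u -> forall i, P (partial i u)) ->
  forall u, P u -> smooth u.
Proof.
move=> Pd Pp u Pu s; elim/last_ind: s u Pu => [|s i IH] u Pu x /=; first exact: Pd.
by rewrite foldr_rcons; apply: IH; exact: Pp.
Qed.

(** A derivative of a product is a sum of products by the Leibniz rule, so sums and products are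
    closed up together to obtain a class to which [smooth_coind] applies. *)
Inductive smooth_alg : (rV -> R) -> Prop :=
| smooth_alg_base u of smooth u : smooth_alg u
| smooth_alg_add f g of smooth_alg f & smooth_alg g : smooth_alg (f + g)
| smooth_alg_mul f g of smooth_alg f & smooth_alg g : smooth_alg (f * g).

Lemma smooth_alg_differentiable u : smooth_alg u -> forall x, differentiable u x.
Proof.
elim=> {u}[u su x|f g _ df _ dg x|f g _ df _ dg x].
- exact: smooth_differentiable.
- exact: differentiableD.
- exact: differentiableM.
Qed.

Lemma partialD f g x i : differentiable f x -> differentiable g x ->
  partial i (f + g) x = partial i f x + partial i g x.
Proof. by move=> df dg; rewrite /partial deriveD//; exact: diff_derivable. Qed.

Lemma partialM f g x i : differentiable f x -> differentiable g x ->
  partial i (f * g) x = f x * partial i g x + g x * partial i f x.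
Proof. by move=> df dg; rewrite /partial deriveM//; exact: diff_derivable. Qed.

Lemma smooth_algP u : smooth_alg u -> smooth u.
Proof.
apply: smooth_coind => [|{}u]; first exact: smooth_alg_differentiable.
elim=> {u}[u su i|f g sf IHf sg IHg i|f g sf IHf sg IHg i].
- by apply: smooth_alg_base; exact: smooth_partial.
- rewrite (_ : partial i _ = partial i f + partial i g).
    exact: smooth_alg_add.
  by apply/funext => x; rewrite partialD//; exact: smooth_alg_differentiable.
- rewrite (_ : partial i _ = f * partial i g + g * partial i f).
    by apply: smooth_alg_add; exact: smooth_alg_mul.
  by apply/funext => x; rewrite partialM//; exact: smooth_alg_differentiable.
Qed.

Lemma smoothD f g : smooth f -> smooth g -> smooth (f + g).
Proof.
by move=> sf sg; apply/smooth_algP/smooth_alg_add; exact: smooth_alg_base.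
Qed.

Lemma smoothM f g : smooth f -> smooth g -> smooth (f * g).
Proof.
by move=> sf sg; apply/smooth_algP/smooth_alg_mul; exact: smooth_alg_base.
Qed.

Lemma partial_cst (a : R) x i : partial i (cst a) x = 0.
Proof. by rewrite /partial derive_cst. Qed.

Lemma smooth_cst (a : R) : smooth (cst a : rV -> R).
Proof.
apply: (@smooth_coind (fun u => exists a, u = cst a)); last by exists a.
- by move=> _ [b ->] x; exact: differentiable_cst.
- move=> _ [b ->] i; exists 0; apply/funext => x; exact: partial_cst.
Qed.

Lemma smoothZ (a : R) f : smooth f -> smooth (fun x => a * f x).
Proof. by move=> sf; have := smoothM (smooth_cst a) sf. Qed.

Lemma smoothB f g : smooth f -> smooth g -> smooth (f - g).
Proof.
move=> sf sg; rewrite (_ : - g = fun x => -1 * g x).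
  by apply: smoothD => //; exact: smoothZ.
by apply/funext => x; rewrite mulN1r.
Qed.

Lemma partialZ (a : R) f x i : differentiable f x ->
  partial i (fun x => a * f x) x = a * partial i f x.
Proof.
move=> df; rewrite [LHS](@partialM (cst a) f)// partial_cst.
by rewrite mulr0 addr0.
Qed.

Lemma partialB f g x i : differentiable f x -> differentiable g x ->
  partial i (f - g) x = partial i f x - partial i g x.
Proof.
move=> df dg; rewrite (_ : - g = fun x => -1 * g x).
  rewrite partialD// ?partialZ ?mulN1r//.
  by apply: differentiableM => //; exact: differentiable_cst.
by apply/funext => y; rewrite mulN1r.
Qed.

Lemma derive_sum_partial u x h : differentiable u x ->
  'D_h u x = \sum_i partial i u x * h 0 i.
Proof.
move=> du; rewrite deriveE// {1}(row_sum_delta h) linear_sum.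
by apply: eq_bigr => i _; rewrite linearZ/= /partial deriveE// mulrC.
Qed.

Lemma is_derive_segment u x h (t : R) : (forall y, differentiable u y) ->
  is_derive t 1 (fun s : R => u (x + s *: h))
    (\sum_i partial i u (x + t *: h) * h 0 i).
Proof.
move=> du; rewrite -derive_sum_partial//.
have E : (fun s : R => s^-1 *: (((fun s : R => u (x + s *: h)) \o shift t) (s *: 1)
     - u (x + t *: h)))
   = (fun s : R => s^-1 *: ((u \o shift (x + t *: h)) (s *: h) - u (x + t *: h))).
  apply/funext => s /=; congr (_ *: (u _ - _)).
  by rewrite [s *: 1]mulr1 scalerDl addrCA.
split; last by rewrite /derive E.
by rewrite /derivable E; exact: diff_derivable.
Qed.

Lemma segment_MVT u x h : (forall y, differentiable u y) ->
  exists c : R, 0 <= c <= 1 /\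
  u (x + h) - u x = \sum_i partial i u (x + c *: h) * h 0 i.
Proof.
move=> du.
have dd t := is_derive_segment x h t du.
have cont : {within `[(0 : R), 1], continuous (fun s : R => u (x + s *: h))}.
  apply: continuous_subspaceT => t.
  by apply: differentiable_continuous; apply/derivable1_diffP; have [] := dd t.
have [c] := MVT_segment ler01 (fun t _ => dd t) cont.
rewrite in_itv/= scale1r scale0r addr0 subr0 mulr1 => c01 E.
by exists c.
Qed.

Definition bounded_support u := exists M : R, forall x, M < `|x| -> u x = 0.

Lemma bounded_support_partial u i : bounded_support u ->
  bounded_support (partial i u).
Proof.
move=> [M uM]; exists M => x Mx; rewrite /partial.
rewrite (@near_eq_derive _ _ _ u (cst 0)) ?derive_cst//.
near=> y; rewrite /= uM//; near: y.
have d0 : 0 < `|x| - M by rewrite subr_gt0.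
apply: filterS (nbhsx_ballx x _ d0) => y; rewrite mx_norm_ball /ball_/= => xy.
rewrite -subr_gt0; apply: (@lt_le_trans _ _ (`|x| - M - `|x - y|)).
  by rewrite subr_gt0.
by rewrite addrAC lerD2r lerBlDl -{1}(subrK y x) ler_normD.
Unshelve. all: by end_near. Qed.

Lemma bounded_support_bounded u : continuous u -> bounded_support u ->
  exists2 K : R, 0 <= K & forall x, `|u x| <= K.
Proof.
move=> cu [M uM].
have cB : compact (closed_ball (0 : rV) (`|M| + 1)).
  apply: bounded_closed_compact; last exact: closed_ball_closed.
  exists (`|M| + 1); split=> [|r Mr x]; first exact: num_real.
  rewrite closed_ballE ?ltr_wpDl// /closed_ball_/= sub0r normrN => /le_trans.
  by apply; exact: ltW.
have /compact_bounded[K [_ KP]] :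
    compact (u @` closed_ball (0 : rV) (`|M| + 1)).
  by apply: continuous_compact => //; exact: continuous_subspaceT.
exists (`|K| + 1) => [|x]; first by rewrite addr_ge0.
have [xM|Mx] := leP `|x| (`|M| + 1).
  apply: KP; first by rewrite (le_lt_trans (ler_norm K)) ?ltrDl.
  exists x => //; rewrite closed_ballE ?ltr_wpDl// /closed_ball_/=.
  by rewrite sub0r normrN.
rewrite uM ?normr0 ?addr_ge0// (le_lt_trans _ Mx)//.
by rewrite (le_trans (ler_norm M)) ?lerDl.
Qed.

Lemma smooth_continuous u : smooth u -> continuous u.
Proof.
by move=> su x; apply: differentiable_continuous; exact: smooth_differentiable.
Qed.

Lemma smooth_bounded u : smooth u -> bounded_support u ->
  exists2 K : R, 0 <= K & forall x, `|u x| <= K.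
Proof.
by move=> su; apply: bounded_support_bounded; exact: smooth_continuous.
Qed.

Lemma smooth_bounded_partial u : smooth u -> bounded_support u ->
  exists2 K : R, 0 <= K & forall i x, `|partial i u x| <= K.
Proof.
move=> su bu.
have H i : exists K : R, 0 <= K /\ forall x, `|partial i u x| <= K.
  have [K K0 uK] := smooth_bounded (smooth_partial i su)
    (bounded_support_partial i bu).
  by exists K.
pose K i := sval (cid (H i)).
have K0 i : 0 <= K i by rewrite /K; case: cid => ? [].
exists (\sum_i K i) => [|i x]; first exact: sumr_ge0.
apply: (@le_trans _ _ (K i)); first by rewrite /K; case: cid => ? [].
by rewrite (bigD1 i)//= lerDl sumr_ge0.
Qed.

Lemma smooth_lipschitz u : smooth u -> bounded_support u ->
  exists2 K : R, 0 <= K & forall x h, `|u (x + h) - u x| <= K * `|h|.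
Proof.
move=> su bu; have [K K0 uK] := smooth_bounded_partial su bu.
exists (N%:R * K) => [|x h]; first by rewrite mulr_ge0.
have [c [_ ->]] := segment_MVT x h (fun y => smooth_differentiable y su).
by apply: le_norm_sum_coord => i; exact: uK.
Qed.

(** The mean value theorem gives one intermediate point for all partial derivatives, and each of
    these is Lipschitz. The constant is uniform in [x], as differentiation under the integral
    requires. *)
Lemma smooth_taylor2 u : smooth u -> bounded_support u ->
  exists2 K : R, 0 <= K & forall x h,
  `|u (x + h) - u x - \sum_i partial i u x * h 0 i| <= K * `|h| ^+ 2.
Proof.
move=> su bu.
have H i : exists K : R, 0 <= K /\
    forall x h, `|partial i u (x + h) - partial i u x| <= K * `|h|.
  have [K K0 uK] := smooth_lipschitz (smooth_partial i su)
    (bounded_support_partial i bu).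
  by exists K.
pose K i := sval (cid (H i)).
have K0 i : 0 <= K i by rewrite /K; case: cid => ? [].
have KP i x h : `|partial i u (x + h) - partial i u x| <= K i * `|h|.
  by rewrite /K; case: cid => ? [].
exists (\sum_i K i) => [|x h]; first exact: sumr_ge0.
have [c [/andP[c0 c1] ->]] := segment_MVT x h (fun y => smooth_differentiable y su).
rewrite -sumrB mulr_suml; apply: (le_trans (ler_norm_sum _ _ _)).
apply: ler_sum => i _; rewrite -mulrBl normrM expr2 mulrA.
apply: ler_pM => //; last exact: le_norm_coord.
apply: (le_trans (KP _ _ _)); rewrite ler_wpM2l//.
by rewrite normrZ ger0_norm// ler_piMl.
Qed.

End smooth_functions.

Lemma Rintegral_eq0 d (T : measurableType d) (R : realType)
    (nu : {measure set T -> \bar R}) (D : set T) (f : T -> R) :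
  (forall x, D x -> f x = 0) -> \int[nu]_(x in D) f x = 0.
Proof. by move=> f0; rewrite /Rintegral integral0_eq// => x /f0 ->. Qed.

Section smoothing.
Context (R : realType) (N : nat).
Local Notation rV := 'rV[R]_N.
Local Notation mu := (lebesgue_rV R N).
Implicit Types (u F G : rV -> R) (x h t : rV).

Definition bounded_measurable F :=
  measurable_fun setT F /\ exists K : R, forall x, `|F x| <= K.

Lemma bounded_measurableD F G :
  bounded_measurable F -> bounded_measurable G -> bounded_measurable (F + G).
Proof.
move=> [mF [K FK]] [mG [L GL]]; split; first exact: measurable_funD.
by exists (K + L) => x; rewrite (le_trans (ler_normD _ _))// lerD.
Qed.

Lemma bounded_measurableZ (a : R) F :
  bounded_measurable F -> bounded_measurable (fun x => a * F x).
Proof.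
move=> [mF [K FK]]; split; first exact: measurable_funM.
by exists (`|a| * K) => x; rewrite normrM ler_wpM2l.
Qed.

Lemma bounded_measurable_shift F x :
  bounded_measurable F -> bounded_measurable (fun t => F (x + t)).
Proof.
move=> [mF [K FK]]; split; last by exists K.
by under eq_fun do rewrite addrC; exact: (measurableT_comp mF (measurable_shift_rV x)).
Qed.

Lemma smooth_measurable u : smooth u -> measurable_fun setT u.
Proof.
by move=> su; apply: continuous_measurable_rV; exact: smooth_continuous.
Qed.

Lemma bounded_measurable_smooth u :
  smooth u -> bounded_support u -> bounded_measurable u.
Proof.
move=> su bu; split; first exact: smooth_measurable.
by have [K _ uK] := smooth_bounded su bu; exists K.
Qed.

(** Smoothness of the average comes from [u], not from the kernel, which may therefore be the
    normalised indicator of a ball. Since [u] is evaluated at [x + t], a kernel living near [- v]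
    moves the support by [v]. *)
Definition smoothing (kap : rV -> R) u x := \int[mu]_t (kap t * u (x + t)).

Context (kap : rV -> R) (m : R).
Hypothesis mkap : measurable_fun setT kap.
Hypothesis kap0 : forall t, 0 <= kap t.
Hypothesis kapm : (\int[mu]_t (kap t)%:E = m%:E)%E.

Let ikap : mu.-integrable setT (EFin \o kap).
Proof.
apply/integrableP; split; first exact/measurable_EFinP.
rewrite (eq_integral (EFin \o kap)) => [|t _ /=]; first by rewrite /= kapm ltry.
by rewrite ger0_norm.
Qed.

Let Rkap : \int[mu]_t kap t = m. Proof. by rewrite /Rintegral kapm. Qed.

Lemma integrable_weight F : bounded_measurable F ->
  mu.-integrable setT (EFin \o (fun t => kap t * F t)).
Proof.
move=> [mF [K FK]].
apply: (@le_integrable _ _ _ mu setT measurableT _ (fun t => (K * kap t)%:E)).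
- by apply/measurable_EFinP; exact: measurable_funM.
- move=> t _ /=; rewrite lee_fin normrM ger0_norm// mulrC.
  by rewrite (le_trans (ler_wpM2r (kap0 t) (FK t)))// ler_norm.
- by have := integrableZl measurableT K ikap.
Qed.

Let wint F := \int[mu]_t (kap t * F t).

Lemma wintD F G : bounded_measurable F -> bounded_measurable G ->
  wint (F + G) = wint F + wint G.
Proof.
move=> bF bG; rewrite /wint -RintegralD//; try exact: integrable_weight.
by apply: eq_Rintegral => t _; rewrite -mulrDr.
Qed.

Lemma wintZ (a : R) F : bounded_measurable F ->
  wint (fun t => a * F t) = a * wint F.
Proof.
move=> bF; rewrite /wint -RintegralZl//; last exact: integrable_weight.
by apply: eq_Rintegral => t _; rewrite mulrCA.
Qed.

Lemma wint_sum (c : 'I_N -> R) (F : 'I_N -> rV -> R) :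
  (forall i, bounded_measurable (F i)) ->
  bounded_measurable (fun t => \sum_i c i * F i t) /\
  wint (fun t => \sum_i c i * F i t) = \sum_i c i * wint (F i).
Proof.
move=> bF.
rewrite (_ : (fun t => _) = \sum_i (fun t => c i * F i t)); last first.
  by apply/funext => t; rewrite fct_sumE.
apply: (big_ind2 (fun (F : rV -> R) a => bounded_measurable F /\ wint F = a)).
- split; last by apply: Rintegral_eq0 => t _; rewrite mulr0.
  by split; [exact: measurable_cst|exists 0 => x; rewrite normr0].
- move=> F1 a G b [bF1 <-] [bG <-]; split; first exact: bounded_measurableD.
  exact: wintD.
- by move=> i _; split; [exact: bounded_measurableZ|exact: wintZ].
Qed.

Lemma wint_le F (K : R) : bounded_measurable F -> (forall t, `|F t| <= K) ->
  `|wint F| <= m * K.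
Proof.
move=> bF FK; apply: (le_trans (le_normr_Rintegral _ _)) => //.
  exact: integrable_weight.
rewrite -Rkap -RintegralZr//; apply: le_Rintegral => //.
- by have := integrable_abse (integrable_weight bF).
- by have := integrableZr measurableT K ikap.
- by move=> t _; rewrite normrM ger0_norm// ler_wpM2l.
Qed.

(** The second-order Taylor remainder of [u] is uniform in the base point; averaged, it is a
    quadratic remainder for the smoothing with constant [m * K]. *)
Lemma smoothing_partial u x : smooth u -> bounded_support u ->
  differentiable (smoothing kap u) x /\
  forall i, partial i (smoothing kap u) x = smoothing kap (partial i u) x.
Proof.
move=> su bu; have [K K0 uK] := smooth_taylor2 su bu.
have bmu := bounded_measurable_smooth su bu.
have bmp i := bounded_measurable_smooth (smooth_partial i su)
  (bounded_support_partial i bu).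
apply: (@differentiable_le_sqr _ _ _ _ _ (m * K)) => h.
pose F t := u (x + h + t).
pose G t := -1 * u (x + t).
pose S t := \sum_i - h 0 i * partial i u (x + t).
have bF : bounded_measurable F by exact: bounded_measurable_shift.
have bG : bounded_measurable G.
  by apply: bounded_measurableZ; exact: bounded_measurable_shift.
have [bS SE] := @wint_sum (fun i => - h 0 i) (fun i t => partial i u (x + t))
  (fun i => bounded_measurable_shift x (bmp i)).
have -> : smoothing kap u (x + h) - smoothing kap u x -
    \sum_i smoothing kap (partial i u) x * h 0 i = wint ((F + G) + S).
  rewrite wintD ?wintD//; last exact: bounded_measurableD.
  rewrite SE wintZ ?mulN1r; last exact: bounded_measurable_shift.
  congr (_ + _); rewrite -sumrN; apply: eq_bigr => i _.
  by rewrite mulNr mulrC.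
rewrite -mulrA; apply: wint_le.
  by do 2 apply: bounded_measurableD => //.
move=> t; have := uK (x + t) h; apply: le_trans.
rewrite le_eqVlt; apply/orP; left; apply/eqP; congr (`| _ |).
rewrite -[LHS]/(F t + G t + S t) /F /G /S mulN1r [x + h + t]addrAC; congr (_ + _).
by rewrite -sumrN; apply: eq_bigr => i _; rewrite mulNr mulrC.
Qed.

Lemma smooth_smoothing u : smooth u -> bounded_support u ->
  smooth (smoothing kap u).
Proof.
move=> su bu.
apply: (@smooth_coind _ _ (fun v => exists u, [/\ smooth u, bounded_support u &
  v = smoothing kap u])); last by exists u.
- by move=> _ [{su bu}u [su bu ->]] x; have [] := smoothing_partial x su bu.
- move=> _ [{su bu}u [su bu ->]] i; exists (partial i u); split.
  + exact: smooth_partial.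
  + exact: bounded_support_partial.
  + by apply/funext => x; have [_ ->] := smoothing_partial x su bu.
Qed.

(* The support of the smoothing is contained in supp u - supp kap. *)
Lemma smoothing_neq0 u x : smoothing kap u x != 0 ->
  exists2 t, kap t != 0 & u (x + t) != 0.
Proof.
apply: contraNP => /forall2NP H; apply/eqP.
apply: Rintegral_eq0 => t _.
by have [/negP/negPn/eqP ->|/negP/negPn/eqP ->] := H t; rewrite ?mul0r ?mulr0.
Qed.

End smoothing.

(** * Bump functions and cutoffs *)

Section cutoffs.
Context (R : realType) (N : nat).
Local Notation rV := 'rV[R]_N.
Local Notation mu := (lebesgue_rV R N).
Implicit Types (u f : rV -> R) (x : rV).

Lemma differentiable_affine f (a : rV) (K : R) x : differentiable f (a + K *: x) ->
  differentiable (fun x => f (a + K *: x)) x.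
Proof.
by move=> df; exact: (@differentiable_comp _ _ _ _ (fun x => a + K *: x) f).
Qed.

Lemma partial_affine f (a : rV) (K : R) x i : differentiable f (a + K *: x) ->
  partial i (fun x => f (a + K *: x)) x = K * partial i f (a + K *: x).
Proof.
move=> df; rewrite /partial.
transitivity ('D_(K *: delta_mx 0 i) f (a + K *: x)).
  rewrite /derive (_ : (fun h : R => _) = (fun h : R => h^-1 *:
     ((f \o shift (a + K *: x)) (h *: (K *: delta_mx 0 i)) - f (a + K *: x))))//.
  apply/funext => h /=.
  by congr (_ *: (f _ - _)); rewrite scalerDr !scalerA mulrC addrCA.
by rewrite !deriveE// linearZ.
Qed.

Lemma smooth_affine f (a : rV) (K : R) : smooth f -> smooth (fun x => f (a + K *: x)).
Proof.
move=> sf.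
apply: (@smooth_coind _ _ (fun v => exists c g, smooth g /\
    v = (cst c : rV -> R) * (fun x => g (a + K *: x) : R))).
- move=> _ [c [g [sg ->]]] x; apply: differentiableM.
    exact: differentiable_cst.
  by apply: differentiable_affine; exact: smooth_differentiable.
- move=> _ [c [g [sg ->]]] i; exists (c * K), (partial i g); split.
    exact: smooth_partial.
  apply/funext => x; have dg := smooth_differentiable (a + K *: x) sg.
  rewrite [LHS](@partialZ _ _ c (fun x => g (a + K *: x))); last first.
    exact: differentiable_affine.
  by rewrite partial_affine// mulrA.
- by exists 1, f; split => //; apply/funext => x; rewrite -[RHS]/(1 * _) mul1r.
Qed.

Lemma integral_indic_ball (k : R) x (r : R) : 0 <= k -> 0 < r ->
  (\int[mu]_y (k * \1_(ball x r : set rV) y)%:E = (k * (2 * r) ^+ N)%:E)%E.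
Proof.
move=> k0 r0; have mB := measurable_ball_rV x r.
under eq_integral do rewrite EFinM.
rewrite ge0_integralZl_EFin//; last first.
  by apply/measurable_EFinP; exact: measurable_indic.
rewrite integral_indic// setIT EFinM; congr (_ * _)%E.
exact: lebesgue_rV_ball.
Qed.

(** The square of any nonzero smooth function of bounded support, recentred at a point where it does
    not vanish and compressed by a factor [K], is a bump; no explicit formula is involved. *)
Lemma exists_bump phi (d : R) : smooth phi -> bounded_support phi ->
  (exists x, phi x != 0) -> 0 < d ->
  exists b : rV -> R, [/\ smooth b, forall x, 0 <= b x, 0 < b 0 &
    forall x, d < `|x| -> b x = 0].
Proof.
move=> sp [M pM] [x0 px0] d0.
have MP : 0 < `|M| + `|x0| + 1 by rewrite ltr_wpDl// addr_ge0.
(* With this factor, [d < |x|] pushes [x0 + K *: x] beyond the radius [M] outside which [phi]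
   vanishes. *)
pose K := (`|M| + `|x0| + 1) / d.
have K0 : 0 < K by rewrite divr_gt0.
exists (fun x => phi (x0 + K *: x) * phi (x0 + K *: x)); split.
- by apply: smoothM; exact: smooth_affine.
- by move=> x; rewrite -expr2 sqr_ge0.
- by rewrite scaler0 addr0 -expr2 exprn_even_gt0.
- move=> x dx; rewrite pM ?mul0r//.
  have : `|M| + `|x0| + 1 < `|K *: x|.
    rewrite normrZ gtr0_norm// /K -mulrA ltr_pMr//.
    by rewrite mulrC ltr_pdivlMr// mul1r.
  move=> h; apply: (@le_lt_trans _ _ `|M|); first exact: ler_norm.
  have := ler_normB (x0 + K *: x) x0; rewrite addrAC subrr add0r.
  lra.
Qed.

Lemma integral_bump_gt0 (b : rV -> R) (d : R) : smooth b ->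
  (forall x, 0 <= b x) -> 0 < b 0 -> (forall x, d < `|x| -> b x = 0) ->
  exists2 m : R, 0 < m & (\int[mu]_x (b x)%:E = m%:E)%E.
Proof.
move=> sb b0 b00 bd.
have mb : measurable_fun setT (fun x => (b x)%:E).
  by apply/measurable_EFinP; exact: smooth_measurable.
have [K K0 bK] : exists2 K : R, 0 <= K & forall x, `|b x| <= K.
  by apply: smooth_bounded => //; exists d.
have fin : (\int[mu]_x (b x)%:E < +oo)%E.
  pose B : set rV := ball (0 : rV) (`|d| + 1).
  have mB : measurable B by exact: measurable_ball_rV.
  apply: (@le_lt_trans _ _ (\int[mu]_x (K * \1_B x)%:E)%E).
    apply: ge0_le_integral => //.
    - by move=> x _; rewrite lee_fin.
    - by apply/measurable_EFinP; apply: measurable_funM => //; exact: measurable_indic.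
    - move=> x _; rewrite lee_fin indicE.
      have [xB|xB] := boolP (x \in B).
        by rewrite mulr1 (le_trans (ler_norm _)).
      rewrite mulr0 bd// ltNge; apply: contra xB => xd.
      rewrite inE /B mx_norm_ball /ball_/= sub0r normrN.
      by rewrite (le_lt_trans xd)// (le_lt_trans (ler_norm d))// ltrDl.
  by rewrite integral_indic_ball ?ltry// ltr_wpDl.
exists (fine (\int[mu]_x (b x)%:E)).
  have /nbhs_ballP[r /= r0 rb] : \forall x \near (0 : rV), b 0 / 2 < b x.
    have cb := @smooth_continuous _ _ _ sb (0 : rV).
    apply: (cvgr_gt (b 0) cb); by rewrite ltr_pdivrMr// ltr_pMr// ltr1n.
  apply: fine_gt0; rewrite fin andbT.
  pose B : set rV := ball (0 : rV) r.
  have mB : measurable B by exact: measurable_ball_rV.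
  apply: (@lt_le_trans _ _ (\int[mu]_x (b 0 / 2 * \1_B x)%:E)%E).
    rewrite integral_indic_ball// ?divr_ge0// lte_fin.
    by rewrite mulr_gt0// ?divr_gt0// exprn_gt0// mulr_gt0.
  apply: ge0_le_integral => //.
  - by move=> x _; rewrite lee_fin mulr_ge0// divr_ge0.
  - by apply/measurable_EFinP; apply: measurable_funM => //; exact: measurable_indic.
  - move=> x _; rewrite lee_fin indicE.
    have [xB|xB] := boolP (x \in B); last by rewrite mulr0.
    by rewrite mulr1 ltW//; apply: rb; rewrite inE in xB.
by rewrite fineK// ge0_fin_numE// integral_ge0// => x _; rewrite lee_fin.
Qed.

(** A bump of radius [rho / 8] is averaged over a ball of radius [3 / 4 * rho]. Up to distance
    [rho / 2] the whole bump is captured, as 1/2 + 1/8 < 3/4, and dividing by its integral gives 1;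
    from distance [rho] on nothing is captured, as 3/4 + 1/8 < 1. The ball is centred at [- x0]
    because [smoothing] evaluates at [x + t]. *)
Lemma exists_cutoff phi (x0 : rV) (rho : R) : smooth phi -> bounded_support phi ->
  (exists x, phi x != 0) -> 0 < rho ->
  exists eta : rV -> R, [/\ smooth eta,
    forall x, `|x - x0| < rho / 2 -> eta x = 1 &
    forall x, rho <= `|x - x0| -> eta x = 0].
Proof.
move=> sp bp phi0 rho0.
have [b [sb b0 b00 bd]] : exists b : rV -> R, [/\ smooth b, forall x, 0 <= b x,
    0 < b 0 & forall x, rho / 8 < `|x| -> b x = 0].
  by apply: exists_bump phi0 _ => //; rewrite divr_gt0.
have [m m0 bm] := integral_bump_gt0 sb b0 b00 bd.
pose B : set rV := ball (- x0) (3 / 4 * rho).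
have r0 : 0 < 3 / 4 * rho by rewrite mulr_gt0.
have mB : measurable B by exact: measurable_ball_rV.
pose kap t := m^-1 * \1_B t.
have mkap : measurable_fun setT kap.
  by apply: measurable_funM => //; exact: measurable_indic.
have kap0 t : 0 <= kap t by rewrite mulr_ge0// invr_ge0 ltW.
have kapm : (\int[mu]_t (kap t)%:E = (m^-1 * (2 * (3 / 4 * rho)) ^+ N)%:E)%E.
  by rewrite integral_indic_ball// invr_ge0 ltW.
exists (smoothing kap b); split.
- by apply: (smooth_smoothing mkap kap0 kapm) => //; exists (rho / 8).
- move=> x xx0.
  rewrite (_ : smoothing kap b x = \int[mu]_t (m^-1 * b (t + x))); last first.
    apply: eq_Rintegral => t _; rewrite /kap indicE -mulrA [x + t]addrC; congr (_ * _).
    have [tB|] := boolP (t \in B); first by rewrite mul1r.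
    rewrite notin_setE /B mx_norm_ball /ball_/= => /negP; rewrite -leNgt => tB.
    rewrite bd ?mulr0//.
    have : `|- x0 - t| <= `|x - x0| + `|t + x|.
      rewrite (_ : - x0 - t = (x - x0) - (t + x)) ?ler_normB//.
      by rewrite [t + x]addrC opprD addrACA subrr add0r.
    lra.
  rewrite /Rintegral.
  under eq_integral do rewrite EFinM.
  rewrite ge0_integralZl_EFin//.
  + rewrite (@ge0_integral_shift_rV _ _ x (fun t => (b t)%:E))//.
    * by rewrite bm /= mulVf// gt_eqF.
    * by apply/measurable_EFinP; exact: smooth_measurable.
    * by move=> y; rewrite lee_fin.
  + apply/measurable_EFinP.
    exact: (measurableT_comp (smooth_measurable sb) (measurable_shift_rV x)).
  + by rewrite invr_ge0 ltW.
- move=> x xx0; apply/eqP; apply: contraTT xx0 => /smoothing_neq0[t].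
  rewrite /kap indicE mulf_eq0 negb_or => /andP[_].
  have [tB _ bt|_] := boolP (t \in B); last by rewrite eqxx.
  rewrite -ltNge.
  have {}bt : `|x + t| <= rho / 8.
    by rewrite leNgt; apply: contra bt => /bd/eqP.
  move: tB; rewrite inE /B mx_norm_ball /ball_/= => tB.
  have : `|x - x0| <= `|x + t| + `|- x0 - t|.
    rewrite (_ : x - x0 = (x + t) + (- x0 - t)) ?ler_normD//.
    by rewrite addrACA subrr addr0.
  lra.
Qed.

End cutoffs.

(** * Translates bounded in weighted L^2 *)

Section translation_bounded.
Context (R : realType) (N : nat).
Local Notation rV := 'rV[R]_N.
Local Notation mu := (lebesgue_rV R N).
Implicit Types (a b f g : rV -> R) (s x : rV).

Definition sqn f : \bar R := (\int[mu]_x (f x ^+ 2)%:E)%E.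

Lemma sqn_ge0 f : (0 <= sqn f)%E.
Proof. by apply: integral_ge0 => x _; rewrite lee_fin sqr_ge0. Qed.

Lemma measurable_sqr_EFin f : measurable_fun setT f ->
  measurable_fun setT (fun x => (f x ^+ 2)%:E).
Proof. by move=> mf; apply/measurable_EFinP; exact: measurable_funX. Qed.

Lemma measurable_translate f s : measurable_fun setT f ->
  measurable_fun setT (fun x => f (x + s)).
Proof. by move=> mf; exact: (measurableT_comp mf (measurable_shift_rV s)). Qed.

Lemma sqn_translate f s : measurable_fun setT f ->
  sqn (fun x => f (x + s)) = sqn f.
Proof.
move=> mf; rewrite /sqn (@ge0_integral_shift_rV _ _ s (fun x => (f x ^+ 2)%:E))//.
- exact: measurable_sqr_EFin.
- by move=> x; rewrite lee_fin sqr_ge0.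
Qed.

Lemma le_sqn f g : measurable_fun setT f -> measurable_fun setT g ->
  (forall x, `|f x| <= `|g x|) -> (sqn f <= sqn g)%E.
Proof.
move=> mf mg fg; apply: ge0_le_integral => //.
- by move=> x _; rewrite lee_fin sqr_ge0.
- exact: measurable_sqr_EFin.
- exact: measurable_sqr_EFin.
- by move=> x _; rewrite lee_fin -(real_normK (num_real (f x)))
    -(real_normK (num_real (g x))) ler_sqr ?nnegrE.
Qed.

Lemma sqnD f g : measurable_fun setT f -> measurable_fun setT g ->
  (sqn (f + g)%R <= 2%:E * sqn f + 2%:E * sqn g)%E.
Proof.
move=> mf mg; rewrite /sqn.
have [mf2 mg2] := (measurable_sqr_EFin mf, measurable_sqr_EFin mg).
rewrite -!ge0_integralZl_EFin//; try by move=> x _; rewrite lee_fin sqr_ge0.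
rewrite -ge0_integralD//.
- apply: ge0_le_integral => //.
  + by move=> x _; rewrite lee_fin sqr_ge0.
  + by apply: measurable_sqr_EFin; exact: measurable_funD.
  + by apply: emeasurable_funD; apply: emeasurable_funM.
  + move=> x _; rewrite -!EFinM -EFinD lee_fin -[(f + g) x]/(f x + g x).
    by have := sqr_ge0 (f x - g x); nra.
- by move=> x _; rewrite mule_ge0// lee_fin sqr_ge0.
- exact: emeasurable_funM.
- by move=> x _; rewrite mule_ge0// lee_fin sqr_ge0.
- exact: emeasurable_funM.
Qed.

Lemma sqnZ (k : R) f : measurable_fun setT f ->
  sqn (fun x => k * f x) = ((k ^+ 2)%:E * sqn f)%E.
Proof.
move=> mf; rewrite /sqn -ge0_integralZl_EFin ?sqr_ge0//.
- by apply: eq_integral => x _; rewrite exprMn.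
- by move=> x _; rewrite lee_fin sqr_ge0.
- exact: measurable_sqr_EFin.
Qed.

(* Boundedness of all translates of f in L^2(a^2 dx); for a = 1 this is just
   f in L^2. Unlike the integrability classes of the data, it is stable under
   averaging with no need for Young's inequality. *)
Definition translation_bounded a f := measurable_fun setT f /\
  exists2 C : R, 0 <= C & forall s, (sqn (fun x => a x * f (x + s))%R <= C%:E)%E.

Definition L2fun f := measurable_fun setT f /\ (sqn f < +oo)%E.

Variable a : rV -> R.
Hypothesis ma : measurable_fun setT a.

Lemma translation_boundedD f g : translation_bounded a f ->
  translation_bounded a g -> translation_bounded a (f + g).
Proof.
move=> [mf [C C0 fC]] [mg [D D0 gD]]; split; first exact: measurable_funD.
exists (2 * C + 2 * D); first by rewrite addr_ge0// mulr_ge0.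
move=> s; rewrite (_ : (fun x => _) =
  (fun x => a x * f (x + s)) + (fun x => a x * g (x + s))); last first.
  by apply/funext => x; rewrite mulrDr.
apply: le_trans; first by apply: sqnD; apply: measurable_funM => //;
  exact: measurable_translate.
by apply: (le_trans (leeD (lee_wpmul2l _ (fC s)) (lee_wpmul2l _ (gD s)))).
Qed.

Lemma translation_bounded_le f g : measurable_fun setT f ->
  (forall x, `|f x| <= `|g x|) ->
  translation_bounded a g -> translation_bounded a f.
Proof.
move=> mf fg [mg [C C0 gC]]; split => //; exists C => // s.
apply: le_trans (gC s); apply: le_sqn => [||x].
- by apply: measurable_funM => //; exact: measurable_translate.
- by apply: measurable_funM => //; exact: measurable_translate.
- by rewrite !normrM ler_wpM2l.
Qed.

Lemma translation_boundedM b f : bounded_measurable b ->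
  translation_bounded a f -> translation_bounded a (b * f).
Proof.
move=> [mb [K bK]] [mf [C C0 fC]]; split; first exact: measurable_funM.
exists (K ^+ 2 * C) => [|s]; first by rewrite mulr_ge0// sqr_ge0.
have K0 : 0 <= K by rewrite (le_trans _ (bK 0)).
have maf : measurable_fun setT (fun x => a x * f (x + s)).
  by apply: measurable_funM => //; exact: measurable_translate.
apply: (@le_trans _ _ (sqn (fun x => K * (a x * f (x + s))))).
  apply: le_sqn => [||x].
  - apply: measurable_funM => //.
    apply: (@measurable_translate (b * f)); exact: measurable_funM.
  - exact: measurable_funM.
  - rewrite -[(b * f) (x + s)]/(b (x + s) * f (x + s)) mulrCA normrM.
    by rewrite [leRHS]normrM ler_wpM2r// (ger0_norm K0).
by rewrite sqnZ// [leRHS]EFinM lee_wpmul2l// ?lee_fin ?sqr_ge0.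
Qed.

End translation_bounded.

(** * Shifting into a Lipschitz domain *)

Section inward_shifts.
Context (R : realType) (N : nat).
Local Notation rV := 'rV[R]_N.

Lemma mulmx_norm_le n (A : 'M[R]_(N, n)) :
  exists2 c : R, 0 < c & forall x : rV, `|x *m A| <= c * `|x|.
Proof.
exists (1 + \sum_i \sum_j `|A i j|).
  by rewrite ltr_pwDl// sumr_ge0// => i _; rewrite sumr_ge0.
move=> x; apply/rV_norm_leP => [|j].
  by rewrite mulr_ge0// addr_ge0// sumr_ge0// => i _; rewrite sumr_ge0.
rewrite mxE (le_trans (ler_norm_sum _ _ _))// mulrDl ler_wpDl ?mul1r//.
rewrite mulr_suml; apply: ler_sum => i _; rewrite normrM mulrC ler_pM//.
  by rewrite (bigD1 j)//= lerDl sumr_ge0.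
exact: le_norm_coord.
Qed.

Lemma inward_shift (Omega : set rV) (x0 : rV) : open Omega ->
  lipschitz_boundary Omega -> closure Omega x0 ->
  exists2 rho : R, 0 < rho & forall d : R, 0 < d ->
    exists (v : rV) (r : R), [/\ 0 < r, `|v| + r <= d &
      forall x s, Omega x -> `|x - x0| < rho -> `|s| < r -> Omega (x + v + s)].
Proof.
move=> oO lO cx0; have [Ox0|Ox0] := pselect (Omega x0).
  have /nbhs_ballP[e /= e0 xe] := open_nbhs_nbhs (conj oO Ox0).
  exists (e / 2); first by rewrite divr_gt0.
  move=> d d0; exists 0, (Num.min d (e / 2)); split.
  - by rewrite lt_min d0 divr_gt0.
  - by rewrite normr0 add0r ge_min lexx.
  - move=> x s _ xx0; rewrite lt_min => /andP[_ se].
    apply: xe; rewrite mx_norm_ball /ball_/= addr0 opprD addrA.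
    rewrite (le_lt_trans (ler_normB _ _))// [ltRHS]splitr ltrD//.
    by rewrite distrC.
have [|P [k [g [PP glip /nbhs_ballP[e /= e0 xe]]]]] := lO x0.
  by split => //; move=> /interior_subset.
have [L L0 gL] : exists2 L : R, 0 < L & forall y z, `|g y - g z| <= L * `|y - z|.
  have [M [_ /(_ (`|M| + 1))]] := glip.
  rewrite (le_lt_trans (ler_norm M)) ?ltrDl// => /(_ isT) h.
  exists (`|M| + 1); first by rewrite ltr_wpDl.
  by move=> y z; apply: (h (y, z)).
have PP' : P^T *m P = 1%:M by exact: mulmx1C.
have [c1 c10 c1P] := mulmx_norm_le P^T.
have [c2 c20 c2P] := mulmx_norm_le P.
exists (e / 2); first by rewrite divr_gt0.
move=> d d0; pose dl : rV := delta_mx 0 k.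
have dl1 : `|dl| <= 1.
  by apply/rV_norm_leP => // i; rewrite mxE; case: eqP => //= _; case: eqP;
    rewrite ?normr1 ?normr0.
(* The factor [c1 + 1] pays for the length of [v], at most [tau * c1], and for [r <= tau]; the bound
   [e / 2] keeps the shifted point in the chart. *)
pose tau := Num.min d (e / 2) / (c1 + 1).
have tau0 : 0 < tau by rewrite divr_gt0 ?addr_gt0// lt_min d0 divr_gt0.
(* Chosen so that [(L + 1) * c2 * r < tau]: the perturbation cannot undo the gain in height. *)
pose r := tau / ((L + 1) * c2 + 1).
have D0 : 0 < (L + 1) * c2 + 1 by rewrite addr_gt0// mulr_gt0// addr_gt0.
have r0 : 0 < r by rewrite divr_gt0.
have rtau : r <= tau.
  rewrite ler_pdivrMr// (ler_peMr (ltW tau0))// lerDr.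
  by apply: mulr_ge0; [rewrite addr_ge0// ltW|exact: ltW].
have rL : (L + 1) * c2 * r < tau.
  rewrite /r mulrCA gtr_pMr// -[ltLHS]/(_ / _) ltr_pdivrMr// mul1r.
  by rewrite ltrDl.
pose v := tau *: (dl *m P^T).
have vc : `|v| <= tau * c1.
  rewrite normrZ gtr0_norm// (ler_wpM2l (ltW tau0))//.
  by rewrite (le_trans (c1P _))// (ler_piMr (ltW c10)).
have vr : `|v| + r <= Num.min d (e / 2).
  apply: (@le_trans _ _ (tau * (c1 + 1))); last first.
    by rewrite /tau divfK// gt_eqF// addr_gt0.
  by rewrite mulrDr mulr1 lerD.
exists v, r; split => //; first by move: vr; rewrite le_min => /andP[].
move=> x s Ox xx0 sr.
have /(xe _) xP : ball x0 e x.
  rewrite mx_norm_ball /ball_/= distrC (lt_trans xx0)// gtr_pMr// invf_lt1//.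
  by rewrite ltr1n.
move: (Ox) => /xP gx.
apply/(xe (x + v + s)).
  rewrite mx_norm_ball /ball_/= -addrA opprD addrA.
  rewrite (le_lt_trans (ler_normB _ _))// [ltRHS]splitr ltr_leD//.
    by rewrite distrC.
  move: vr; rewrite le_min => /andP[_]; apply: le_trans.
  by rewrite (le_trans (ler_normD _ _))// lerD2l ltW.
have vP : v *m P = tau *: dl by rewrite -scalemxAl -mulmxA PP' mulmx1.
have zP : (x + v + s) *m P = x *m P + tau *: dl + s *m P.
  by rewrite !mulmxDl vP.
have ck : col' k (x *m P + tau *: dl + s *m P) = col' k (x *m P) + col' k (s *m P).
  apply/rowP => j; rewrite !mxE eqxx eq_sym (negbTE (neq_lift _ _)).
  by rewrite mulr0 addr0.
rewrite zP ck [ltRHS](_ : _ = (x *m P) 0 k + tau + (s *m P) 0 k); last first.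
  by rewrite 2!mxE; congr (_ + _ + _); rewrite !mxE !eqxx mulr1.
have sP : `|s *m P| <= c2 * r.
  by rewrite (le_trans (c2P s))// (ler_wpM2l (ltW c20))// ltW.
have sPk : - (c2 * r) <= (s *m P) 0 k.
  have := le_trans (le_norm_coord _ k) sP.
  by rewrite ler_norml => /andP[].
have g1 : g (col' k (x *m P) + col' k (s *m P)) <= g (col' k (x *m P)) + L * (c2 * r).
  rewrite -lerBlDl; apply: (le_trans (ler_norm _)).
  apply: (le_trans (gL _ _)); rewrite addrAC subrr add0r (ler_wpM2l (ltW L0))//.
  rewrite (le_trans _ sP)//; apply/rV_norm_leP => // j; rewrite mxE.
  exact: le_norm_coord.
move: gx rL g1 sPk; rewrite mulrDl mul1r mulrDl; lra.
Qed.

End inward_shifts.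

Section test_functions.
Context (R : realType) (N : nat).
Local Notation rV := 'rV[R]_N.
Variable Omega : set rV.
Implicit Types (u phi : rV -> R) (x : rV).

Lemma C0infty_smooth phi : C0infty Omega phi -> smooth phi.
Proof. by case. Qed.

Lemma C0infty_bounded_support phi : C0infty Omega phi -> bounded_support phi.
Proof.
move=> [_ [/compact_bounded[M [_ MP]] _]]; exists (`|M| + 1) => x xM.
apply/eqP; apply: contraTT xM => px; rewrite -leNgt.
apply: (MP (`|M| + 1)); first by rewrite (le_lt_trans (ler_norm M)) ?ltrDl.
exact: subset_closure.
Qed.

Lemma C0infty_out phi x : C0infty Omega phi -> ~ Omega x -> phi x = 0.
Proof.
move=> [_ [_ sub]] Ox; apply/eqP; apply: contrapT => /negP px; apply: Ox.
by apply: sub; exact: subset_closure.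
Qed.

Lemma C0inftyP phi (K : set rV) : smooth phi -> compact K -> K `<=` Omega ->
  (forall x, phi x != 0 -> K x) -> C0infty Omega phi.
Proof.
move=> sp cK KO pK.
have sub : closure [set x | phi x != 0] `<=` K.
  have cl : closed K by apply: compact_closed => //; exact: norm_hausdorff.
  by rewrite [X in _ `<=` X](closure_id K).1//; apply: closureS => x /pK.
split=> //; split; last exact: subset_trans KO.
exact: subclosed_compact (@closed_closure _ _) cK sub.
Qed.

Lemma C0infty_partial phi i : C0infty Omega phi -> C0infty Omega (partial i phi).
Proof.
move=> [sp [cp pO]]; apply: (C0inftyP _ cp pO); first exact: smooth_partial.
move=> x; apply: contraNP => Kx; rewrite /partial.
rewrite (@near_eq_derive _ _ _ phi (cst 0)) ?derive_cst//.
have oK : open (~` closure [set x | phi x != 0]).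
  by apply: closed_openC; exact: closed_closure.
apply: filterS (open_nbhs_nbhs (conj oK Kx)) => y /= Ky.
by apply/eqP; apply: contrapT => /negP py; apply: Ky; exact: subset_closure.
Qed.

Lemma C0inftyD phi psi : C0infty Omega phi -> C0infty Omega psi ->
  C0infty Omega (phi + psi).
Proof.
move=> [sp [cp pO]] [sq [cq qO]].
apply: (@C0inftyP _ (closure [set x | phi x != 0] `|` closure [set x | psi x != 0])).
- exact: smoothD.
- exact: compactU.
- by move=> x [/pO|/qO].
- move=> x; apply: contraNP => /not_orP[px qx].
  rewrite -[(phi + psi) x]/(phi x + psi x).
  have -> : phi x = 0.
    by apply/eqP; apply: contrapT => /negP h; apply: px; exact: subset_closure.
  have -> : psi x = 0.
    by apply/eqP; apply: contrapT => /negP h; apply: qx; exact: subset_closure.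
  by rewrite addr0.
Qed.

Lemma C0inftyM phi (eta : rV -> R) : smooth eta -> C0infty Omega phi ->
  C0infty Omega (eta * phi).
Proof.
move=> se [sp [cp pO]]; apply: (C0inftyP _ cp pO); first exact: smoothM.
move=> x; apply: contraNP => px.
rewrite -[(eta * phi) x]/(eta x * phi x) (_ : phi x = 0) ?mulr0//.
by apply/eqP; apply: contrapT => /negP h; apply: px; exact: subset_closure.
Qed.

Lemma C0infty0 : C0infty Omega (cst 0).
Proof.
apply: (@C0inftyP _ set0) => //; first exact: smooth_cst.
- exact: compact0.
- by move=> x; rewrite eqxx.
Qed.

End test_functions.

(** * Averages along a coordinate direction *)

Section line_averages.
Context (R : realType) (N : nat).
Local Notation rV := 'rV[R]_N.
Local Notation mu := (lebesgue_rV R N).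
Variables (i : 'I_N) (d : R).
Hypothesis d0 : 0 < d.
Implicit Types (a f g u phi : rV -> R) (x s : rV).

Let e : rV := delta_mx 0 i.

Let kap (t : R) : R := \1_(`[- d, 0]%classic) t.

Let mkap : measurable_fun setT kap. Proof. exact: measurable_indic. Qed.

Let kap0 t : 0 <= kap t. Proof. by rewrite /kap. Qed.

Let kapm : (\int[lebesgue_measure]_t (kap t)%:E = d%:E)%E.
Proof.
rewrite integral_indic// setIT.
by rewrite /= lebesgue_measure_itv/= lte_fin oppr_lt0 d0 opprK add0e.
Qed.

(** The integral of [|f|] over the segment of length [d] that ends at [x] in direction [i]. It takes
    values in the extended reals, as it may be infinite at some points for [f] merely in L^2. *)
Definition line_average f x : \bar R :=
  (\int[lebesgue_measure]_t (kap t * `|f (x + t *: e)|)%:E)%E.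

Lemma line_average_ge0 f x : (0 <= line_average f x)%E.
Proof. by apply: integral_ge0 => t _; rewrite lee_fin mulr_ge0. Qed.

Let mH f s : measurable_fun setT f ->
  measurable_fun setT (fun p : rV * R => `|f (p.1 + s + p.2 *: e)|).
Proof.
move=> mf; apply: measurableT_comp => //; apply: (measurableT_comp mf).
apply: (measurableT_comp (@measurable_add_rV R N)
  (g := fun p : rV * R => (p.1 + s, p.2 *: e))).
apply/measurable_fun_pair.
  exact: (measurableT_comp (measurable_shift_rV s) measurable_fst).
exact: (measurableT_comp (measurable_scale_rV e) measurable_snd).
Qed.

Let mline f x : measurable_fun setT f ->
  measurable_fun setT (fun t => (kap t * `|f (x + t *: e)|)%:E).
Proof.
move=> mf; apply/measurable_EFinP; apply: measurable_funM => //.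
apply: measurableT_comp => //; apply: (measurableT_comp mf).
under eq_fun do rewrite addrC.
exact: (measurableT_comp (measurable_shift_rV x) (measurable_scale_rV e)).
Qed.

Lemma measurable_line_average f : measurable_fun setT f ->
  measurable_fun setT (line_average f).
Proof.
move=> mf.
apply: (measurable_fun_fubini_tonelli_F (m2 := lebesgue_measure)
  (fun p : rV * R => (kap p.2 * `|f (p.1 + p.2 *: e)|)%:E)).
  apply/measurable_EFinP; apply: measurable_funM.
    exact: (measurableT_comp mkap measurable_snd).
  by have := mH 0 mf; under eq_fun do rewrite addr0.
by move=> p; rewrite lee_fin mulr_ge0.
Qed.

Lemma line_averageD f g x : measurable_fun setT f -> measurable_fun setT g ->
  (line_average f x <= line_average g x + line_average (f - g)%R x)%E.
Proof.
move=> mf mg; rewrite /line_average -ge0_integralD//; last 4 first.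
- by move=> t _; rewrite lee_fin mulr_ge0.
- exact: mline.
- by move=> t _; rewrite lee_fin mulr_ge0.
- by apply: mline; exact: measurable_funB.
apply: ge0_le_integral => //.
- by move=> t _; rewrite lee_fin mulr_ge0.
- exact: mline.
- by apply: emeasurable_funD; apply: mline => //; exact: measurable_funB.
- move=> t _; rewrite -EFinD lee_fin -mulrDr ler_wpM2l//.
  by rewrite -{1}(subrK (g (x + t *: e)) (f (x + t *: e))) addrC ler_normD.
Qed.

Lemma sqr_line_average_le a f (C : R) s : measurable_fun setT a ->
  measurable_fun setT f -> 0 <= C ->
  (forall s, sqn (fun x => a x * f (x + s))%R <= C%:E)%E ->
  (\int[mu]_x ((a x ^+ 2)%:E * line_average f (x + s)%R ^+ 2) <= (d ^+ 2 * C)%:E)%E.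
Proof.
move=> ma mf C0 fC.
apply: (@ge0_sqr_integral_kernel_le R _ _ _ _ mu lebesgue_measure kap d C a
  (fun p : rV * R => `|f (p.1 + s + p.2 *: e)|)) => //; first exact: mH.
move=> t _; apply: le_trans (fC (s + t *: e)).
rewrite le_eqVlt; apply/orP; left; apply/eqP; apply: eq_integral => x _ /=.
by rewrite !exprMn real_normK ?num_real// addrA.
Qed.

(** The fundamental theorem of calculus on a segment at whose far end [phi] vanishes. *)
Lemma smooth_le_line_average phi x : smooth phi -> bounded_support phi ->
  phi (x - d *: e) = 0 -> (`|phi x|%:E <= line_average (partial i phi) x)%E.
Proof.
move=> sp bp p0.
pose F (t : R) := phi (x + t *: e); pose f (t : R) := partial i phi (x + t *: e).
have dF (t : R) : is_derive t 1 F (f t).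
  have := is_derive_segment x e t (fun y => smooth_differentiable y sp).
  rewrite (_ : \sum_j _ = f t)// (bigD1 i)//= big1 ?addr0.
    by rewrite mxE !eqxx mulr1.
  by move=> j ji; rewrite mxE eqxx (negbTE ji) mulr0.
have cF : continuous F.
  by move=> t; apply: differentiable_continuous; apply/derivable1_diffP; have [] := dF t.
have cf : continuous f.
  move=> t; have sp' := smooth_partial i sp.
  have [+ _] := is_derive_segment x e t (fun y => smooth_differentiable y sp').
  by move=> /derivable1_diffP/differentiable_continuous.
pose D : set R := `[- d, 0]%classic.
have I : (\int[lebesgue_measure]_(t in D) (f t)%:E = (F 0)%:E - (F (- d)%R)%:E)%E.
  apply: continuous_FTC2.
  - by rewrite oppr_lt0.
  - exact: continuous_subspaceT.
  - split; first by move=> t _; have [] := dF t.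
    + by apply: cvg_at_right_filter; exact: cF.
    + by apply: cvg_at_left_filter; exact: cF.
  - by move=> t _; rewrite derive1E; have [_ ->] := dF t.
have E : (phi x)%:E = (\int[lebesgue_measure]_(t in D) (f t)%:E)%E.
  by rewrite I /F scale0r addr0 scaleNr p0 sube0.
rewrite -abse_EFin E (le_trans (le_abse_integral _ _ _))//.
  exact: measurable_itv.
  apply/measurable_EFinP; apply: measurable_funTS.
  exact: continuous_measurable_fun.
rewrite le_eqVlt; apply/orP; left; apply/eqP.
rewrite integral_mkcond; apply: eq_integral => t _; rewrite patchE /kap indicE.
by case: ifP => _ /=; rewrite ?mul1r ?mul0r.
Qed.

End line_averages.

(** * Sobolev pairs and density of test functions *)

Section poincare.
Context (R : realType) (N : nat).
Local Notation rV := 'rV[R]_N.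
Local Notation mu := (lebesgue_rV R N).
Variable Omega : set rV.
Implicit Types (a u phi : rV -> R) (g : 'I_N -> rV -> R) (x s : rV).

(** Membership in [H10] put on the whole space, with gradients by components and squared norms; it
    is meant for functions extended by zero, for which translates make sense. *)
Definition sobolev_pair u g := [/\ L2fun u, forall i, L2fun (g i) &
  forall eps : R, 0 < eps -> exists phi, [/\ C0infty Omega phi,
    (sqn (phi - u)%R <= eps%:E)%E &
    forall i, (sqn (partial i phi - g i)%R <= eps%:E)%E]].

Lemma sqreD_le (x y : \bar R) : (0 <= x)%E -> (0 <= y)%E ->
  ((x + y) ^+ 2 <= 2%:E * x ^+ 2 + 2%:E * y ^+ 2)%E.
Proof.
have y2 : ((+oo : \bar R) ^+ 2 = +oo)%E by rewrite expe2 mulyy.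
have m2 : (2%:E * +oo = +oo :> \bar R)%E by rewrite gt0_muley ?lte_fin.
case: x => [x| |]; case: y => [y| |] //; rewrite ?y2 ?m2.
- move=> _ _; rewrite -EFinD -!EFin_expe -!EFinM -EFinD lee_fin.
  by have := sqr_ge0 (x - y); nra.
- by move=> _ _; rewrite addey ?leey// -EFin_expe -EFinM.
- by move=> _ _; rewrite addye ?leey// -EFin_expe -EFinM.
- by move=> _ _; rewrite addye ?leey.
Qed.

Lemma le_eps_eq0 (x : \bar R) (K : R) : (0 <= x)%E ->
  (forall eps : R, 0 < eps -> (x <= (K * eps)%:E)%E) -> x = 0%E.
Proof.
move=> x0 xK; apply/eqP; rewrite eq_le x0 andbT.
apply/lee_addgt0Pr => e e0; rewrite add0e.
have K1 : 0 < `|K| + 1 by rewrite ltr_wpDl.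
apply: le_trans (xK (e / (`|K| + 1)) _) _; first by rewrite divr_gt0.
rewrite lee_fin mulrA ler_pdivrMr// mulrC (ler_wpM2l (ltW e0))//.
by rewrite (le_trans (ler_norm K))// lerDl.
Qed.

Hypothesis bO : bounded_set Omega.

(** The usual norm inequality would say nothing about the weight [a]. Instead [|u|] is shown to be
    bounded almost everywhere by the line average of [g i], a pointwise fact that can be translated
    and multiplied by any weight; the average is then controlled by [sqr_line_average_le]. *)
Lemma poincare_translation_bounded (i : 'I_N) : exists2 d : R, 0 < d &
  forall u g a (C : R), sobolev_pair u g -> measurable_fun setT a -> 0 <= C ->
    (forall s, sqn (fun x => a x * g i (x + s))%R <= C%:E)%E ->
    forall s, (sqn (fun x => a x * u (x + s))%R <= (d ^+ 2 * C)%:E)%E.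
Proof.
have [M M0 OM] : exists2 M : R, 0 < M & forall x, Omega x -> `|x| <= M.
  move: bO => [M [_ /(_ (`|M| + 1))]]; rewrite (le_lt_trans (ler_norm M)) ?ltrDl//.
  by move=> /(_ isT) h; exists (`|M| + 1) => //; rewrite ltr_wpDl.
(* Longer than the diameter of Omega, so that [x - d *: delta_mx 0 i] lies outside and test
   functions vanish there. *)
pose d := 2 * M + 1.
have d0 : 0 < d by rewrite addr_gt0// mulr_gt0.
exists d => // u g a C [[mu' ui] gi approx] ma C0 agC s.
have mg : measurable_fun setT (g i) by have [] := gi i.
pose la := @line_average R N i d.
have mla f : measurable_fun setT f -> measurable_fun setT (la f).
  exact: measurable_line_average.
have la0 f x : (0 <= la f x)%E by exact: line_average_ge0.
have phi_la phi x : C0infty Omega phi -> (`|phi x|%:E <= la (partial i phi) x)%E.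
  move=> cp; have [Ox|Ox] := pselect (Omega x); last first.
    by rewrite (C0infty_out cp Ox) normr0.
  apply: smooth_le_line_average => //; first exact: C0infty_smooth cp.
    exact: C0infty_bounded_support cp.
  apply: (C0infty_out cp) => /OM; apply/negP; rewrite -ltNge.
  have e1 : 1 <= `|delta_mx 0 i : rV|.
    by have := le_norm_coord (delta_mx 0 i : rV) i; rewrite mxE !eqxx normr1.
  have := ler_normB (x - d *: delta_mx 0 i) x.
  rewrite addrAC subrr add0r normrN normrZ gtr0_norm// => h.
  have := OM _ Ox; have : d <= d * `|delta_mx 0 i : rV| by rewrite ler_peMr// ltW.
  rewrite /d in h *; lra.
(* The excess of [|u|] over the line average. It is zero for test functions, and the excess for [u]
   is bounded by the approximation errors of [u] and of [g i]; hence its L^2 norm vanishes. *)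
pose p x : \bar R := maxe (`|u x|%:E - la (g i) x)%E 0%E.
have mp : measurable_fun setT p.
  apply: measurable_maxe => //; apply: emeasurable_funB; last exact: mla.
  by apply/measurable_EFinP; exact: measurableT_comp.
have p0 x : (0 <= p x)%E by rewrite le_max lexx orbT.
have mp2 : measurable_fun setT (fun x => p x ^+ 2)%E.
  by under eq_fun do rewrite expe2; exact: emeasurable_funM.
have p20 x : (0 <= p x ^+ 2)%E by rewrite sqre_ge0.
have ip : (\int[mu]_x (p x ^+ 2) = 0)%E.
  apply: (@le_eps_eq0 _ (2 + 2 * d ^+ 2)); first exact: integral_ge0.
  move=> eps eps0; have [phi [cp phiu phig]] := approx eps eps0.
  have sp := C0infty_smooth cp.
  have mphi : measurable_fun setT (phi - u)%R.
    by apply: measurable_funB => //; exact: smooth_measurable.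
  have mdphi : measurable_fun setT (partial i phi - g i)%R.
    apply: measurable_funB => //; apply: smooth_measurable; exact: smooth_partial.
  have mdp : measurable_fun setT (partial i phi).
    by apply: smooth_measurable; exact: smooth_partial.
  have pr x : (p x <= `|(phi - u)%R x|%:E + la (partial i phi - g i)%R x)%E.
    rewrite ge_max; apply/andP; split; last by rewrite adde_ge0.
    have [->|laf] := eqVneq (la (g i) x) +oo%E; first by rewrite addeNy leNye.
    have lafin : la (g i) x \is a fin_num by rewrite ge0_fin_numE// ltey.
    rewrite leeBlDr// -addeA.
    apply: (@le_trans _ _ (`|(phi - u)%R x|%:E + `|phi x|%:E)%E).
      rewrite -EFinD lee_fin -[(phi - u) x]/(phi x - u x) distrC.
      by rewrite -{1}(subrK (phi x) (u x)) ler_normD.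
    rewrite leeD2l// (le_trans (phi_la phi x cp))// addeC.
    exact: line_averageD.
  apply: (@le_trans _ _ (\int[mu]_x (2%:E * ((phi - u)%R x ^+ 2)%:E +
      2%:E * (la (partial i phi - g i)%R x) ^+ 2))%E).
    apply: ge0_le_integral => //.
    - apply: emeasurable_funD; apply: emeasurable_funM => //.
        exact: measurable_sqr_EFin.
      by under eq_fun do rewrite expe2; apply: emeasurable_funM; exact: mla.
    - move=> x _; apply: (@le_trans _ _ ((`|(phi - u)%R x|%:E +
        la (partial i phi - g i)%R x) ^+ 2)%E).
        by rewrite !expe2 lee_pmul.
      apply: (le_trans (sqreD_le _ _)) => //.
      by rewrite -EFin_expe real_normK ?num_real.
  rewrite ge0_integralD//; last 4 first.
  - by move=> x _; rewrite mule_ge0// lee_fin sqr_ge0.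
  - by apply: emeasurable_funM => //; exact: measurable_sqr_EFin.
  - by move=> x _; rewrite mule_ge0// sqre_ge0.
  - apply: emeasurable_funM => //.
    by under eq_fun do rewrite expe2; apply: emeasurable_funM; exact: mla.
  rewrite !ge0_integralZl_EFin//; last 4 first.
  - by move=> x _; rewrite sqre_ge0.
  - by under eq_fun do rewrite expe2; apply: emeasurable_funM; exact: mla.
  - by move=> x _; rewrite lee_fin sqr_ge0.
  - exact: measurable_sqr_EFin.
  rewrite [leRHS](_ : _ = 2%:E * eps%:E + 2%:E * (d ^+ 2 * eps)%:E)%E; last first.
    by rewrite -!EFinM -EFinD mulrDl -mulrA.
  apply: leeD; first by rewrite lee_wpmul2l.
  rewrite lee_wpmul2l//.
  have := @sqr_line_average_le R N i d d0 (cst 1) (partial i phi - g i) eps 0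
     (measurable_cst _) mdphi (ltW eps0).
  rewrite [X in (X <= _)%E](_ : _ = \int[mu]_x (la (partial i phi - g i)%R x ^+ 2))%E.
    apply => t; rewrite (_ : (fun x => _) = (fun x => (partial i phi - g i) (x + t))).
      by rewrite sqn_translate.
    by apply/funext => x; rewrite mul1r.
  by apply: eq_integral => x _; rewrite expr1n mul1e addr0.
have ips : (\int[mu]_x `|p (x + s)%R ^+ 2| = 0)%E.
  rewrite -[RHS]ip -(@ge0_integral_shift_rV _ _ s (fun x => p x ^+ 2)%E)//.
  by apply: eq_integral => x _; rewrite gee0_abs.
have mps : measurable_fun setT (fun x => p (x + s)%R ^+ 2)%E.
  exact: (measurableT_comp mp2 (measurable_shift_rV s)).
have aep := (@ae_eq_integral_abs _ _ _ mu setT measurableT _ mps).1 ips.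
have mlas : measurable_fun setT (fun x => la (g i) (x + s)%R).
  exact: (measurableT_comp (mla _ mg) (measurable_shift_rV s)).
have key (x : rV) : (p (x + s)%R ^+ 2 = 0)%E ->
    (((a x * u (x + s)) ^+ 2)%:E <= (a x ^+ 2)%:E * la (g i) (x + s)%R ^+ 2)%E.
  move=> /eqP; rewrite expe_eq0 => /andP[_ /eqP px].
  have ula : (`|u (x + s)%R|%:E <= la (g i) (x + s)%R)%E.
    have : (`|u (x + s)%R|%:E - la (g i) (x + s)%R <= 0)%E by rewrite -px le_max lexx.
    by rewrite sube_le0.
  rewrite exprMn EFinM; apply: lee_pmul => //; rewrite ?lee_fin ?sqr_ge0//.
  by rewrite -(real_normK (num_real (u _))) EFin_expe !expe2 lee_pmul.
apply: (@le_trans _ _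
  (\int[mu]_x ((a x ^+ 2)%:E * la (g i) (x + s)%R ^+ 2))%E); last first.
  exact: sqr_line_average_le.
apply: ae_ge0_le_integral => //.
- by move=> x _; rewrite lee_fin sqr_ge0.
- apply: measurable_sqr_EFin; apply: measurable_funM => //.
  exact: measurable_translate.
- by move=> x _; rewrite mule_ge0 ?lee_fin ?sqr_ge0// sqre_ge0.
- apply: emeasurable_funM; first exact: measurable_sqr_EFin.
  by under eq_fun do rewrite expe2; exact: emeasurable_funM.
- by apply: filterS aep => x /(_ I) px2 _; exact: key px2.
Qed.

End poincare.

(** * Continuity of translations, in L^2 and against an integrable factor *)

Section weighted_translations.
Context (R : realType) (N : nat).
Local Notation rV := 'rV[R]_N.
Local Notation mu := (lebesgue_rV R N).
Implicit Types (a f g u phi w F : rV -> R) (x s t v : rV).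

Lemma sqn_translate_smooth phi : smooth phi -> bounded_support phi ->
  exists2 K : R, 0 <= K & forall t, `|t| < 1 ->
    (sqn (fun x => phi (x + t) - phi x)%R <= (K * `|t| ^+ 2)%:E)%E.
Proof.
move=> sp bp; have [L L0 lip] := smooth_lipschitz sp bp; have [M pM] := bp.
exists (L ^+ 2 * (2 * (`|M| + 2)) ^+ N).
  by rewrite mulr_ge0 ?sqr_ge0// exprn_ge0// mulr_ge0// addr_ge0.
move=> t t1; have M2 : 0 < `|M| + 2 by rewrite ltr_wpDl.
rewrite mulrAC -exprMn.
rewrite -(@integral_indic_ball R N ((L * `|t|) ^+ 2) 0)// ?sqr_ge0//.
have mp := smooth_measurable sp.
apply: ge0_le_integral => //.
- by move=> x _; rewrite lee_fin sqr_ge0.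
- apply: measurable_sqr_EFin; apply: measurable_funB => //.
  exact: measurable_translate.
- apply/measurable_EFinP; apply: measurable_funM => //.
  by apply: measurable_indic; exact: measurable_ball_rV.
- move=> x _; rewrite lee_fin indicE.
  have [xB|xB] := boolP (x \in _).
    rewrite mulr1 -(real_normK (num_real (_ - _))) lerXn2r ?nnegrE ?mulr_ge0//.
  suff xM : `|M| + 1 < `|x|.
    rewrite !pM ?subrr ?expr0n ?mulr0//.
      by rewrite (le_lt_trans (ler_norm M))// (le_lt_trans _ xM)// lerDl.
    have := ler_normB (x + t) t; rewrite addrK => h.
    have := ler_norm M; lra.
  move: xB; rewrite notin_setE mx_norm_ball /ball_/= sub0r normrN => /negP.
  by rewrite -leNgt; apply: lt_le_trans; rewrite ltrD2l ltr1n.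
Qed.

Definition L2_smooth_approximable g := forall eps : R, 0 < eps ->
  exists phi, [/\ smooth phi, bounded_support phi & (sqn (phi - g)%R <= eps%:E)%E].

Lemma sqn_translate_cvg g : measurable_fun setT g -> L2_smooth_approximable g ->
  forall eps : R, 0 < eps -> exists2 d : R, 0 < d & forall t, `|t| < d ->
    (sqn (fun x => g (x + t) - g x)%R <= eps%:E)%E.
Proof.
move=> mg ag eps eps0.
(* Three errors of size [eps / 12] enter through [sqnD], used twice: 2/12 + 2 * (2/12 + 2/12) <
   1. *)
have e12 : 0 < eps / 12 by rewrite divr_gt0.
have [phi [sp bp phig]] := ag _ e12.
have [K K0 tK] := sqn_translate_smooth sp bp.
have mp := smooth_measurable sp.
have D0 : 0 < 12 * K + 1 by rewrite ltr_wpDl// mulr_ge0.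
exists (Num.min 1 (Num.min 1 eps / (12 * K + 1))).
  by rewrite lt_min ltr01/= divr_gt0// lt_min ltr01.
move=> t; rewrite lt_min => /andP[t1 td].
have tm : `|t| < Num.min 1 eps / (12 * K + 1) by [].
have tK12 : K * `|t| ^+ 2 <= eps / 12.
  rewrite expr2 ler_pdivlMr// -mulrA.
  have h : `|t| * (12 * K + 1) <= eps.
    by rewrite -ler_pdivlMr// (le_trans (ltW tm))// ler_pM2r ?invr_gt0// ge_min lexx orbT.
  have h2 : K * (`|t| * `|t|) * 12 <= `|t| * (12 * K).
    have : `|t| * `|t| <= `|t| by rewrite ler_piMr// ltW.
    move=> tt; have := ler_wpM2l K0 tt; lra.
  rewrite -mulrA in h2; apply: (le_trans h2).
  apply: le_trans h; rewrite ler_wpM2l//; lra.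
pose A x := g (x + t) - phi (x + t); pose B x := phi (x + t) - phi x.
have mgt : measurable_fun setT (fun x => g (x + t)) by exact: measurable_translate.
have mpt : measurable_fun setT (fun x => phi (x + t)) by exact: measurable_translate.
have mA : measurable_fun setT A by exact: measurable_funB.
have mB : measurable_fun setT B by exact: measurable_funB.
have mD : measurable_fun setT (phi - g) by exact: measurable_funB.
have -> : (fun x => g (x + t) - g x) = A + (B + (phi - g)).
  by apply/funext => x; rewrite -[RHS]/(A x + (B x + (phi x - g x))) /A /B; ring.
have sA : (sqn A <= (eps / 12)%:E)%E.
  rewrite (_ : sqn A = sqn (phi - g)%R)// -(sqn_translate t mD).
  by apply: eq_integral => x _; rewrite /A -[(phi - g) _]/(_ - _) -sqrrN opprB.
have sB : (sqn B <= (eps / 12)%:E)%E.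
  by apply: (le_trans (tK t t1)); rewrite lee_fin.
have mBD : measurable_fun setT (B + (phi - g)) by exact: measurable_funD.
apply: (le_trans (sqnD mA mBD)).
apply: (@le_trans _ _ (2%:E * (eps / 12)%:E + 2%:E * (2%:E * (eps / 12)%:E +
    2%:E * (eps / 12)%:E))%E).
  apply: leeD; apply: lee_wpmul2l => //.
  apply: (le_trans (sqnD mB mD)).
  by apply: leeD; apply: lee_wpmul2l.
rewrite -!(EFinM, EFinD) lee_fin; lra.
Qed.

(** [F] stands for a component of the product of a skew matrix and a gradient: only integrable, but
    dominated by a matrix weight [a] times an L^2 function [w]. *)
Variables (a w F : rV -> R).
Hypothesis ma : measurable_fun setT a.
Hypothesis w2 : L2fun w.
Hypothesis mF : measurable_fun setT F.
Hypothesis Faw : forall x, `|F x| <= `|a x| * `|w x|.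
Hypothesis F1 : (\int[mu]_x `|F x|%:E < +oo)%E.

(** Dominated convergence: [w ^ 2] is integrable and [F] is finite everywhere, so the sets where
    [|F|] exceeds [M] shrink to the empty set. *)
Lemma tail_sqr_cvg : forall eps : R, 0 < eps ->
  exists2 M : R, 0 < M &
    (\int[mu]_x (w x ^+ 2 * (M < `|F x|)%R%:R)%:E <= eps%:E)%E.
Proof.
move=> eps eps0; have [mw wfin] := w2.
have iw2 : mu.-integrable setT (fun x => (w x ^+ 2)%:E).
  apply/integrableP; split; first exact: measurable_sqr_EFin.
  rewrite (eq_integral (fun x => (w x ^+ 2)%:E))// => x _ /=.
  by rewrite ger0_norm// sqr_ge0.
pose f n x := (w x ^+ 2 * ((n.+1%:R : R) < `|F x|)%R%:R)%:E.
have mf n : measurable_fun setT (f n).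
  apply/measurable_EFinP; apply: measurable_funM; first exact: measurable_funX.
  rewrite (_ : (fun x => _) = \1_[set x | n.+1%:R < `|F x|]); last first.
    by apply/funext => x; rewrite indicE; congr (_%:R); congr nat_of_bool;
      apply/idP/idP => h; [rewrite inE|rewrite inE in h].
  apply: measurable_indic; rewrite -[X in measurable X]setTI.
  have mnF : measurable_fun setT (fun x => `|F x|) by exact: measurableT_comp.
  have := mnF measurableT `]n.+1%:R, +oo[%classic (measurable_itv _).
  congr measurable; congr (_ `&` _); apply/seteqP; split => x /=;
    by rewrite in_itv/= andbT.
have f0 n x : (0 <= f n x)%E by rewrite lee_fin mulr_ge0 ?sqr_ge0.
have cvf : {ae mu, forall x, setT x -> f ^~ x @ \oo --> (cst 0%E : rV -> \bar R) x}.
  apply: aeW => x _; apply: cvg_near_cst.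
  exists (Num.truncn `|F x|).+1 => // n /= Fn.
  rewrite /f ltNge (_ : `|F x| <= n.+1%:R) ?mulr0//.
  rewrite (le_trans (ltW (truncnS_gt _)))// ler_nat.
  exact: leq_trans Fn _.
have domf : {ae mu, forall x n, setT x -> (`|f n x| <= (w x ^+ 2)%:E)%E}.
  apply: aeW => x n _; rewrite gee0_abs// lee_fin.
  by case: (_ < _); rewrite ?mulr1// mulr0 sqr_ge0.
have [_ _ cf] := dominated_convergence measurableT mf (measurable_cst _) cvf iw2 domf.
rewrite integral0 in cf.
have /cf[n _ /(_ n (leqnn n)) fn] : \forall y \near (0 : \bar R)%E, (y < eps%:E)%E.
  by apply: open_ereal_lt'; rewrite lte_fin.
by exists n.+1%:R => //; exact: ltW.
Qed.

Lemma ler_amgm (e x y : R) : 0 < e -> `|x * y| <= e * x ^+ 2 + e^-1 * y ^+ 2.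
Proof.
move=> e0; have -> : y = e * (y / e) by rewrite mulrC divfK// gt_eqF.
set z := y / e; rewrite [e^-1 * _](_ : _ = e * z ^+ 2); last first.
  by rewrite exprMn expr2 -mulrA mulKf// gt_eqF.
rewrite mulrCA normrM (gtr0_norm e0) -mulrDr ler_pM2l// ler_norml.
have := sqr_ge0 (x + z); have := sqr_ge0 (x - z).
have := sqr_ge0 x; have := sqr_ge0 z; nra.
Qed.

Lemma ge0_integral_le_add (f g h : rV -> R) : measurable_fun setT f ->
  measurable_fun setT g -> measurable_fun setT h ->
  (forall x, 0 <= f x) -> (forall x, 0 <= g x) -> (forall x, 0 <= h x) ->
  (forall x, f x <= g x + h x) ->
  (\int[mu]_x (f x)%:E <= \int[mu]_x (g x)%:E + \int[mu]_x (h x)%:E)%E.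
Proof.
move=> mf mg mh f0 g0 h0 fgh.
rewrite -ge0_integralD//; try by [move=> x _; rewrite lee_fin|exact/measurable_EFinP].
apply: ge0_le_integral => //.
- by move=> x _; rewrite lee_fin.
- exact/measurable_EFinP.
- by apply: emeasurable_funD; exact/measurable_EFinP.
- by move=> x _; rewrite -EFinD lee_fin.
Qed.

Lemma ge0_integralZ (k : R) (f : rV -> R) : 0 <= k -> measurable_fun setT f ->
  (forall x, 0 <= f x) ->
  (\int[mu]_x (k * f x)%:E = k%:E * \int[mu]_x (f x)%:E)%E.
Proof.
move=> k0 mf f0; rewrite -ge0_integralZl_EFin//.
- by move=> x _; rewrite lee_fin.
- exact/measurable_EFinP.
Qed.

(** Where [|F| <= M], the factor is bounded and the continuity of translations in L^2 suffices.
    Where [|F| > M], the weight is moved onto the difference: [a] times it is bounded in L^2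
    uniformly in [t], because all translates are, while [w] is small there. The threshold [M] is
    chosen before the size of [t]. *)
Lemma weighted_translate_cvg g : translation_bounded a g ->
  L2_smooth_approximable g ->
  forall eps : R, 0 < eps -> exists2 d : R, 0 < d & forall t, `|t| < d ->
    (\int[mu]_x `|(g (x + t) - g x) * F x|%:E <= eps%:E)%E.
Proof.
move=> [mg [C C0 gC]] ag eps eps0; have [mw _] := w2.
(* The weighted difference has squared norm at most [4 * C], so [eta] makes its contribution at most
   [eps / 4]; the extra 4 keeps the denominator positive. *)
pose eta := eps / (16 * C + 4).
have c0 : 0 < 16 * C + 4 by rewrite ltr_wpDl// mulr_ge0.
have eta0 : 0 < eta by rewrite divr_gt0.
have [|M M0 tail] := tail_sqr_cvg (eps := eta * (eps / 4)).
  by rewrite mulr_gt0// divr_gt0.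
pose I := fine (\int[mu]_x `|F x|%:E).
have IE : (\int[mu]_x `|F x|%:E = I%:E)%E.
  by rewrite fineK// ge0_fin_numE// integral_ge0// => x _; rewrite lee_fin.
have I0 : 0 <= I by rewrite fine_ge0// integral_ge0// => x _; rewrite lee_fin.
(* Now that [M] is fixed, [eta' * M * I] is at most [eps / 4]. *)
pose eta' := eps / (4 * (M * I) + 4).
have c'0 : 0 < 4 * (M * I) + 4 by rewrite ltr_wpDl// mulr_ge0// mulr_ge0// ltW.
have eta'0 : 0 < eta' by rewrite divr_gt0.
have [|d d0 sD] := sqn_translate_cvg mg ag (eps := eta' * (eps / 4)).
  by rewrite mulr_gt0// divr_gt0.
exists d => // t td.
pose D x := g (x + t) - g x.
have mgt s : measurable_fun setT (fun x => g (x + s)) by exact: measurable_translate.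
have mD : measurable_fun setT D by exact: measurable_funB.
have maD : measurable_fun setT (fun x => a x * D x) by exact: measurable_funM.
have mFn : measurable_fun setT (fun x => `|F x|) by exact: measurableT_comp.
pose W x := w x ^+ 2 * (M < `|F x|)%R%:R.
have mW : measurable_fun setT W.
  apply: measurable_funM; first exact: measurable_funX.
  rewrite (_ : (fun x => _) = \1_[set x | M < `|F x|]); last first.
    by apply/funext => x; rewrite indicE; congr (_%:R); congr nat_of_bool;
      apply/idP/idP => h; [rewrite inE|rewrite inE in h].
  apply: measurable_indic; rewrite -[X in measurable X]setTI.
  have := mFn measurableT `]M, +oo[%classic (measurable_itv _).
  congr measurable; congr (_ `&` _); apply/seteqP; split => x /=;
    by rewrite in_itv/= andbT.
have W0 x : 0 <= W x by rewrite mulr_ge0 ?sqr_ge0.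
have aD : (\int[mu]_x ((a x * D x) ^+ 2)%:E <= (4 * C)%:E)%E.
  rewrite (_ : integral _ _ _ =
     sqn ((fun x => a x * g (x + t)) + (fun x => -1 * (a x * g (x + 0))))%R).
    apply: (le_trans (sqnD _ _)).
    - exact: measurable_funM.
    - by apply: measurable_funM => //; exact: measurable_funM.
    rewrite sqnZ; last exact: measurable_funM.
    rewrite sqrrN expr1n mul1e.
    apply: (le_trans (leeD (lee_wpmul2l _ (gC t)) (lee_wpmul2l _ (gC 0)))) => //.
    by rewrite -!(EFinM, EFinD) lee_fin; lra.
  apply: eq_integral => x _; congr ((_ ^+ 2)%:E).
  by rewrite -[RHS]/(a x * g (x + t) + -1 * (a x * g (x + 0))) addr0 /D; ring.
(* By the weighted arithmetic-geometric inequality, [G1 + G2] dominates the integrand where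
   [|F| <= M] and [G3 + G4] dominates it elsewhere; each of the four integrals is at most
   [eps / 4]. *)
pose G1 x := eta' * M * `|F x|; pose G2 x := eta'^-1 * D x ^+ 2.
pose G3 x := eta * (a x * D x) ^+ 2; pose G4 x := eta^-1 * W x.
have mD2 : measurable_fun setT (fun x => D x ^+ 2) by exact: measurable_funX.
have maD2 : measurable_fun setT (fun x => (a x * D x) ^+ 2) by exact: measurable_funX.
have mG1 : measurable_fun setT G1 by exact: measurable_funM.
have mG2 : measurable_fun setT G2 by exact: measurable_funM.
have mG3 : measurable_fun setT G3 by exact: measurable_funM.
have mG4 : measurable_fun setT G4 by exact: measurable_funM.
have G10 x : 0 <= G1 x by rewrite mulr_ge0// mulr_ge0// ltW.
have G20 x : 0 <= G2 x by rewrite mulr_ge0 ?sqr_ge0// invr_ge0 ltW.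
have G30 x : 0 <= G3 x by rewrite mulr_ge0 ?sqr_ge0// ltW.
have G40 x : 0 <= G4 x by rewrite mulr_ge0// invr_ge0 ltW.
apply: (@le_trans _ _ (\int[mu]_x ((G1 x + G2 x)%R)%:E + \int[mu]_x ((G3 x + G4 x)%R)%:E)%E).
  apply: ge0_integral_le_add.
  - by apply: measurableT_comp => //; exact: measurable_funM.
  - exact: measurable_funD.
  - exact: measurable_funD.
  - by [].
  - by move=> x; rewrite addr_ge0.
  - by move=> x; rewrite addr_ge0.
  - move=> x; rewrite -/(D x); have [FM|FM] := leP `|F x| M.
      rewrite ler_wpDr ?addr_ge0// mulrC.
      apply: (le_trans (ler_amgm (F x) (D x) eta'0)); rewrite lerD2r.
      rewrite /G1 -mulrA (ler_wpM2l (ltW eta'0))//.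
      by rewrite -(real_normK (num_real (F x))) expr2 ler_wpM2r.
    rewrite ler_wpDl ?addr_ge0// /G4 /W FM mulr1.
    apply: le_trans (ler_amgm (a x * D x) (w x) eta0).
    by rewrite !normrM mulrAC [leRHS]mulrC [`|D x| * _]mulrC [leRHS]mulrC ler_wpM2r.
apply: (@le_trans _ _ ((eta' * M * I)%:E + (eps / 4)%:E + ((eta * (4 * C))%:E + (eps / 4)%:E))%E).
  apply: leeD.
  - apply: (le_trans (ge0_integral_le_add _ mG1 mG2 _ G10 G20 (fun x => lexx _))).
    + exact: measurable_funD.
    + by move=> x; rewrite addr_ge0.
    apply: leeD.
    + rewrite ge0_integralZ//; last by rewrite mulr_ge0// ltW.
      by rewrite IE -EFinM.
    + rewrite ge0_integralZ// ?invr_ge0 ?(ltW eta'0)//; last by move=> x; exact: sqr_ge0.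
      apply: (le_trans (lee_wpmul2l _ (sD t td))).
        by rewrite lee_fin invr_ge0 ltW.
      by rewrite -EFinM lee_fin mulKf// gt_eqF.
  - apply: (le_trans (ge0_integral_le_add _ mG3 mG4 _ G30 G40 (fun x => lexx _))).
    + exact: measurable_funD.
    + by move=> x; rewrite addr_ge0.
    apply: leeD.
    + rewrite ge0_integralZ// ?(ltW eta0)//; last by move=> x; exact: sqr_ge0.
      by rewrite [leRHS]EFinM lee_wpmul2l// lee_fin ltW.
    + rewrite ge0_integralZ// ?invr_ge0 ?(ltW eta0)//.
      apply: (le_trans (lee_wpmul2l _ tail)).
        by rewrite lee_fin invr_ge0 ltW.
      by rewrite -EFinM lee_fin mulKf// gt_eqF.
rewrite -!EFinD lee_fin.
have h1 : eta' * M * I <= eps / 4.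
  rewrite /eta' -mulrA mulrAC -mulrA ler_wpM2l// ?(ltW eps0)//.
  rewrite ler_pdivrMr// mulrDr; lra.
have h2 : eta * (4 * C) <= eps / 4.
  rewrite /eta mulrAC -mulrA ler_wpM2l// ?(ltW eps0)//.
  rewrite ler_pdivrMr// mulrDr; lra.
lra.
Qed.

End weighted_translations.

(** * The error of averaging a smooth approximation *)

Section smoothing_error.
Context (R : realType) (N : nat).
Local Notation rV := 'rV[R]_N.
Local Notation mu := (lebesgue_rV R N).
Implicit Types (f g h F : rV -> R) (x s t v : rV).

Variables (kap : rV -> R) (k : R).
Hypothesis mkap : measurable_fun setT kap.
Hypothesis kap0 : forall t, 0 <= kap t.
Hypothesis kapk : forall t, kap t <= k.
Hypothesis kap1 : (\int[mu]_t (kap t)%:E = 1%:E)%E.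

Variables (f g F : rV -> R) (s eps I : R).
Hypothesis sf : smooth f.
Hypothesis bf : bounded_support f.
Hypothesis mg : measurable_fun setT g.
Hypothesis mF : measurable_fun setT F.
Hypothesis IF : (\int[mu]_x `|F x|%:E = I%:E)%E.
Hypothesis fgs : (sqn (f - g)%R <= s%:E)%E.
Hypothesis eps0 : 0 <= eps.

Let mf : measurable_fun setT f. Proof. exact: smooth_measurable. Qed.

Let mfg : measurable_fun setT (f - g). Proof. exact: measurable_funB. Qed.

Let mpair h : measurable_fun setT h ->
  measurable_fun setT (fun p : rV * rV => h (p.1 + p.2)).
Proof. by move=> mh; exact: (measurableT_comp mh (@measurable_add_rV R N)). Qed.

Let mshift h x : measurable_fun setT h -> measurable_fun setT (fun t => h (x + t)).
Proof.
move=> mh; under eq_fun do rewrite addrC; exact: measurable_translate.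
Qed.

Let H1 (p : rV * rV) := `|(f - g) (p.1 + p.2)|.
Let H2 (p : rV * rV) := `|g (p.1 + p.2) - g p.1|.

Let mH1 : measurable_fun setT H1.
Proof. by apply: measurableT_comp => //; exact: mpair. Qed.

Let mH2 : measurable_fun setT H2.
Proof.
apply: measurableT_comp => //; apply: measurable_funB; first exact: mpair.
exact: (measurableT_comp mg measurable_fst).
Qed.

Let A x := (\int[mu]_t (kap t * H1 (x, t))%:E)%E.
Let B x := (\int[mu]_t (kap t * H2 (x, t))%:E)%E.

Let mAB (H : rV * rV -> R) : measurable_fun setT H -> (forall p, 0 <= H p) ->
  measurable_fun setT (fun x => \int[mu]_t (kap t * H (x, t))%:E)%E.
Proof.
move=> mH H0; apply: (measurable_fun_fubini_tonelli_F (m2 := mu)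
  (fun p : rV * rV => (kap p.2 * H p)%:E)).
  apply/measurable_EFinP; apply: measurable_funM => //.
  exact: (measurableT_comp mkap measurable_snd).
by move=> p; rewrite lee_fin mulr_ge0.
Qed.

Let H10 p : 0 <= H1 p. Proof. exact: normr_ge0. Qed.
Let H20 p : 0 <= H2 p. Proof. exact: normr_ge0. Qed.
Let mA : measurable_fun setT A. Proof. exact: (mAB mH1). Qed.
Let mB : measurable_fun setT B. Proof. exact: (mAB mH2). Qed.
Let A0 x : (0 <= A x)%E.
Proof. by apply: integral_ge0 => t _; rewrite lee_fin mulr_ge0. Qed.
Let B0 x : (0 <= B x)%E.
Proof. by apply: integral_ge0 => t _; rewrite lee_fin mulr_ge0. Qed.

(** Inserting [g (x + t)] separates the approximation error of [f], averaged in [A], from the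
    oscillation of [g] on the support of the kernel, averaged in [B]. *)
Let smoothing_dist x : (`|smoothing kap f x - g x|%:E <= A x + B x)%E.
Proof.
have bmf := bounded_measurable_shift x (bounded_measurable_smooth sf bf).
have bmg : bounded_measurable (cst (- g x) : rV -> R).
  by split; [exact: measurable_cst|exists `|g x| => t; rewrite normrN].
have bmfg := bounded_measurableD bmf bmg.
have -> : smoothing kap f x - g x =
    \int[mu]_t (kap t * ((fun t => f (x + t)) + cst (- g x)) t).
  rewrite (wintD mkap kap0 kap1 bmf bmg); congr (_ + _).
  rewrite (_ : (fun t => _) = (fun t => - g x * (kap t * 1))); last first.
    by apply/funext => t; rewrite mulr1 mulrC.
  have bm1 : bounded_measurable (cst 1 : rV -> R).
    by split; [exact: measurable_cst|exists 1 => t; rewrite normr1].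
  rewrite RintegralZl//; last exact: (integrable_weight mkap kap0 kap1 bm1).
  rewrite (_ : \int[mu]_t (kap t * 1) = 1) ?mulr1//.
  by rewrite /Rintegral; under eq_integral do rewrite mulr1; rewrite kap1.
have ii := integrable_weight mkap kap0 kap1 bmfg.
apply: (@le_trans _ _ (\int[mu]_t `|kap t * (f (x + t) - g x)|%:E)%E).
  have := le_normr_Rintegral measurableT ii; rewrite -lee_fin => /le_trans; apply.
  rewrite /Rintegral fineK//.
  by apply: integrable_fin_num => //; exact: (integrable_abse ii).
have mx H : measurable_fun setT H -> measurable_fun setT (fun t : rV => kap t * H (x, t)).
  move=> mH; apply: measurable_funM => //; exact: measurableT_comp.
apply: (ge0_integral_le_add _ (mx _ mH1) (mx _ mH2)).
- apply: measurableT_comp => //; apply: measurable_funM => //.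
  by apply: measurable_funB => //; exact: mshift.
- by [].
- by move=> t; rewrite mulr_ge0.
- by move=> t; rewrite mulr_ge0.
- move=> t; rewrite normrM ger0_norm// -mulrDr ler_wpM2l// /H1 /H2 /=.
  by rewrite (le_trans _ (ler_normD _ _))// -[(f - g) _]/(_ - _) addrA subrK.
Qed.

Let msm : measurable_fun setT (fun x => smoothing kap f x - g x).
Proof.
apply: measurable_funB => //; apply: smooth_measurable.
exact: (smooth_smoothing mkap kap0 kap1).
Qed.

Lemma sqn_smoothing_error :
  (forall t, kap t != 0 -> (sqn (fun x => g (x + t) - g x)%R <= eps%:E)%E) ->
  (sqn (smoothing kap f - g)%R <= (2 * s + 2 * eps)%:E)%E.
Proof.
move=> geps.
have s0 : 0 <= s by rewrite -lee_fin (le_trans _ fgs)// sqn_ge0.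
have mE2 (X : rV -> \bar R) : measurable_fun setT X ->
    measurable_fun setT (fun x => X x ^+ 2)%E.
  by move=> mX; under eq_fun do rewrite expe2; exact: emeasurable_funM.
apply: (@le_trans _ _ (\int[mu]_x (2%:E * A x ^+ 2 + 2%:E * B x ^+ 2))%E).
  apply: ge0_le_integral => //.
  - by move=> x _; rewrite lee_fin sqr_ge0.
  - exact: measurable_sqr_EFin.
  - by apply: emeasurable_funD; apply: emeasurable_funM => //; exact: mE2.
  - move=> x _; apply: le_trans (sqreD_le (A0 x) (B0 x)).
    rewrite -(real_normK (num_real _)) EFin_expe !expe2.
    by apply: lee_pmul => //; exact: smoothing_dist.
have AB (H : rV * rV -> R) (C : R) : measurable_fun setT H -> (forall p, 0 <= H p) ->
    0 <= C ->
    (forall t, kap t != 0 -> (\int[mu]_x (H (x, t) ^+ 2)%:E <= C%:E)%E) ->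
    (\int[mu]_x ((\int[mu]_t (kap t * H (x, t))%:E) ^+ 2) <= C%:E)%E.
  move=> mH H0 C0 HC.
  have := @ge0_sqr_integral_kernel_le R _ _ _ _ mu mu kap 1 C (cst 1) H mkap kap0 kap1
    C0 (measurable_cst _) mH H0.
  rewrite expr1n mul1r => h; apply: le_trans (h _).
    rewrite le_eqVlt; apply/orP; left; apply/eqP; apply: eq_integral => x _.
    by rewrite mul1e.
  move=> t kt; apply: le_trans (HC t kt).
  by rewrite le_eqVlt; apply/orP; left; apply/eqP; apply: eq_integral => x _;
      rewrite /cst mul1r.
have A2 : (\int[mu]_x (A x ^+ 2) <= s%:E)%E.
  apply: AB => // t _; apply: le_trans fgs; rewrite -(sqn_translate t mfg).
  by rewrite le_eqVlt; apply/orP; left; apply/eqP; apply: eq_integral => x _;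
    rewrite real_normK ?num_real.
have B2 : (\int[mu]_x (B x ^+ 2) <= eps%:E)%E.
  apply: AB => // t kt; apply: le_trans (geps t kt).
  by rewrite le_eqVlt; apply/orP; left; apply/eqP; apply: eq_integral => x _;
    rewrite real_normK ?num_real.
rewrite ge0_integralD//; last 4 first.
- by move=> x _; rewrite mule_ge0// sqre_ge0.
- by apply: emeasurable_funM => //; exact: mE2.
- by move=> x _; rewrite mule_ge0// sqre_ge0.
- by apply: emeasurable_funM => //; exact: mE2.
rewrite !ge0_integralZl_EFin//; try by [move=> x _; rewrite sqre_ge0|exact: mE2].
apply: (le_trans (leeD (lee_wpmul2l _ A2) (lee_wpmul2l _ B2))) => //.
Qed.

(** The L^2 error of [f] says nothing against [F], which is only integrable. After averaging it is
    bounded uniformly: [kap * |f - g|] is at most [eta * k * kap + eta^-1 * |f - g| ^ 2], with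
    integral at most [eta * k + eta^-1 * s]. For a fixed kernel this is small once [eta], and then
    [s], are. The oscillation of [g] is paired with [F] slice by slice. *)
Lemma weighted_smoothing_error (eta : R) : 0 < eta ->
  (forall t, kap t != 0 ->
    (\int[mu]_x `|(g (x + t) - g x) * F x|%:E <= eps%:E)%E) ->
  (\int[mu]_x `|(smoothing kap f x - g x) * F x|%:E <=
    ((eta * k + eta^-1 * s) * I + eps)%:E)%E.
Proof.
move=> eta0 geps; set c := eta * k + eta^-1 * s.
have s0 : 0 <= s by rewrite -lee_fin (le_trans _ fgs)// sqn_ge0.
have k0 : 0 <= k by rewrite (le_trans (kap0 0)).
have c0 : 0 <= c by rewrite addr_ge0// mulr_ge0// ?invr_ge0 ltW.
have Ac x : (A x <= c%:E)%E.
  have mk2 : measurable_fun setT (fun t => eta * k * kap t) by exact: measurable_funM.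
  have mfgx : measurable_fun setT (fun t => eta^-1 * (f - g) (x + t) ^+ 2).
    by apply: measurable_funM => //; apply: measurable_funX; exact: (mshift x mfg).
  apply: (le_trans (ge0_integral_le_add _ mk2 mfgx _ _ _ _)).
  - apply: measurable_funM => //; apply: measurableT_comp => //; exact: (mshift x mfg).
  - by move=> t; rewrite mulr_ge0.
  - by move=> t; rewrite mulr_ge0// mulr_ge0// ltW.
  - by move=> t; rewrite mulr_ge0 ?sqr_ge0// invr_ge0 ltW.
  - move=> t; apply: (@le_trans _ _ (eta * kap t ^+ 2 + eta^-1 * (f - g) (x + t) ^+ 2)).
      apply: le_trans (ler_amgm _ _ eta0); rewrite normrM.
      by rewrite [X in _ <= X * _]ger0_norm.
    by rewrite lerD2r -mulrA expr2 (ler_wpM2l (ltW eta0))// ler_wpM2r.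
  rewrite EFinD; apply: leeD.
    by rewrite ge0_integralZ// ?kap1 ?mule1// mulr_ge0// ltW.
  rewrite ge0_integralZ//.
  - rewrite [leRHS]EFinM lee_wpmul2l//; first by rewrite lee_fin invr_ge0 ltW.
    apply: le_trans fgs; rewrite -(sqn_translate x mfg).
    by rewrite le_eqVlt; apply/orP; left; apply/eqP; apply: eq_integral => t _;
      rewrite [x + t]addrC.
  - by rewrite invr_ge0 ltW.
  - by apply: measurable_funX; exact: (mshift x mfg).
  - by move=> t; rewrite sqr_ge0.
pose H3 (p : rV * rV) := `|(g (p.1 + p.2) - g p.1) * F p.1|.
have mH3 : measurable_fun setT H3.
  apply: measurableT_comp => //; apply: measurable_funM.
    apply: measurable_funB; first exact: mpair.
    exact: (measurableT_comp mg measurable_fst).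
  exact: (measurableT_comp mF measurable_fst).
have H30 p : 0 <= H3 p by exact: normr_ge0.
have mH2x x : measurable_fun setT (fun t => kap t * H2 (x, t)).
  by apply: measurable_funM => //; exact: measurableT_comp.
apply: (@le_trans _ _ (\int[mu]_x ((c * `|F x|)%:E + \int[mu]_t (kap t * H3 (x, t))%:E))%E).
  apply: ge0_le_integral => //.
  - by apply/measurable_EFinP; apply: measurableT_comp => //; exact: measurable_funM.
  - apply: emeasurable_funD; last exact: mAB.
    by apply/measurable_EFinP; apply: measurable_funM => //; exact: measurableT_comp.
  - move=> x _; rewrite normrM EFinM.
    apply: (@le_trans _ _ ((c%:E + B x) * `|F x|%:E)%E).
      rewrite lee_wpmul2r//; apply: (le_trans (smoothing_dist x)).
      by rewrite leeD2r.
    rewrite ge0_muleDl// ?lee_fin//; apply: leeD => //.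
    rewrite /B -ge0_integralZr//.
    + rewrite le_eqVlt; apply/orP; left; apply/eqP; apply: eq_integral => t _.
      by rewrite /H3 /H2 /= normrM -EFinM mulrA.
    + exact/measurable_EFinP.
    + by move=> t _; rewrite lee_fin mulr_ge0.
rewrite ge0_integralD//; last 4 first.
- by move=> x _; rewrite lee_fin mulr_ge0.
- by apply/measurable_EFinP; apply: measurable_funM => //; exact: measurableT_comp.
- by move=> x _; apply: integral_ge0 => t _; rewrite lee_fin mulr_ge0.
- exact: mAB.
rewrite EFinD; apply: leeD.
  by rewrite ge0_integralZ ?IF//; exact: measurableT_comp.
by rewrite -[eps]mul1r; apply: ge0_integral_kernel_le.
Qed.

End smoothing_error.

(** * Approximation by test functions near a point of the closure *)

Section density.
Context (R : realType) (N : nat).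
Local Notation rV := 'rV[R]_N.
Local Notation mu := (lebesgue_rV R N).
Implicit Types (u phi theta zeta : rV -> R) (g : 'I_N -> rV -> R) (x s t v : rV).

Variable Omega : set rV.
Hypothesis oO : open Omega.
Hypothesis bO : bounded_set Omega.
Hypothesis lO : lipschitz_boundary Omega.

Variables (a w : rV -> R) (F : 'I_N -> rV -> R).
Hypothesis ma : measurable_fun setT a.
Hypothesis w2 : L2fun w.
Hypothesis mF : forall i, measurable_fun setT (F i).
Hypothesis Faw : forall i x, `|F i x| <= `|a x| * `|w x|.
Hypothesis F1 : forall i, (\int[mu]_x `|F i x|%:E < +oo)%E.

(** One test function serves both errors: the L^2 distance of the gradients and the L^1 distance
    against the factors [F i], which is what a limit of the skew form needs. *)
Definition test_approximable g := forall eps : R, 0 < eps ->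
  exists2 phi, C0infty Omega phi & forall i,
    (sqn (partial i phi - g i)%R <= eps%:E)%E /\
    (\int[mu]_x `|(partial i phi x - g i x) * F i x|%:E <= eps%:E)%E.

Lemma test_approximableD g h : (forall i, measurable_fun setT (g i)) ->
  (forall i, measurable_fun setT (h i)) ->
  test_approximable g -> test_approximable h ->
  test_approximable (fun i => g i + h i).
Proof.
move=> mg mh tg th eps eps0.
have e4 : 0 < eps / 4 by rewrite divr_gt0.
have [phi cp phig] := tg _ e4; have [psi cq psih] := th _ e4.
have [sp sq] := (C0infty_smooth cp, C0infty_smooth cq).
exists (phi + psi); first exact: C0inftyD.
move=> i; have [g2 gF] := phig i; have [h2 hF] := psih i.
have mp : measurable_fun setT (partial i phi - g i).
  by apply: measurable_funB => //; apply: smooth_measurable; exact: smooth_partial.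
have mq : measurable_fun setT (partial i psi - h i).
  by apply: measurable_funB => //; apply: smooth_measurable; exact: smooth_partial.
have E : partial i (phi + psi) - (g i + h i) =
    (partial i phi - g i) + (partial i psi - h i).
  apply/funext => x.
  rewrite -[LHS]/(partial i (phi + psi) x - (g i x + h i x)).
  rewrite partialD; [|exact: smooth_differentiable|exact: smooth_differentiable].
  rewrite -[RHS]/((partial i phi x - g i x) + (partial i psi x - h i x)).
  by rewrite opprD addrACA.
split.
  rewrite E; apply: (le_trans (sqnD mp mq)).
  apply: (le_trans (leeD (lee_wpmul2l _ g2) (lee_wpmul2l _ h2))) => //.
  by rewrite -!(EFinM, EFinD) lee_fin; lra.
apply: (le_trans (ge0_integral_le_add (g := fun x => `|(partial i phi - g i) x * F i x|)
   (h := fun x => `|(partial i psi - h i) x * F i x|) _ _ _ _ _ _ _)) => //.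
- apply: measurableT_comp => //; apply: measurable_funM => //.
  rewrite (_ : (fun x => _) = (partial i phi - g i) + (partial i psi - h i)).
    exact: measurable_funD.
  by rewrite -E.
- by apply: measurableT_comp => //; exact: measurable_funM.
- by apply: measurableT_comp => //; exact: measurable_funM.
- move=> x; rewrite -[X in `|X * _|]/((partial i (phi + psi) - (g i + h i)) x) E.
  rewrite -[X in `|X * _|]/((partial i phi - g i) x + (partial i psi - h i) x).
  by rewrite mulrDl ler_normD.
- apply: (le_trans (leeD gF hF)).
  by rewrite -!(EFinM, EFinD) lee_fin; lra.
Qed.

Lemma nbhs0_forall (P : 'I_N -> rV -> Prop) :
  (forall i, exists2 d : R, 0 < d & forall t, `|t| < d -> P i t) ->
  exists2 d : R, 0 < d & forall t, `|t| < d -> forall i, P i t.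
Proof.
move=> H.
have : \forall t \near (0 : rV), forall i, P i t.
  apply: (@filter_forall _ _ P (nbhs (0 : rV))) => i; have [d d0 Pd] := H i.
  apply: filterS (nbhsx_ballx (0 : rV) _ d0) => t.
  by rewrite mx_norm_ball /ball_/= sub0r normrN => /Pd.
move=> /nbhs_ballP[d /= d0 Pd]; exists d => // t td; apply: Pd.
by rewrite mx_norm_ball /ball_/= sub0r normrN.
Qed.

(** The kernel near [- v] moves the support of [phi] by [v], up to [r / 2]. The new support lies in
    the sum of two compact sets, which is compact and, as [r / 2 < r], inside Omega. *)
Lemma C0infty_smoothing_inward phi v (r k : R) : 0 < r -> 0 <= k ->
  smooth phi -> compact (closure [set x | phi x != 0]) ->
  (forall x s, closure [set x | phi x != 0] x -> `|s| < r -> Omega (x + v + s)) ->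
  C0infty Omega (smoothing (fun t => k * \1_(ball (- v) (r / 2) : set rV) t) phi).
Proof.
move=> r0 k0 sp cS inw; set S := closure _ in cS inw *.
set kap := fun t => _.
have r2 : 0 < r / 2 by rewrite divr_gt0.
have bp : bounded_support phi.
  have [M [_ MP]] := compact_bounded cS; exists (`|M| + 1) => x xM.
  apply/eqP; apply: contraTT xM => px; rewrite -leNgt.
  apply: (MP (`|M| + 1)); first by rewrite (le_lt_trans (ler_norm M)) ?ltrDl.
  exact: subset_closure.
have mkap : measurable_fun setT kap.
  apply: measurable_funM => //; apply: measurable_indic.
  exact: measurable_ball_rV.
have kap0 t : 0 <= kap t by rewrite mulr_ge0.
have kapm := @integral_indic_ball R N k (- v) (r / 2) k0 r2.
have cB : compact (closed_ball (v : rV) (r / 2)).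
  apply: bounded_closed_compact; last exact: closed_ball_closed.
  exists (`|v| + r / 2); split=> [|M Mr x]; first exact: num_real.
  rewrite closed_ballE// /closed_ball_/= => vx.
  apply: le_trans (ltW Mr); rewrite -(subrK v x).
  by rewrite (le_trans (ler_normD _ _))// addrC lerD2l distrC.
pose K := (fun p : rV * rV => p.1 + p.2) @` (S `*` closed_ball (v : rV) (r / 2)).
apply: (@C0inftyP _ _ _ _ K).
- exact: (smooth_smoothing mkap kap0 kapm).
- apply: continuous_compact; last exact: compact_setX.
  by apply: continuous_subspaceT => p; exact: add_continuous.
- move=> q [[y z] [/= Sy]]; rewrite closed_ballE// /closed_ball_/= => vz <-.
  rewrite (_ : y + z = y + v + (z - v)); last by rewrite addrACA subrr addr0.
  apply: inw => //; rewrite distrC (le_lt_trans vz)// ltr_pdivrMr// ltr_pMr//.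
  by rewrite ltr1n.
- move=> x /smoothing_neq0[t]; rewrite /kap indicE mulf_eq0 negb_or => /andP[_].
  have [tB _ px|_] := boolP (t \in _); last by rewrite eqxx.
  exists (x + t, - t); last by rewrite /= addrK.
  split; first exact: subset_closure.
  rewrite closed_ballE// /closed_ball_/= opprK.
  move: tB; rewrite inE mx_norm_ball /ball_/= => /ltW.
  by rewrite -opprD normrN.
Qed.

(** The product [theta * phi] is a test function already, but close to [theta * u] in the Sobolev
    norm only. It is therefore averaged with a kernel of integral 1, and the kernel is centred off
    the origin so that the support stays in Omega. The order of choices matters: the size [d] of the
    translations, the shift and its kernel of height [k], the tolerance [s] depending on [k], and
    only then [phi]. *)
Lemma local_test_approximable u g theta x0 (rho : R) :
  sobolev_pair Omega u g -> (forall i, translation_bounded a (g i)) ->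
  translation_bounded a u ->
  smooth theta -> (forall x, rho / 2 <= `|x - x0| -> theta x = 0) -> 0 < rho ->
  (forall d : R, 0 < d -> exists (v : rV) (r : R), [/\ 0 < r, `|v| + r <= d &
      forall x s, Omega x -> `|x - x0| < rho -> `|s| < r -> Omega (x + v + s)]) ->
  test_approximable (fun i => theta * g i + partial i theta * u).
Proof.
move=> [[mu' ui] gi approx] ag au st theta0 rho0 chart eps eps0.
have bt : bounded_support theta.
  exists (rho + `|x0|) => x xM; apply: theta0.
  have := ler_normB x x0; have := lerB_dist x x0; lra.
pose g' i := theta * g i + partial i theta * u.
have mg i : measurable_fun setT (g i) by have [] := gi i.
have mt : measurable_fun setT theta by exact: smooth_measurable.
have mdt i : measurable_fun setT (partial i theta).
  by apply: smooth_measurable; exact: smooth_partial.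
have mg' i : measurable_fun setT (g' i).
  by apply: measurable_funD; exact: measurable_funM.
have bmt := bounded_measurable_smooth st bt.
have bmdt i := bounded_measurable_smooth (smooth_partial i st)
  (bounded_support_partial i bt).
have ag' i : translation_bounded a (g' i).
  by apply: translation_boundedD => //; exact: translation_boundedM.
have [K K0 [tK dtK]] : exists2 K : R, 0 <= K &
    (forall x, `|theta x| <= K) /\ (forall i x, `|partial i theta x| <= K).
  have [K1 K10 tK1] := smooth_bounded st bt.
  have [K2 K20 tK2] := smooth_bounded_partial st bt.
  exists (K1 + K2); first exact: addr_ge0.
  split=> [x|i x]; first by rewrite (le_trans (tK1 x))// lerDl.
  by rewrite (le_trans (tK2 i x))// lerDr.
(* By the product rule the error is [theta] times that of [g i] plus the derivative of [theta] times
   that of [u], both factors being bounded by [K]. *)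
have prod_approx (e : R) : 0 < e -> exists phi, [/\ C0infty Omega phi,
    C0infty Omega (theta * phi) &
    forall i, (sqn (partial i (theta * phi) - g' i)%R <= e%:E)%E].
  move=> e0; have D0 : 0 < 4 * K ^+ 2 + 1 by rewrite ltr_wpDl// mulr_ge0 ?sqr_ge0.
  have [|phi [cp pu pg]] := approx (e / (4 * K ^+ 2 + 1)); first by rewrite divr_gt0.
  exists phi; split=> [//||i]; first exact: C0inftyM.
  have sp := C0infty_smooth cp.
  pose A x := theta x * (partial i phi - g i) x.
  pose B x := partial i theta x * (phi - u) x.
  have mpg : measurable_fun setT (partial i phi - g i).
    by apply: measurable_funB => //; apply: smooth_measurable; exact: smooth_partial.
  have mpu : measurable_fun setT (phi - u).
    by apply: measurable_funB => //; exact: smooth_measurable.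
  have -> : partial i (theta * phi) - g' i = A + B.
    apply/funext => x.
    rewrite -[LHS]/(partial i (theta * phi) x - g' i x).
    rewrite partialM; [|exact: smooth_differentiable|exact: smooth_differentiable].
    rewrite -[RHS]/(theta x * (partial i phi x - g i x) +
      partial i theta x * (phi x - u x)).
    rewrite -[g' i x]/(theta x * g i x + partial i theta x * u x).
    by ring.
  have mA : measurable_fun setT A by exact: measurable_funM.
  have mB : measurable_fun setT B by exact: measurable_funM.
  apply: (le_trans (sqnD mA mB)).
  have bnd (c f : rV -> R) (q : R) : measurable_fun setT c -> measurable_fun setT f ->
      (forall x, `|c x| <= K) -> (sqn f <= q%:E)%E ->
      (sqn (fun x => c x * f x)%R <= (K ^+ 2 * q)%:E)%E.
    move=> mc mf cK fq; apply: (@le_trans _ _ (sqn (fun x => K * f x)%R)).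
      apply: le_sqn => [||x]; [exact: measurable_funM|exact: measurable_funM|].
      by rewrite !normrM ler_wpM2r// (ger0_norm K0).
    by rewrite sqnZ// [leRHS]EFinM lee_wpmul2l// lee_fin sqr_ge0.
  have hA := bnd _ _ _ mt mpg tK (pg i).
  have hB := bnd _ _ _ (mdt i) mpu (dtK i) pu.
  apply: (le_trans (leeD (lee_wpmul2l _ hA) (lee_wpmul2l _ hB))) => //.
  rewrite -!(EFinM, EFinD) lee_fin.
  set q := e / _.
  rewrite [leLHS](_ : _ = 4 * K ^+ 2 * q); last by ring.
  by rewrite /q mulrCA -[leRHS]mulr1 (ler_wpM2l (ltW e0))// ler_pdivrMr// mul1r lerDl.
have ag2 i : L2_smooth_approximable (g' i).
  move=> e e0; have [phi [cp ctp pe]] := prod_approx e e0.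
  exists (partial i (theta * phi)); split => //.
  - by apply: smooth_partial; exact: C0infty_smooth ctp.
  - by apply: bounded_support_partial; exact: C0infty_bounded_support ctp.
have e4 : 0 < eps / 4 by rewrite divr_gt0.
(* Both moduli of continuity are fixed before the shift, whose size [d] is to meet them on the whole
   support of the kernel. *)
have [d d0 dP] : exists2 d : R, 0 < d & forall t, `|t| < d -> forall i,
    (sqn (fun x => g' i (x + t) - g' i x)%R <= (eps / 4)%:E)%E /\
    (\int[mu]_x `|(g' i (x + t) - g' i x) * F i x|%:E <= (eps / 4)%:E)%E.
  apply: nbhs0_forall => i.
  have [d1 d10 d1P] := sqn_translate_cvg (mg' i) (ag2 i) e4.
  have [d2 d20 d2P] := weighted_translate_cvg ma w2 (mF i) (Faw i) (F1 i)
    (ag' i) (ag2 i) e4.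
  exists (Num.min d1 d2); first by rewrite lt_min d10.
  by move=> t; rewrite lt_min => /andP[t1 t2]; split; [exact: d1P|exact: d2P].
have [v [r [r0 vr inw]]] := chart d d0.
have r2 : 0 < r / 2 by rewrite divr_gt0.
pose k := ((2 * (r / 2)) ^+ N)^-1.
have k0 : 0 < k by rewrite invr_gt0 exprn_gt0// mulr_gt0.
pose kap t := k * \1_(ball (- v) (r / 2) : set rV) t.
have mkap : measurable_fun setT kap.
  by apply: measurable_funM => //; apply: measurable_indic; exact: measurable_ball_rV.
have kap0 t : 0 <= kap t by rewrite mulr_ge0// ltW.
have kapk t : kap t <= k.
  by rewrite /kap indicE; case: (_ \in _); rewrite ?mulr1// mulr0 ltW.
have kap1 : (\int[mu]_t (kap t)%:E = 1%:E)%E.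
  rewrite integral_indic_ball ?(ltW k0)// /k mulVf// gt_eqF//.
  by rewrite exprn_gt0// mulr_gt0.
have kapd t : kap t != 0 -> `|t| < d.
  rewrite /kap indicE mulf_eq0 negb_or => /andP[_].
  have [tB _|_] := boolP (t \in _); last by rewrite eqxx.
  move: tB; rewrite inE mx_norm_ball /ball_/= => tB.
  have := ler_normB (- v) (- v - t); rewrite opprB addrA addrAC subrr.
  rewrite add0r normrN => h.
  apply: (le_lt_trans (_ : _ <= `|v| + `|- v - t|)).
    by rewrite (_ : t = - v - (- v - t)) ?[X in X <= _](le_trans (ler_normB _ _)) ?normrN// opprB addrA addrAC subrr add0r.
  lra.
pose I i := fine (\int[mu]_x `|F i x|%:E).
have IE i : (\int[mu]_x `|F i x|%:E = (I i)%:E)%E.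
  by rewrite fineK// ge0_fin_numE// integral_ge0// => x _; rewrite lee_fin.
have I0 i : 0 <= I i by rewrite fine_ge0// integral_ge0// => x _; rewrite lee_fin.
pose J := \sum_i I i.
have IJ i : I i <= J by rewrite /J (bigD1 i)//= lerDl sumr_ge0.
have J0 : 0 <= J by exact: sumr_ge0.
have J10 : 0 < 4 * (J + 1) by rewrite mulr_gt0// ltr_wpDl.
(* Then [eta * k] and [eta^-1 * s] are both at most [eps / (4 * (J + 1))], where [J] bounds the
   integral of every [|F i|]. *)
pose eta := eps / (4 * (J + 1)) / k.
have eta0 : 0 < eta by rewrite !divr_gt0.
pose s := Num.min (eps / 4) (eta * (eps / (4 * (J + 1)))).
have s0 : 0 < s by rewrite lt_min e4/= mulr_gt0// divr_gt0.
have [phi [cp ctp pg']] := prod_approx s s0.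
exists (smoothing kap (theta * phi)).
  apply: C0infty_smoothing_inward => //; first exact: ltW.
  - exact: C0infty_smooth ctp.
  - by case: ctp => _ [].
  - move=> x t Sx; apply: inw; first by case: ctp => _ [_]; exact.
    (* The shift is inward only within distance [rho]; the support of [theta], closure included,
       stays within [rho / 2]. *)
    have : closed [set x | `|x - x0| <= rho / 2].
      rewrite (_ : [set x | _] = closed_ball x0 (rho / 2)).
        exact: closed_ball_closed.
      by rewrite closed_ballE ?divr_gt0//; apply/seteqP; split => y /=;
        rewrite /closed_ball_/= distrC.
    move=> /closure_id clE.
    have : closure [set x | `|x - x0| <= rho / 2] x.
      apply: closureS Sx => y /=; apply: contraNT; rewrite -ltNge => /ltW/theta0.
      by rewrite -[(theta * phi) y]/(theta y * phi y) => ->; rewrite mul0r.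
    rewrite -clE /= => /le_lt_trans; apply.
    by rewrite ltr_pdivrMr// ltr_pMr// ltr1n.
have [stp btp] := (C0infty_smooth ctp, C0infty_bounded_support ctp).
move=> i.
have pJ x : partial i (smoothing kap (theta * phi)) x =
    smoothing kap (partial i (theta * phi)) x.
  by have [_ ->] := smoothing_partial mkap kap0 kap1 x stp btp.
have sdp := smooth_partial i stp; have bdp := bounded_support_partial i btp.
split.
- have -> : partial i (smoothing kap (theta * phi)) =
    smoothing kap (partial i (theta * phi)) by apply/funext => x.
  apply: (le_trans (sqn_smoothing_error mkap kap0 kap1 sdp bdp (mg' i) (pg' i)
    (ltW e4) _)).
    by move=> t /kapd td; have [] := dP t td i.
  rewrite lee_fin; have : s <= eps / 4 by rewrite ge_min lexx.
  lra.
- under eq_integral do rewrite pJ.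
  apply: (le_trans (weighted_smoothing_error mkap kap0 kapk kap1 sdp bdp (mg' i)
    (mF i) (IE i) (pg' i) (ltW e4) eta0 _)).
    by move=> t /kapd td; have [] := dP t td i.
  rewrite lee_fin.
  have h1 : eta * k = eps / (4 * (J + 1)) by rewrite /eta divfK// gt_eqF.
  have h2 : eta^-1 * s <= eps / (4 * (J + 1)).
    by rewrite ler_pdivrMl// ge_min lexx orbT.
  have h3 : eps / (4 * (J + 1)) * I i <= eps / 4.
    rewrite mulrAC -mulrA (ler_wpM2l (ltW eps0))// ler_pdivrMr//.
    have := IJ i; lra.
  have h4 : (eta * k + eta^-1 * s) * I i <= 2 * (eps / (4 * (J + 1))) * I i.
    by rewrite ler_wpM2r// h1; lra.
  lra.
Qed.

End density.

(** * From local to global approximation *)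

Section global_density.
Context (R : realType) (N : nat).
Local Notation rV := 'rV[R]_N.
Local Notation mu := (lebesgue_rV R N).
Implicit Types (u phi theta zeta : rV -> R) (g : 'I_N -> rV -> R) (x s t v : rV).

Variable Omega : set rV.
Hypothesis oO : open Omega.
Hypothesis bO : bounded_set Omega.
Hypothesis lO : lipschitz_boundary Omega.

Variables (a w : rV -> R) (F : 'I_N -> rV -> R).
Hypothesis ma : measurable_fun setT a.
Hypothesis w2 : L2fun w.
Hypothesis mF : forall i, measurable_fun setT (F i).
Hypothesis Faw : forall i x, `|F i x| <= `|a x| * `|w x|.
Hypothesis F1 : forall i, (\int[mu]_x `|F i x|%:E < +oo)%E.

(** The degenerate case in which there is no nonzero test function to build cutoffs from: then [g]
    vanishes almost everywhere and the zero function approximates it. *)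
Lemma trivial_test_approximable u g : sobolev_pair Omega u g ->
  (forall phi, C0infty Omega phi -> forall x, phi x = 0) ->
  test_approximable Omega F g.
Proof.
move=> [_ gi approx] triv.
have g0 i : sqn (g i) = 0%E.
  apply: (@le_eps_eq0 _ _ 1); first exact: sqn_ge0.
  move=> e e0; have [phi [cp _ /(_ i)]] := approx e e0.
  rewrite mul1r; apply: le_trans; rewrite le_eqVlt; apply/orP; left; apply/eqP.
  apply: eq_integral => x _.
  rewrite -[(partial i phi - g i) x]/(partial i phi x - g i x).
  by rewrite (triv _ (C0infty_partial i cp)) sub0r sqrrN.
move=> eps eps0; exists (cst 0); first exact: C0infty0.
move=> i; have [mg _] := gi i.
have p0 : partial i (cst 0) = cst 0 :> (rV -> R).
  by apply/funext => x; rewrite partial_cst.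
split.
  have -> : sqn (partial i (cst 0) - g i)%R = sqn (g i).
    apply: eq_integral => x _.
    by rewrite p0 -[(cst 0 - g i) x]/(0 - g i x) sub0r sqrrN.
  by rewrite g0 lee_fin ltW.
have -> : (\int[mu]_x `|(partial i (cst 0) x - g i x) * F i x|%:E = 0)%E; last first.
  by rewrite lee_fin ltW.
have mg2 := measurable_sqr_EFin mg.
have /(ae_eq_integral_abs mu measurableT mg2) ae0 :
    (\int[mu]_x `|(g i x ^+ 2)%:E| = 0)%E.
  by rewrite -(g0 i); apply: eq_integral => x _; rewrite gee0_abs// lee_fin sqr_ge0.
rewrite -(integral0 mu setT); apply: ge0_ae_eq_integral => //.
- apply/measurable_EFinP; apply: measurableT_comp => //; apply: measurable_funM => //.
  by rewrite p0; exact: measurable_funB.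
- apply: filterS ae0 => x /(_ I) [] /eqP; rewrite expf_eq0/= => /eqP gx _.
  by rewrite p0 gx subr0 mul0r normr0.
Qed.

(** The closure of Omega is compact, so finitely many balls admitting an inward shift cover it.
    Products of [1 - eta] over the cutoffs [eta] of these balls vanish near the closure, which
    avoids the division in a partition of unity. *)
Lemma sobolev_test_approximable (i0 : 'I_N) u g : sobolev_pair Omega u g ->
  (forall i, translation_bounded a (g i)) ->
  (forall x, ~ Omega x -> u x = 0 /\ forall i, g i x = 0) ->
  test_approximable Omega F g.
Proof.
move=> ug ag out.
have [triv|/existsNP[phi0 /not_implyP[cp0 /existsNP[y0 /eqP py0]]]] :=
  pselect (forall phi, C0infty Omega phi -> forall x, phi x = 0).
  exact: trivial_test_approximable ug triv.
have sp0 := C0infty_smooth cp0; have bp0 := C0infty_bounded_support cp0.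
have [mu' gi _] := ug.
have mg i : measurable_fun setT (g i) by have [] := gi i.
(* The cutoffs produce terms in [u] itself, which inherits the bound on translates from one
   component of its gradient. *)
have au : translation_bounded a u.
  have [d d0 dP] := poincare_translation_bounded bO i0.
  have [mgi [C C0 gC]] := ag i0; split; first by case: mu'.
  by exists (d ^+ 2 * C); [rewrite mulr_ge0 ?sqr_ge0|exact: (dP u g)].
have H x0 : closure Omega x0 -> exists2 rho : R, 0 < rho & forall d : R, 0 < d ->
    exists (v : rV) (r : R), [/\ 0 < r, `|v| + r <= d &
      forall x s, Omega x -> `|x - x0| < rho -> `|s| < r -> Omega (x + v + s)].
  exact: inward_shift.
pose chart_radius x0 (r0 : R) := closure Omega x0 -> 0 < r0 /\
    forall d : R, 0 < d -> exists (v : rV) (r : R), [/\ 0 < r, `|v| + r <= d &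
      forall x s, Omega x -> `|x - x0| < r0 -> `|s| < r -> Omega (x + v + s)].
(* The radius 0 off the closure of Omega is a default value: [chart_radius] asks nothing there. *)
have [rho rhoP] : {rho : rV -> R & forall x0, chart_radius x0 (rho x0)}.
  apply: choice => x0.
  have [cx|ncx] := pselect (closure Omega x0); last by exists 0.
  by have [r r0 rP] := H x0 cx; exists r.
(* Localisation: 1 - zeta is assembled from cutoffs supported in the balls. *)
have step (L : seq rV) : (forall x0, x0 \in L -> closure Omega x0) ->
    exists zeta, [/\ smooth zeta,
      forall x0 x, x0 \in L -> `|x - x0| < rho x0 / 4 -> zeta x = 0 &
      test_approximable Omega F
        (fun i => (cst 1 - zeta) * g i - partial i zeta * u)].
  elim: L => [_|x0 L IH LO].
    exists (cst 1); split=> //; first exact: smooth_cst.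
    move=> eps eps0; exists (cst 0); first exact: C0infty0.
    move=> i.
    have E x : partial i (cst 0) x - ((cst 1 - cst 1) * g i - partial i (cst 1) * u) x = 0.
      rewrite -[X in _ - X]/((1 - 1) * g i x - partial i (cst 1) x * u x).
      by rewrite !partial_cst subrr !mul0r subr0 subrr.
    split.
      rewrite (_ : sqn _ = 0%E) ?lee_fin ?ltW//.
      by apply: integral0_eq => x _; congr EFin;
        rewrite -[X in X ^+ 2]/(partial i (cst 0) x - _) E expr0n.
    rewrite integral0_eq ?lee_fin ?ltW// => x _.
    by rewrite E mul0r normr0.
  have [x1 x1L|zeta [sz z0 tz]] := IH; first by apply: LO; rewrite inE x1L orbT.
  have [r0 chart] := rhoP x0 (LO x0 (mem_head _ _)).
  have [eta [se eta1 eta0]] : exists eta : rV -> R, [/\ smooth eta,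
      forall x, `|x - x0| < rho x0 / 2 / 2 -> eta x = 1 &
      forall x, rho x0 / 2 <= `|x - x0| -> eta x = 0].
    apply: exists_cutoff sp0 bp0 _ _; first by exists y0.
    by rewrite divr_gt0.
  have s1e : smooth (cst 1 - eta) by apply: smoothB => //; exact: smooth_cst.
  exists (zeta * (cst 1 - eta)); split; first exact: smoothM.
  - move=> x1 x; rewrite inE => /orP[/eqP ->|x1L] xx.
      rewrite -[LHS]/(zeta x * (1 - eta x)) eta1 ?subrr ?mulr0//.
      by apply: lt_le_trans xx _; lra.
    by rewrite -[LHS]/(zeta x * (1 - eta x)) (z0 x1)// mul0r.
  - have sze : smooth (zeta * eta) by exact: smoothM.
    have tl : test_approximable Omega F
        (fun i => (zeta * eta) * g i + partial i (zeta * eta) * u).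
      apply: (local_test_approximable ma w2 mF Faw F1 ug ag au sze _ r0 chart).
      by move=> x /eta0 ex; rewrite -[LHS]/(zeta x * eta x) ex mulr0.
    have mz : measurable_fun setT zeta by exact: smooth_measurable.
    have mdz i : measurable_fun setT (partial i zeta).
      by apply: smooth_measurable; exact: smooth_partial.
    have mze : measurable_fun setT (zeta * eta) by exact: smooth_measurable.
    have mdze i : measurable_fun setT (partial i (zeta * eta)).
      by apply: smooth_measurable; exact: smooth_partial.
    have mu1 : measurable_fun setT u by case: mu'.
    (* Telescoping: [1 - zeta * (1 - eta) = (1 - zeta) + zeta * eta], where the last product is
       supported in the new ball and the rest is treated by induction. *)
    have -> : (fun i => (cst 1 - zeta * (cst 1 - eta)) * g i -
          partial i (zeta * (cst 1 - eta)) * u) =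
        (fun i => ((cst 1 - zeta) * g i - partial i zeta * u) +
          ((zeta * eta) * g i + partial i (zeta * eta) * u)).
      apply/funext => i; apply/funext => x.
      have dz := smooth_differentiable x sz; have de := smooth_differentiable x se.
      have d1 := smooth_differentiable x (@smooth_cst R N 1).
      rewrite -[RHS]/(((1 - zeta x) * g i x - partial i zeta x * u x) +
        (zeta x * eta x * g i x + partial i (zeta * eta) x * u x)).
      rewrite -[LHS]/((1 - zeta x * (1 - eta x)) * g i x -
        partial i (zeta * (cst 1 - eta)) x * u x).
      rewrite (partialM _ dz de) (partialM _ dz (smooth_differentiable x s1e)).
      rewrite (partialB _ d1 de) partial_cst -[(cst 1 - eta) x]/(1 - eta x).
      by ring.
    apply: test_approximableD => //.
    + move=> i; apply: measurable_funB; apply: measurable_funM => //.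
      by apply: measurable_funB => //; exact: measurable_cst.
    + by move=> i; apply: measurable_funD; exact: measurable_funM.
have cO : compact (closure Omega).
  apply: bounded_closed_compact; last exact: closed_closure.
  have [M [_ MP]] := bO; exists (`|M| + 1); split=> [|m Mm x cx]; first exact: num_real.
  have M1 : 0 < `|M| + 1 by rewrite ltr_wpDl.
  have : closure (closed_ball (0 : rV) (`|M| + 1)) x.
    apply: closureS cx => y Oy; rewrite closed_ballE// /closed_ball_/= sub0r normrN.
    by apply: MP Oy; rewrite (le_lt_trans (ler_norm M))// ltrDl.
  rewrite -(closure_id _).1; last exact: closed_ball_closed.
  rewrite closed_ballE// /closed_ball_/= sub0r normrN => /le_trans; apply.
  exact: ltW.
have := cO; rewrite compact_cover => /(_ rV (closure Omega)
  (fun x0 => ball x0 (rho x0 / 4))) [].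
- by move=> x0 _; exact: ball_open.
- move=> x Ox; exists x => //; apply: ballxx; rewrite divr_gt0//.
  by have [] := rhoP x Ox.
move=> D DO cov.
have [|zeta [sz z0 tz]] := step (finmap.enum_fset D).
  by move=> x0 /DO; rewrite inE.
(* Vanishing on a whole neighbourhood, and not just at the point, removes the derivative of [zeta]
   as well. *)
have zb x : closure Omega x -> \forall y \near x, zeta y = 0.
  move=> /cov[x0 Dx0 xx0].
  apply: filterS (open_nbhs_nbhs (conj (ball_open x0 (rho x0 / 4)) xx0)) => y.
  by rewrite mx_norm_ball /ball_/= distrC; exact: z0.
rewrite (_ : g = (fun i => (cst 1 - zeta) * g i - partial i zeta * u))//.
apply/funext => i; apply/funext => x.
rewrite -[RHS]/((1 - zeta x) * g i x - partial i zeta x * u x).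
have [Ox|Ox] := pselect (Omega x); last first.
  by have [-> ->] := out x Ox; rewrite !mulr0 subrr.
have zx := zb x (subset_closure Ox).
rewrite (nbhs_singleton zx) subr0 mul1r /partial.
by rewrite (@near_eq_derive _ _ _ zeta (cst 0))// derive_cst mul0r subr0.
Qed.

End global_density.

(** * The spaces L^2 and H^1_0 on a domain *)

Section dot_products.
Context (R : realType) (N : nat).
Implicit Types (u v w : 'cV[R]_N) (A B : 'M[R]_N).

Lemma dotDl u v w : dot (u + v) w = dot u w + dot v w.
Proof.
by rewrite /dot -big_split; apply: eq_bigr => i _; rewrite mxE mulrDl.
Qed.

Lemma dotZl (a : R) u v : dot (a *: u) v = a * dot u v.
Proof.
by rewrite /dot mulr_sumr; apply: eq_bigr => i _; rewrite mxE mulrA.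
Qed.

Lemma dotC u v : dot u v = dot v u.
Proof. by apply: eq_bigr => i _; rewrite mulrC. Qed.

Lemma dotDr u v w : dot u (v + w) = dot u v + dot u w.
Proof. by rewrite dotC dotDl !(dotC _ u). Qed.

Lemma dotZr (a : R) u v : dot u (a *: v) = a * dot u v.
Proof. by rewrite dotC dotZl dotC. Qed.

Lemma dotNr u v : dot u (- v) = - dot u v.
Proof. by rewrite -scaleN1r dotZr mulN1r. Qed.

Lemma dot_ge0 u : 0 <= dot u u.
Proof. by apply: sumr_ge0 => i _; rewrite -expr2 sqr_ge0. Qed.

Lemma sqr_enorm u : enorm u ^+ 2 = dot u u.
Proof. by rewrite /enorm sqr_sqrtr// dot_ge0. Qed.

Lemma dot_mulmxE A u v : dot u (A *m v) = \sum_i \sum_j u i 0 * A i j * v j 0.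
Proof.
apply: eq_bigr => i _; rewrite mxE mulr_sumr.
by apply: eq_bigr => j _; rewrite mulrA.
Qed.

Lemma dot_trmx A u v : dot u (A^T *m v) = dot v (A *m u).
Proof.
rewrite !dot_mulmxE exchange_big; apply: eq_bigr => i _; apply: eq_bigr => j _.
by rewrite mxE mulrC mulrA mulrAC [v _ _ * _]mulrC.
Qed.

Lemma dot_skew A u v : A^T = - A -> dot u (A *m v) = - dot v (A *m u).
Proof. by move=> sA; rewrite -(dot_trmx A u v) sA mulNmx dotNr opprK. Qed.

Lemma dot_skew0 A u : A^T = - A -> dot u (A *m u) = 0.
Proof. by move=> sA; apply/eqP; rewrite -eqNr -dot_skew. Qed.

(** Polarisation: the quadratic form at [e i + e j] and [e i - e j] differs by 4 times the entry,
    and both values lie between 0 and [2 * be]. The diagonal is read off at [e i]. *)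
Lemma sym_entry_le A (al be : R) : A^T = A -> 0 <= al ->
  (forall xi : 'cV[R]_N, al * dot xi xi <= dot xi (A *m xi) <= be * dot xi xi) ->
  forall i j, `|A i j| <= be.
Proof.
move=> sA al0 ell i j.
pose e k : 'cV[R]_N := delta_mx k 0.
have eA k (v : 'cV[R]_N) : dot (e k) v = v k 0.
  rewrite /dot (bigD1 k)//= big1 ?addr0; first by rewrite mxE !eqxx mul1r.
  by move=> l lk; rewrite mxE (negbTE lk) mul0r.
have eAe k l : dot (e k) (A *m e l) = A k l.
  rewrite eA mxE (bigD1 l)//= big1 ?addr0; first by rewrite mxE !eqxx mulr1.
  by move=> m ml; rewrite mxE (negbTE ml) mulr0.
have Asym : A j i = A i j by rewrite -{1}sA mxE.
have ee k : dot (e k) (e k) = 1 by rewrite eA mxE !eqxx.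
have h1 := ell (e i + e j); have h2 := ell (e i - e j).
have q (s : R) : dot (e i + s *: e j) (A *m (e i + s *: e j)) =
    A i i + s * A i j + (s * A i j + s * (s * A j j)).
  by rewrite mulmxDr -scalemxAr dotDl dotZl !dotDr !dotZr !eAe Asym; ring.
have d (s : R) : dot (e i + s *: e j) (e i + s *: e j) =
    1 + s * (e i) j 0 + (s * (e i) j 0 + s * (s * 1)).
  by rewrite dotDl dotZl !dotDr !dotZr !ee [dot (e i) (e j)]dotC !eA; ring.
have := q 1; have := q (-1); have := d 1; have := d (-1).
rewrite scale1r scaleN1r => dN dP qN qP.
have /andP[p1 p2] : 0 <= dot (e i + e j) (A *m (e i + e j)) <= be * dot (e i + e j) (e i + e j).
  by case/andP: h1 => l1 ->; rewrite andbT (le_trans _ l1)// mulr_ge0// dot_ge0.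
have /andP[m1 m2] : 0 <= dot (e i - e j) (A *m (e i - e j)) <= be * dot (e i - e j) (e i - e j).
  by case/andP: h2 => l1 ->; rewrite andbT (le_trans _ l1)// mulr_ge0// dot_ge0.
rewrite dP qP in p1 p2; rewrite dN qN in m1 m2.
set t := (e i) j 0 in p2 m2.
have [ij|ij] := eqVneq i j.
  have := ell (e i); rewrite ee eAe !mulr1 => /andP[a1 a2].
  by rewrite -ij ger0_norm// (le_trans al0).
have t0 : t = 0 by rewrite /t mxE eq_sym (negbTE ij).
rewrite t0 in p2 m2; rewrite ler_norml; apply/andP; split; lra.
Qed.

Lemma sym_skew_partD (A : 'rV[R]_N -> 'M[R]_N) x :
  sym_part A x + skew_part A x = A x.
Proof.
rewrite /sym_part /skew_part -scalerDr addrACA subrr addr0.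
have -> : A x + A x = (2 : R) *: A x by rewrite scaler_nat mulr2n.
by rewrite scalerA mulVf// scale1r.
Qed.

Lemma sym_skew_partB (A : 'rV[R]_N -> 'M[R]_N) x :
  sym_part A x - skew_part A x = (A x)^T.
Proof.
rewrite /sym_part /skew_part -scalerBr opprB [A x + _]addrC addrACA subrr addr0.
have -> : (A x)^T + (A x)^T = (2 : R) *: (A x)^T by rewrite scaler_nat mulr2n.
by rewrite scalerA mulVf// scale1r.
Qed.

End dot_products.

Section L2_on_domain.
Context (R : realType) (N : nat).
Local Notation rV := 'rV[R]_N.
Local Notation mu := (lebesgue_rV R N).
Variable Omega : set rV.
Hypothesis oO : open Omega.
Implicit Types (f g h : rV -> R).

Let mO : measurable Omega. Proof. exact: open_measurable_rV. Qed.

Definition L2in f := L2fun (f \_ Omega).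

Local Notation intg f := (mu.-integrable Omega (EFin \o f)).

Lemma L2fun_Lfun f : L2fun f <-> f \in Lfun mu 2%:E.
Proof.
split=> [[mf f2]|f2].
  rewrite inE; apply/andP; split; rewrite inE//= /finite_norm unlock.
  apply: poweR_lty; rewrite (_ : integral _ _ _ = sqn f)//.
  apply: eq_integral => x _; rewrite /= powR_mulrn//.
  by rewrite real_normK// num_real.
have /integrableP[_ i2] := Lfun2_integrable_sqr f2.
move: f2; rewrite inE => /andP[/[!inE]/= mf _]; split => //.
apply: le_lt_trans i2; rewrite le_eqVlt; apply/orP; left; apply/eqP.
by apply: eq_integral => x _ /=; rewrite ger0_norm// sqr_ge0.
Qed.

Lemma Lp2P f : Lp Omega 2%:E f <-> L2in f.
Proof. by rewrite /Lp /= /L2in L2fun_Lfun. Qed.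

Lemma Lp_lin (p : \bar R) (a : R) f g : (1 <= p)%E -> Lp Omega p f -> Lp Omega p g ->
  Lp Omega p (fun x => a * f x + g x).
Proof.
move=> p1 Lf Lg; rewrite /Lp /=.
rewrite (_ : _ \_ _ = a *: (f \_ Omega) + g \_ Omega).
  by apply: (Lfun_submod_closed mu p1).2.
apply/funext => x; rewrite -[RHS]/(a * (f \_ Omega) x + (g \_ Omega) x) !patchE.
by case: ifP => _; rewrite ?mulr0 ?addr0.
Qed.

Lemma L2in_lin (a : R) f g : L2in f -> L2in g -> L2in (fun x => a * f x + g x).
Proof.
move=> /Lp2P Lf /Lp2P Lg; apply/Lp2P; apply: Lp_lin => //.
by rewrite lee_fin ler1n.
Qed.

Lemma L2in0 : L2in (fun=> 0).
Proof.
rewrite /L2in (_ : _ \_ _ = cst 0); last first.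
  by apply/funext => x; rewrite patchE; case: ifP.
split; first exact: measurable_cst.
by rewrite /sqn integral0_eq ?ltry// => x _; rewrite expr0n.
Qed.

Lemma L2inD f g : L2in f -> L2in g -> L2in (fun x => f x + g x).
Proof.
move=> Lf Lg; have := L2in_lin 1 Lf Lg.
by under eq_fun do rewrite mul1r.
Qed.

Lemma L2inZ (a : R) f : L2in f -> L2in (fun x => a * f x).
Proof.
move=> Lf; have := L2in_lin a Lf L2in0.
by under eq_fun do rewrite addr0.
Qed.

Lemma L2inN f : L2in f -> L2in (fun x => - f x).
Proof. by move=> /(L2inZ (-1)); under eq_fun do rewrite mulN1r. Qed.

Lemma L2in_sum (I : Type) (s : seq I) (F : I -> rV -> R) :
  (forall i, L2in (F i)) -> L2in (fun x => \sum_(i <- s) F i x).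
Proof.
move=> LF; elim: s => [|i s IH].
  by under eq_fun do rewrite big_nil; exact: L2in0.
by under eq_fun do rewrite big_cons; exact: L2inD.
Qed.

Lemma L2in_measurable f : L2in f -> measurable_fun Omega f.
Proof. by case=> mf _; apply/(measurable_restrictT _ mO). Qed.

Lemma sqn_restrict f : sqn (f \_ Omega) = (\int[mu]_(x in Omega) (f x ^+ 2)%:E)%E.
Proof.
rewrite [RHS]integral_mkcond; apply: eq_integral => x _; rewrite !patchE.
by case: ifP => _ //; rewrite expr0n.
Qed.

Lemma L2inP f : L2in f <-> measurable_fun Omega f /\
  (\int[mu]_(x in Omega) (f x ^+ 2)%:E < +oo)%E.
Proof.
split=> [[mf f2]|[mf f2]].
  by split; [apply/(measurable_restrictT _ mO)|rewrite -sqn_restrict].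
by split; [apply/(measurable_restrictT _ mO)|rewrite sqn_restrict].
Qed.

Lemma sqr_L2norm f : L2in f -> ((L2norm Omega f ^+ 2)%:E = sqn (f \_ Omega))%E.
Proof.
move=> Lf; rewrite /L2norm sqr_sqrtr; last first.
  by apply: Rintegral_ge0 => x _; exact: sqr_ge0.
have [_ f2] := Lf; rewrite /Rintegral -sqn_restrict fineK// ge0_fin_numE//.
exact: sqn_ge0.
Qed.

Lemma L2in_le f g (M : R) : measurable_fun Omega f -> L2in g ->
  ae_in Omega (fun x => `|f x| <= M * `|g x|) ->
  L2in f /\ L2norm Omega f <= `|M| * L2norm Omega g.
Proof.
move=> mf Lg fg; have mg := L2in_measurable Lg.
have mf2 : measurable_fun Omega (fun x => (f x ^+ 2)%:E).
  by apply/measurable_EFinP; exact: measurable_funX.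
have mg2 : measurable_fun Omega (fun x => (g x ^+ 2)%:E).
  by apply/measurable_EFinP; exact: measurable_funX.
have le2 : (\int[mu]_(x in Omega) (f x ^+ 2)%:E <=
    (M ^+ 2)%:E * \int[mu]_(x in Omega) (g x ^+ 2)%:E)%E.
  rewrite -ge0_integralZl_EFin ?sqr_ge0//; last first.
    by move=> x _; rewrite lee_fin sqr_ge0.
  apply: ae_ge0_le_integral => //.
  - by move=> x _; rewrite lee_fin sqr_ge0.
  - by move=> x _; rewrite mule_ge0// lee_fin sqr_ge0.
  - exact: emeasurable_funM.
  - rewrite /ae_in in fg; apply: filterS fg => x fgx Ox; rewrite -EFinM lee_fin -exprMn.
    rewrite -(real_normK (num_real (f x))) -(real_normK (num_real (M * _))).
    rewrite ler_sqr ?nnegrE// normrM (le_trans (fgx Ox))//.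
    by rewrite ler_wpM2r// ler_norm.
have Lf : L2in f.
  apply/L2inP; split => //; apply: le_lt_trans le2 _.
  have [_ g2] := (L2inP g).1 Lg.
  rewrite lte_mul_pinfty// ?lee_fin ?sqr_ge0//.
split => //.
rewrite -(@ler_sqr R) ?nnegrE ?sqrtr_ge0 ?mulr_ge0 ?sqrtr_ge0// exprMn.
rewrite real_normK ?num_real// -lee_fin [X in (_ <= X)%E]EFinM.
by rewrite [X in (X <= _)%E]sqr_L2norm// [X in (_ <= _ * X)%E]sqr_L2norm// !sqn_restrict.
Qed.

Lemma integrable_L2inM f g : L2in f -> L2in g -> intg (fun x => f x * g x).
Proof.
rewrite /L2in !L2fun_Lfun => Lf Lg; apply/(integrable_mkcond _ mO).
have := (Lfun1_integrable mu _).1 (Lfun2_mul_Lfun1 Lf Lg).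
congr (mu.-integrable setT _); apply/funext => x /=.
by rewrite !patchE; case: ifP => _ //=; rewrite mulr0.
Qed.

Lemma L2in_cauchy_schwarz f g : L2in f -> L2in g ->
  `|\int[mu]_(x in Omega) (f x * g x)| <= L2norm Omega f * L2norm Omega g.
Proof.
move=> Lf Lg; have ifg := integrable_L2inM Lf Lg.
rewrite -(@ler_sqr R) ?nnegrE ?mulr_ge0 ?sqrtr_ge0// exprMn.
apply: (@le_trans _ _ ((\int[mu]_(x in Omega) `|f x * g x|) ^+ 2)).
  rewrite ler_sqr ?nnegrE ?Rintegral_ge0//.
  exact: le_normr_Rintegral.
rewrite -lee_fin EFin_expe [X in (_ <= X)%E]EFinM.
rewrite [X in (_ <= X * _)%E]sqr_L2norm// [X in (_ <= _ * X)%E]sqr_L2norm//.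
have [mf _] := Lf; have [mg _] := Lg.
apply: le_trans (le_sqr_integralM mu mf mg).
rewrite le_eqVlt; apply/orP; left; apply/eqP; congr (_ ^+ 2)%E.
rewrite /Rintegral fineK; last first.
  by apply: integrable_fin_num => //; exact: (integrable_abse ifg).
rewrite integral_mkcond; apply: eq_integral => x _; rewrite !patchE.
by case: ifP => _ //; rewrite mulr0 normr0.
Qed.

Definition L2vec (v : rV -> 'cV[R]_N) := forall i, L2in (fun x => v x i 0).

(** [H10norm] of a pair is this norm of its second component by definition; the two are exchanged by
    conversion. *)
Definition vnorm (v : rV -> 'cV[R]_N) : R :=
  Num.sqrt (\int[mu]_(x in Omega) (enorm (v x) ^+ 2)).

Implicit Types v w : rV -> 'cV[R]_N.

Lemma Lp_vec2P v : Lp_vec Omega 2%:E v <-> L2vec v.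
Proof. by split=> h i; apply/Lp2P; exact: h. Qed.

Lemma vnorm_ge0 v : 0 <= vnorm v. Proof. exact: sqrtr_ge0. Qed.

Lemma L2vec_lin (a : R) v w : L2vec v -> L2vec w -> L2vec (a *: v + w).
Proof.
move=> Lv Lw i.
rewrite (_ : (fun x => _) = (fun x => a * v x i 0 + w x i 0)).
  exact: L2in_lin.
by apply/funext => x; rewrite !mxE.
Qed.

Lemma L2vecD v w : L2vec v -> L2vec w -> L2vec (v + w).
Proof. by move=> Lv Lw; have := L2vec_lin 1 Lv Lw; rewrite scale1r. Qed.

Lemma L2vec0 : L2vec 0.
Proof.
move=> i; rewrite (_ : (fun x => _) = (fun=> 0)); first exact: L2in0.
by apply/funext => x; rewrite mxE.
Qed.

Lemma L2vecZ (a : R) v : L2vec v -> L2vec (a *: v).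
Proof. by move=> Lv; have := L2vec_lin a Lv L2vec0; rewrite addr0. Qed.

Lemma L2vecB v w : L2vec v -> L2vec w -> L2vec (v - w).
Proof.
by move=> Lv Lw; have := L2vec_lin (-1) Lw Lv; rewrite scaleN1r addrC.
Qed.

Lemma integrable_dot v w : L2vec v -> L2vec w ->
  intg (fun x => dot (v x) (w x)).
Proof.
move=> Lv Lw; rewrite (_ : EFin \o _ = (fun x => \sum_i (v x i 0 * w x i 0)%:E)%E).
  by apply: integrable_sum => // i _; exact: integrable_L2inM.
by apply/funext => x /=; rewrite /dot sumEFin.
Qed.

Lemma Rintegral_dot v w : L2vec v -> L2vec w ->
  \int[mu]_(x in Omega) dot (v x) (w x) =
  \sum_i \int[mu]_(x in Omega) (v x i 0 * w x i 0).
Proof.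
move=> Lv Lw; rewrite /Rintegral.
rewrite (eq_integral (fun x => \sum_i (v x i 0 * w x i 0)%:E)%E); last first.
  by move=> x _; rewrite /dot sumEFin.
rewrite integral_sum//; last by move=> i; exact: integrable_L2inM.
rewrite -sum_fine// => i _; apply: integrable_fin_num => //.
exact: integrable_L2inM.
Qed.

Lemma sqr_vnorm v : L2vec v ->
  vnorm v ^+ 2 = \sum_i L2norm Omega (fun x => v x i 0) ^+ 2.
Proof.
move=> Lv; rewrite /vnorm sqr_sqrtr; last first.
  by apply: Rintegral_ge0 => x _; exact: sqr_ge0.
under eq_Rintegral do rewrite sqr_enorm.
rewrite Rintegral_dot//; apply: eq_bigr => i _.
rewrite /L2norm sqr_sqrtr; first by apply: eq_Rintegral => x _; rewrite expr2.
by apply: Rintegral_ge0 => x _; exact: sqr_ge0.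
Qed.

Lemma L2norm_le_vnorm v i : L2vec v -> L2norm Omega (fun x => v x i 0) <= vnorm v.
Proof.
move=> Lv; rewrite -(@ler_sqr R) ?nnegrE ?sqrtr_ge0// sqr_vnorm//.
by rewrite (bigD1 i)//= lerDl sumr_ge0// => j _; rewrite sqr_ge0.
Qed.

(** Summing the scalar inequality over the components costs a factor [N], harmless because later
    estimates only need some constant. *)
Lemma vnorm_cauchy_schwarz v w : L2vec v -> L2vec w ->
  `|\int[mu]_(x in Omega) dot (v x) (w x)| <= N%:R * (vnorm v * vnorm w).
Proof.
move=> Lv Lw; rewrite Rintegral_dot//.
apply: (le_trans (ler_norm_sum _ _ _)).
apply: (@le_trans _ _ (\sum_(i < N) vnorm v * vnorm w)).
  apply: ler_sum => i _; apply: (le_trans (L2in_cauchy_schwarz (Lv i) (Lw i))).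
  by apply: ler_pM; rewrite ?sqrtr_ge0//; exact: L2norm_le_vnorm.
by rewrite sumr_const card_ord mulr_natl.
Qed.

Lemma sqr_vnormB v w : L2vec v -> L2vec w ->
  vnorm (v - w) ^+ 2 <= 2 * vnorm v ^+ 2 + 2 * vnorm w ^+ 2.
Proof.
move=> Lv Lw; rewrite /vnorm !sqr_sqrtr; try by
  apply: Rintegral_ge0 => x _; exact: sqr_ge0.
have ii u : L2vec u -> intg (fun x => enorm (u x) ^+ 2).
  by move=> Lu; under eq_fun do rewrite sqr_enorm; exact: integrable_dot.
have iv := integrableZl mO 2 (ii _ Lv); have iw := integrableZl mO 2 (ii _ Lw).
rewrite -!RintegralZl//; try exact: ii.
rewrite -RintegralD//; apply: le_Rintegral => //.
- by apply: ii; exact: L2vecB.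
- by have := integrableD mO iv iw.
- move=> x _; rewrite !sqr_enorm -[(v - w) x]/(v x - w x).
  have := dot_ge0 (v x + w x).
  have -> : v x - w x = v x + (-1) *: w x by rewrite scaleN1r.
  by rewrite !dotDl !dotDr !dotZl !dotZr (dotC (w x)); lra.
Qed.

Lemma vnorm_le v w (M : R) : 0 <= M ->
  (forall i, measurable_fun Omega (fun x => v x i 0)) -> L2vec w ->
  ae_in Omega (fun x => forall i, `|v x i 0| <= M * enorm (w x)) ->
  L2vec v /\ vnorm v <= N%:R * M * vnorm w.
Proof.
move=> M0 mv Lw vw.
have men : L2in (fun x => enorm (w x)).
  apply/L2inP; split.
    apply: (@measurableT_comp _ _ _ _ _ _ (@Num.sqrt R)).
      by apply: continuous_measurable_fun; exact: sqrt_continuous.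
    by apply: measurable_sum => i; apply: measurable_funM; exact: L2in_measurable.
  under eq_integral do rewrite sqr_enorm.
  have /integrableP[_] := integrable_dot Lw Lw; apply: le_lt_trans.
  rewrite le_eqVlt; apply/orP; left; apply/eqP; apply: eq_integral => x _.
  by rewrite gee0_abs// lee_fin dot_ge0.
have nw : L2norm Omega (fun x => enorm (w x)) = vnorm w by [].
have H i : L2in (fun x => v x i 0) /\
    L2norm Omega (fun x => v x i 0) <= M * vnorm w.
  rewrite -nw -[X in X * _](ger0_norm M0); apply: L2in_le => //.
  rewrite /ae_in in vw; apply: filterS vw => x vwx Ox; rewrite (le_trans (vwx Ox i))//.
  by rewrite ler_wpM2l// ler_norm.
have Lv : L2vec v by move=> i; have [] := H i.
split => //; rewrite -(@ler_sqr R) ?nnegrE ?vnorm_ge0 ?mulr_ge0 ?vnorm_ge0//.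
rewrite sqr_vnorm//.
apply: (@le_trans _ _ (\sum_(i < N) (M * vnorm w) ^+ 2)).
  apply: ler_sum => i _; rewrite ler_sqr ?nnegrE ?sqrtr_ge0 ?mulr_ge0 ?vnorm_ge0//.
  by have [] := H i.
rewrite sumr_const card_ord -[N%:R * M * _]mulrA [leRHS]exprMn -[leLHS]mulr_natl.
apply: ler_wpM2r; first exact: sqr_ge0.
have nn (n : nat) : (n <= n ^ 2)%N by case: n => // n; rewrite leq_pmulr.
by rewrite -natrX ler_nat nn.
Qed.

Definition measurable_mx (A : rV -> 'M[R]_N) :=
  forall i j, measurable_fun Omega (fun x => A x i j).

Lemma L2vec_mulmx_bounded (A : rV -> 'M[R]_N) v (M : R) : 0 <= M ->
  measurable_mx A -> ae_in Omega (fun x => forall i j, `|A x i j| <= M) ->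
  L2vec v -> L2vec (fun x => A x *m v x) /\
    vnorm (fun x => A x *m v x) <= N%:R * (N%:R * M) * vnorm v.
Proof.
move=> M0 mA AM Lv; apply: vnorm_le => //; first by rewrite mulr_ge0.
  move=> i; under eq_fun do rewrite mxE.
  apply: measurable_sum => j; apply: measurable_funM => //.
  exact: L2in_measurable.
rewrite /ae_in in AM; apply: filterS AM => x AMx Ox i; rewrite mxE (le_trans (ler_norm_sum _ _ _))//.
apply: (@le_trans _ _ (\sum_(j < N) M * enorm (v x))).
  apply: ler_sum => j _; rewrite normrM ler_pM//; first exact: AMx.
  rewrite -(@ler_sqr R) ?nnegrE ?sqrtr_ge0// sqr_enorm real_normK ?num_real//.
  rewrite /dot (bigD1 j)//= expr2 lerDl sumr_ge0// => l _.
  by rewrite -expr2 sqr_ge0.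
by rewrite sumr_const card_ord -mulrA mulr_natl.
Qed.

End L2_on_domain.

Section cvg0.
Context (R : realType).
Implicit Types (u : nat -> R).

Lemma cvg0_sqr u : (forall n, 0 <= u n) ->
  (forall eps : R, 0 < eps -> \forall n \near \oo, u n ^+ 2 <= eps) ->
  u @ \oo --> (0 : R).
Proof.
move=> u0 H; apply/cvgr0Pnorm_le => e e0.
have := H (e ^+ 2) (exprn_gt0 _ e0); apply: filterS => n.
by rewrite ler_sqr ?nnegrE ?(ltW e0)// ger0_norm.
Qed.

Lemma cvg0_sqr_le u : u @ \oo --> (0 : R) -> forall eps : R, 0 < eps ->
  \forall n \near \oo, u n ^+ 2 <= eps.
Proof.
move=> u0 e e0; have m0 : 0 < Num.min 1 e by rewrite lt_min ltr01.
have /cvgr0Pnorm_le/(_ _ m0) := u0; apply: filterS => n.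
rewrite le_min => /andP[h1 he]; rewrite -(real_normK (num_real (u n))) expr2.
by rewrite (le_trans _ he)// ler_piMl.
Qed.

Lemma cvg_dominated_dist (v : nat -> R) u (l C : R) : u @ \oo --> (0 : R) ->
  (forall n, `|v n - l| <= C * u n) -> v @ \oo --> l.
Proof.
move=> u0 H; apply/cvgrPdist_le => e e0.
have C1 : 0 < `|C| + 1 by rewrite ltr_wpDl.
have e1 : 0 < e / (`|C| + 1) by rewrite divr_gt0.
have /cvgr0Pnorm_le/(_ _ e1) := u0; apply: filterS => n un.
rewrite distrC (le_trans (H n))// (le_trans (ler_norm _))// normrM.
rewrite -(@divfK _ (`|C| + 1) _ e) ?gt_eqF// mulrC ler_pM//.
by rewrite lerDl.
Qed.

Lemma harmonic_le (eps : R) : 0 < eps -> \forall n \near \oo, (n.+1%:R : R)^-1 <= eps.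
Proof.
move=> e0; have /cvgrPdist_le/(_ _ e0) := @cvg_harmonic R; apply: filterS => n.
by rewrite sub0r normrN ger0_norm// invr_ge0.
Qed.

End cvg0.

Section H10_theory.
Context (R : realType) (N : nat).
Local Notation rV := 'rV[R]_N.
Local Notation mu := (lebesgue_rV R N).
Variable Omega : set rV.
Hypothesis oO : open Omega.
Hypothesis bO : bounded_set Omega.
Implicit Types (f g h phi : rV -> R) (u v w y psi : sobolev R N)
  (A B : rV -> 'M[R]_N).

Let mO : measurable Omega. Proof. exact: open_measurable_rV. Qed.

Local Notation intg f := (mu.-integrable Omega (EFin \o f)).
Local Notation L2in := (L2in Omega).
Local Notation L2vec := (L2vec Omega).
Local Notation vnorm := (vnorm Omega).

Lemma restrict_C0infty phi : C0infty Omega phi -> phi \_ Omega = phi.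
Proof.
move=> cp; apply/funext => x; rewrite patchE; case: ifPn => //.
by rewrite notin_setE => /(C0infty_out cp) ->.
Qed.

Lemma L2in_C0infty phi : C0infty Omega phi -> L2in phi.
Proof.
move=> cp; rewrite -[L2in phi]/(L2fun (phi \_ Omega)) restrict_C0infty//.
have sp := C0infty_smooth cp; have [M pM] := C0infty_bounded_support cp.
have [K K0 pK] := smooth_bounded sp (C0infty_bounded_support cp).
have mp := smooth_measurable sp; split => //.
have M1 : 0 < `|M| + 1 by rewrite ltr_wpDl.
apply: (@le_lt_trans _ _ (\int[mu]_x (K ^+ 2 * \1_(ball (0 : rV) (`|M| + 1) : set rV) x)%:E)%E);
  last by rewrite integral_indic_ball ?sqr_ge0// ltry.
apply: ge0_le_integral => //.
- by move=> x _; rewrite lee_fin sqr_ge0.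
- exact: measurable_sqr_EFin.
- apply/measurable_EFinP; apply: measurable_funM => //.
  by apply: measurable_indic; exact: measurable_ball_rV.
- move=> x _; rewrite lee_fin indicE.
  have [xB|xB] := boolP (x \in _).
    by rewrite mulr1 -(real_normK (num_real (phi x))) lerXn2r ?nnegrE.
  rewrite pM ?expr0n ?mulr0//.
  move: xB; rewrite notin_setE mx_norm_ball /ball_/= sub0r normrN => /negP.
  rewrite -leNgt; apply: lt_le_trans.
  by rewrite (le_lt_trans (ler_norm M))// ltrDl.
Qed.

Lemma L2vec_grad phi : C0infty Omega phi -> L2vec (grad phi).
Proof.
move=> cp i; rewrite (_ : (fun x => _) = partial i phi).
  by apply: L2in_C0infty; exact: C0infty_partial.
by apply/funext => x; rewrite mxE.
Qed.

(** Trades the approximating sequence for one test function per tolerance on the squared norms;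
    conversely the tolerances [1 / (n + 1)] rebuild a sequence. *)
Lemma H10P u : H10 Omega u <-> [/\ L2in u.1, L2vec u.2 &
  forall eps : R, 0 < eps -> exists phi, [/\ C0infty Omega phi,
    L2norm Omega (phi - u.1) ^+ 2 <= eps & vnorm (grad phi - u.2) ^+ 2 <= eps]].
Proof.
split=> [[/Lp2P L1 /Lp_vec2P L2 [phi [cp p1 p2]]]|[L1 L2 H]].
  split => // eps eps0.
  have [n _ hn] := cvg0_sqr_le p1 eps0; have [m _ hm] := cvg0_sqr_le p2 eps0.
  exists (phi (maxn n m)); split => //.
  - by apply: hn; exact: leq_maxl.
  - by apply: hm; exact: leq_maxr.
split; [exact/Lp2P|exact/Lp_vec2P|].
have n0 n : 0 < (n.+1%:R : R)^-1 by rewrite invr_gt0.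
pose phi n := sval (cid (H _ (n0 n))).
have phiP n : [/\ C0infty Omega (phi n),
    L2norm Omega (phi n - u.1) ^+ 2 <= (n.+1%:R)^-1 &
    vnorm (grad (phi n) - u.2) ^+ 2 <= (n.+1%:R)^-1].
  by rewrite /phi; case: cid.
exists phi; split; first by move=> n; have [] := phiP n.
- apply: cvg0_sqr => [n|e e0]; first exact: sqrtr_ge0.
  apply: filterS (harmonic_le e0) => n; apply: le_trans.
  by have [] := phiP n.
- apply: cvg0_sqr => [n|e e0]; first exact: sqrtr_ge0.
  apply: filterS (harmonic_le e0) => n; apply: le_trans.
  by have [] := phiP n.
Qed.

Lemma H10_L2vec u : H10 Omega u -> L2vec u.2.
Proof. by case/H10P. Qed.

Lemma H10_L2in u : H10 Omega u -> L2in u.1.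
Proof. by case/H10P. Qed.

Lemma L2norm_sqrD_le f g : L2in f -> L2in g ->
  L2norm Omega (f + g) ^+ 2 <= 2 * L2norm Omega f ^+ 2 + 2 * L2norm Omega g ^+ 2.
Proof.
move=> Lf Lg; rewrite -lee_fin EFinD [X in (_ <= X + _)%E]EFinM [X in (_ <= _ + X)%E]EFinM.
have Lfg : L2in (f + g) by exact: L2inD.
rewrite [X in (X <= _)%E]sqr_L2norm// [X in (_ <= _ * X + _)%E]sqr_L2norm//.
rewrite [X in (_ <= _ + _ * X)%E]sqr_L2norm//.
have [mf _] := Lf; have [mg _] := Lg.
apply: le_trans (sqnD mf mg); rewrite le_eqVlt; apply/orP; left; apply/eqP.
apply: eq_integral => x _; congr ((_ ^+ 2)%:E).
rewrite -[RHS]/((f \_ Omega) x + (g \_ Omega) x) !patchE.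
by case: ifP => _ //; rewrite addr0.
Qed.

Lemma L2normZ_sqr (a : R) f : L2in f ->
  L2norm Omega (fun x => a * f x) ^+ 2 = a ^+ 2 * L2norm Omega f ^+ 2.
Proof.
move=> Lf; rewrite /L2norm !sqr_sqrtr; try by
  apply: Rintegral_ge0 => x _; exact: sqr_ge0.
under eq_Rintegral do rewrite exprMn.
rewrite RintegralZl//; have := integrable_L2inM oO Lf Lf.
by apply: eq_integrable => // x _.
Qed.

Lemma gradD f g x : smooth f -> smooth g ->
  grad (f + g) x = grad f x + grad g x.
Proof.
move=> sp sq; apply/colP => i; rewrite !mxE partialD//;
  exact: smooth_differentiable.
Qed.

Lemma gradZ (a : R) phi x : smooth phi ->
  grad (fun z => a * phi z) x = a *: grad phi x.
Proof.
move=> sp; apply/colP => i; rewrite !mxE partialZ//; exact: smooth_differentiable.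
Qed.

Lemma C0inftyZ (a : R) phi : C0infty Omega phi -> C0infty Omega (fun x => a * phi x).
Proof.
move=> cp; have := @C0inftyM _ _ Omega phi (cst a) (smooth_cst a) cp.
by congr C0infty.
Qed.

Lemma vnormZ_sqr (a : R) (v : rV -> 'cV[R]_N) : L2vec v ->
  vnorm (a *: v) ^+ 2 = a ^+ 2 * vnorm v ^+ 2.
Proof.
move=> Lv; rewrite !sqr_vnorm//; last exact: L2vecZ.
rewrite mulr_sumr; apply: eq_bigr => i _; rewrite -L2normZ_sqr//.
by congr (L2norm _ _ ^+ 2); apply/funext => x; rewrite !mxE.
Qed.

Lemma vnormN (v : rV -> 'cV[R]_N) : L2vec v -> vnorm (- v) = vnorm v.
Proof.
move=> Lv; apply/eqP; rewrite -(@eqrXn2 _ 2) ?vnorm_ge0// -scaleN1r vnormZ_sqr//.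
by rewrite sqrrN expr1n mul1r.
Qed.

Lemma H10_lin (a : R) u v : H10 Omega u -> H10 Omega v -> H10 Omega (a *: u + v).
Proof.
move=> /H10P[u1 u2 uH] /H10P[v1 v2 vH]; apply/H10P; split.
- exact: L2in_lin.
- exact: L2vec_lin.
move=> eps eps0.
(* The squared error of the combination is at most [2 * a ^ 2] times one squared error plus 2 times
   the other. *)
have D0 : 0 < 4 * (a ^+ 2 + 1) by rewrite mulr_gt0// ltr_wpDl// sqr_ge0.
have e1 : 0 < eps / (4 * (a ^+ 2 + 1)) by rewrite divr_gt0.
have [phi [cp p1 p2]] := uH _ e1; have [psi [cq q1 q2]] := vH _ e1.
have [sp sq] := (C0infty_smooth cp, C0infty_smooth cq).
have h (s t : R) : 0 <= s -> 0 <= t -> s <= eps / (4 * (a ^+ 2 + 1)) ->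
    t <= eps / (4 * (a ^+ 2 + 1)) -> 2 * (a ^+ 2 * s) + 2 * t <= eps.
  move=> s0 t0 se te.
  have /ler_pM2l/(_ s (eps / (4 * (a ^+ 2 + 1)))) : 0 < a ^+ 2 + 1.
    by rewrite ltr_wpDl// sqr_ge0.
  rewrite se => as1.
  have E : (a ^+ 2 + 1) * (eps / (4 * (a ^+ 2 + 1))) = eps / 4.
    have a1 : a ^+ 2 + 1 != 0 by rewrite gt_eqF// ltr_wpDl// sqr_ge0.
    by field.
  have te4 : t <= eps / 4.
    apply: (le_trans te); rewrite -E ler_peMl ?(ltW e1)//.
    by rewrite lerDr sqr_ge0.
  rewrite E mulrDl mul1r in as1; lra.
exists ((fun x => a * phi x) + psi); split.
- by apply: C0inftyD => //; exact: C0inftyZ.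
- have Lp := L2in_C0infty cp; have Lq := L2in_C0infty cq.
  have L1 : L2in (fun x => phi x - u.1 x) by apply: L2inD => //; exact: L2inN.
  have L2 : L2in (fun x => psi x - v.1 x) by apply: L2inD => //; exact: L2inN.
  rewrite (_ : _ - _ = (fun x => a * (phi x - u.1 x)) + (fun x => psi x - v.1 x)).
    apply: (le_trans (L2norm_sqrD_le (L2inZ a L1) L2)); rewrite L2normZ_sqr//.
    by apply: h => //; rewrite sqr_ge0.
  apply/funext => x; rewrite -[LHS]/((a * phi x + psi x) - (a * u.1 x + v.1 x)).
  by rewrite -[RHS]/(a * (phi x - u.1 x) + (psi x - v.1 x)); ring.
- have Lp := L2vec_grad cp; have Lq := L2vec_grad cq.
  have L1 : L2vec (grad phi - u.2) by exact: L2vecB.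
  have L2 : L2vec (v.2 - grad psi) by exact: L2vecB.
  rewrite (_ : _ - _ = a *: (grad phi - u.2) - (v.2 - grad psi)).
    apply: (le_trans (sqr_vnormB oO (L2vecZ a L1) L2)).
    rewrite vnormZ_sqr// -(vnormN L2) opprB.
    by apply: h => //; rewrite sqr_ge0.
  apply/funext => x; rewrite -[LHS]/(grad _ x - (a *: u.2 x + v.2 x)).
  rewrite gradD ?gradZ//; last exact: smoothZ.
  rewrite -[RHS]/(a *: (grad phi x - u.2 x) - (v.2 x - grad psi x)).
  by rewrite scalerBr opprB opprD addrACA.
Qed.

Lemma H10_C0infty phi : C0infty Omega phi -> H10 Omega (with_grad phi).
Proof.
move=> cp; apply/H10P; split; [exact: L2in_C0infty|exact: L2vec_grad|].
move=> eps eps0; exists phi; split => //=.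
- rewrite /L2norm Rintegral_eq0 ?sqrtr0 ?expr0n ?(ltW eps0)// => x _.
  by rewrite -[(phi - phi) x]/(phi x - phi x) subrr expr0n.
- rewrite -[vnorm _]/(H10norm Omega (with_grad phi - with_grad phi)) /H10norm.
  rewrite Rintegral_eq0 ?sqrtr0 ?expr0n ?(ltW eps0)// => x _.
  rewrite sqr_enorm -[(_ - _).2 x]/(grad phi x - grad phi x) subrr.
  by rewrite /dot big1// => i _; rewrite mxE mul0r.
Qed.

Lemma H10B u v : H10 Omega u -> H10 Omega v -> H10 Omega (u - v).
Proof. by move=> Hu Hv; have := H10_lin (-1) Hv Hu; rewrite scaleN1r addrC. Qed.

Lemma H10_sobolev_pair u : H10 Omega u ->
  sobolev_pair Omega (u.1 \_ Omega) (fun i => (fun x => u.2 x i 0) \_ Omega).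
Proof.
move=> /H10P[u1 u2 uH]; split => // eps eps0.
have [phi [cp p1 p2]] := uH _ eps0; exists phi; split => //.
  have L1 : L2in (phi - u.1).
    by apply: L2inD => //; [exact: L2in_C0infty|exact: L2inN].
  move: p1; rewrite -lee_fin [X in (X <= _)%E]sqr_L2norm//; apply: le_trans.
  rewrite le_eqVlt; apply/orP; left; apply/eqP; apply: eq_integral => x _.
  rewrite -[(phi - _) x]/(phi x - (u.1 \_ Omega) x) -[in LHS](restrict_C0infty cp) !patchE.
  by case: ifP => _ //; rewrite subr0.
move=> i; have L1 : L2vec (grad phi - u.2) by apply: L2vecB => //; exact: L2vec_grad.
have := le_trans _ p2 => /(_ (L2norm Omega (fun x => (grad phi - u.2) x i 0) ^+ 2)).
rewrite lerXn2r ?nnegrE ?sqrtr_ge0//; last exact: L2norm_le_vnorm.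
move=> /(_ isT); rewrite -lee_fin [X in (X <= _)%E]sqr_L2norm//; apply: le_trans.
rewrite le_eqVlt; apply/orP; left; apply/eqP; apply: eq_integral => x _.
rewrite -[(partial i phi - _) x]/(partial i phi x - _).
rewrite -[in LHS](restrict_C0infty (C0infty_partial i cp)) !patchE.
by case: ifP => _ //; rewrite ?subr0// !mxE.
Qed.

(** The case of the constant weight 1, for which all translates of the gradient have the same
    norm. *)
Lemma H10_poincare (i0 : 'I_N) : exists2 P : R, 0 <= P &
  forall u, H10 Omega u -> L2norm Omega u.1 <= P * H10norm Omega u.
Proof.
have [d d0 dP] := poincare_translation_bounded bO i0.
exists d; first exact: ltW.
move=> u Hu; have Lu := H10_L2vec Hu; have L1 := H10_L2in Hu.
pose g0 := (fun x => u.2 x i0 0) \_ Omega.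
have K s : (sqn (fun x => cst 1 x * g0 (x + s))%R <=
    (L2norm Omega (fun x => u.2 x i0 0) ^+ 2)%:E)%E.
  rewrite [leRHS]sqr_L2norm//; have [mg _] := Lu i0.
  rewrite -[leRHS](sqn_translate s mg) le_eqVlt; apply/orP; left; apply/eqP.
  by apply: eq_integral => x _; rewrite mul1r.
have := dP _ _ _ _ (H10_sobolev_pair Hu) (measurable_cst _) (sqr_ge0 _) K 0.
rewrite (_ : sqn _ = sqn (u.1 \_ Omega)); last first.
  by apply: eq_integral => x _; rewrite mul1r addr0.
rewrite -[leLHS]sqr_L2norm// lee_fin -exprMn => H.
apply: (@le_trans _ _ (d * L2norm Omega (fun x => u.2 x i0 0))).
  by rewrite -(@ler_sqr R) ?nnegrE ?sqrtr_ge0// mulr_ge0 ?sqrtr_ge0 ?(ltW d0).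
by rewrite ler_wpM2l ?(ltW d0)//; exact: L2norm_le_vnorm.
Qed.

End H10_theory.

(** * The bracket as a continuous extension *)

Lemma eq_of_le_eps (R : realType) (x y C : R) :
  (forall e : R, 0 < e -> `|x - y| <= C * e) -> x = y.
Proof.
move=> H; apply/eqP; rewrite -subr_eq0 -normr_le0; apply/ler_addgt0Pl => e e0.
have C1 : 0 < `|C| + 1 by rewrite ltr_wpDl.
rewrite addr0 (le_trans (H (e / (`|C| + 1)) _)) ?divr_gt0//.
rewrite mulrA ler_pdivrMr// mulrC ler_wpM2l ?(ltW e0)//.
by rewrite (le_trans (ler_norm C))// lerDl.
Qed.

Section duality.
Context (R : realType) (N : nat).
Local Notation rV := 'rV[R]_N.
Local Notation mu := (lebesgue_rV R N).
Variable Omega : set rV.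
Hypothesis oO : open Omega.
Implicit Types (v w : rV -> 'cV[R]_N) (phi psi : rV -> R) (u y : sobolev R N)
  (A B : rV -> 'M[R]_N) (f g : sobolev R N -> R).

Let mO : measurable Omega. Proof. exact: open_measurable_rV. Qed.

Local Notation intg f := (mu.-integrable Omega (EFin \o f)).
Local Notation L2in := (L2in Omega).
Local Notation L2vec := (L2vec Omega).
Local Notation vnorm := (vnorm Omega).

Definition dot_integrable v w := intg (fun x => dot (v x) (w x)).

Definition dot_integral v w : R := \int[mu]_(x in Omega) dot (v x) (w x).

Lemma dot_integralC v w : dot_integral v w = dot_integral w v.
Proof. by apply: eq_Rintegral => x _; rewrite dotC. Qed.

Lemma dot_integrableC v w : dot_integrable v w -> dot_integrable w v.
Proof. by rewrite /dot_integrable; under eq_fun do rewrite dotC. Qed.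

Lemma dot_integral_linr (a : R) (v w z : rV -> 'cV[R]_N) :
  dot_integrable w v -> dot_integrable w z ->
  dot_integral w (a *: v + z) = a * dot_integral w v + dot_integral w z.
Proof.
move=> iv iz; rewrite /dot_integral -RintegralZl// -RintegralD//; last first.
  by have := integrableZl mO a iv.
by apply: eq_Rintegral => x _; rewrite -dotZr -dotDr.
Qed.

Lemma vnormD_le v w : L2vec v -> L2vec w ->
  vnorm (v + w) <= 2 * (vnorm v + vnorm w).
Proof.
move=> Lv Lw; have LN : L2vec (- w) by rewrite -scaleN1r; exact: L2vecZ.
rewrite -(@ler_sqr R) ?nnegrE ?mulr_ge0 ?addr_ge0 ?vnorm_ge0//.
rewrite -{1}[w]opprK (le_trans (sqr_vnormB oO Lv LN))// (vnormN oO Lw).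
by have := vnorm_ge0 Omega v; have := vnorm_ge0 Omega w; nra.
Qed.

Lemma vnormZ (a : R) v : L2vec v -> vnorm (a *: v) = `|a| * vnorm v.
Proof.
move=> Lv; apply/eqP; rewrite -(@eqrXn2 _ 2) ?vnorm_ge0 ?mulr_ge0 ?vnorm_ge0//.
by rewrite vnormZ_sqr// exprMn real_normK ?num_real.
Qed.

Lemma vnorm_lin_le (a : R) v w : L2vec v -> L2vec w ->
  vnorm (a *: v + w) <= 2 * (`|a| * vnorm v + vnorm w).
Proof.
by move=> Lv Lw; rewrite -vnormZ//; apply: vnormD_le => //; exact: L2vecZ.
Qed.

Lemma H10_dense u (e : R) : H10 Omega u -> 0 < e ->
  exists2 phi, C0infty Omega phi & H10norm Omega (with_grad phi - u) <= e.
Proof.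
move=> /H10P[_ _ H] e0; have [phi [cp _ h]] := H _ (exprn_gt0 2 e0).
exists phi => //; rewrite -(@ler_sqr R) ?nnegrE ?sqrtr_ge0 ?(ltW e0)//.
Qed.

Lemma Hm1_lin (a : R) f g : Hm1 Omega f -> Hm1 Omega g ->
  Hm1 Omega (fun u => a * f u + g u).
Proof.
move=> [fl [C fC]] [gl [D gD]]; split=> [b u v Hu Hv|].
  by rewrite fl// gl//; ring.
exists (`|a| * C + D) => u Hu; rewrite (le_trans (ler_normD _ _))// mulrDl.
by rewrite lerD ?gD// normrM -mulrA ler_wpM2l ?fC.
Qed.

(** Density of the test functions and continuity. Identities between brackets are reduced by it to
    identities between integrals against test functions. *)
Lemma Hm1_ext f g : Hm1 Omega f -> Hm1 Omega g ->
  (forall phi, C0infty Omega phi -> f (with_grad phi) = g (with_grad phi)) ->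
  forall u, H10 Omega u -> f u = g u.
Proof.
move=> fm gm fg u Hu; have [hl [C hC]] := Hm1_lin (-1) gm fm.
apply: (@eq_of_le_eps _ _ _ `|C|) => e e0.
have [phi cp pe] := H10_dense Hu e0; have Hp := H10_C0infty cp.
have := hl (-1) _ _ Hu Hp; rewrite !fg//.
rewrite (_ : -1 * g (with_grad phi) + g (with_grad phi) = 0); last by ring.
have := hC (-1 *: u + with_grad phi) (H10_lin oO (-1) Hu Hp).
move=> h1 h2; move: h1; rewrite h2.
rewrite (_ : -1 * (-1 * g u + f u) + 0 = - (f u - g u)); last by ring.
rewrite normrN => h; apply: (le_trans h); rewrite scaleN1r addrC.
apply: (le_trans (ler_wpM2r (sqrtr_ge0 _) (ler_norm C))).
by apply: ler_wpM2l; [exact: normr_ge0|exact: pe].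
Qed.

Lemma Hm1_dot_integral v : L2vec v -> Hm1 Omega (fun u => dot_integral u.2 v).
Proof.
move=> Lv; split=> [a u w /H10_L2vec Lu /H10_L2vec Lw|].
  rewrite !(dot_integralC _ v) dot_integral_linr//; exact: integrable_dot.
exists (N%:R * vnorm v) => u /H10_L2vec Lu.
by rewrite (le_trans (vnorm_cauchy_schwarz oO Lu Lv))// mulrCA mulrC.
Qed.

Definition L2mx A := forall i j, L2in (fun x => A x i j).

Lemma Lp_mx2P A : Lp_mx Omega 2%:E A <-> L2mx A.
Proof. by split=> h i j; apply/Lp2P; exact: h. Qed.

Lemma L2mx_lin (a : R) A B : L2mx A -> L2mx B -> L2mx (a *: A + B).
Proof.
move=> LA LB i j; have := L2in_lin a (LA i j) (LB i j).
by congr L2in; apply/funext => x; rewrite !mxE.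
Qed.

Lemma sym_partE A x i j : sym_part A x i j = 2^-1 * (A x i j + A x j i).
Proof. by rewrite !mxE. Qed.

Lemma skew_partE A x i j : skew_part A x i j = 2^-1 * (A x i j - A x j i).
Proof. by rewrite !mxE. Qed.

Lemma sym_part_tr A x : (sym_part A x)^T = sym_part A x.
Proof. by apply/matrixP => i j; rewrite mxE !sym_partE addrC. Qed.

Lemma skew_part_tr A x : (skew_part A x)^T = - skew_part A x.
Proof. by apply/matrixP => i j; rewrite !mxE -mulrN opprB. Qed.

Lemma L2mx_sym A : L2mx A -> L2mx (sym_part A).
Proof.
move=> LA i j; under eq_fun do rewrite sym_partE.
by apply: L2inZ; exact: L2inD.
Qed.

Lemma L2mx_skew A : L2mx A -> L2mx (skew_part A).
Proof.
move=> LA i j; under eq_fun do rewrite skew_partE.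
by apply: L2inZ; apply: L2inD => //; exact: L2inN.
Qed.

Lemma dot_integrable_grad phi A v : C0infty Omega phi -> L2mx A -> L2vec v ->
  dot_integrable (grad phi) (fun x => A x *m v x).
Proof.
move=> cp LA Lv; rewrite /dot_integrable.
rewrite (_ : EFin \o _ = (fun x =>
    \sum_i \sum_j (A x i j * (partial i phi x * v x j 0))%:E)%E); last first.
  apply/funext => x /=; rewrite dot_mulmxE -sumEFin.
  apply: eq_bigr => i _; rewrite -sumEFin; apply: eq_bigr => j _.
  by rewrite mxE; congr EFin; ring.
apply: integrable_sum => // i _; apply: integrable_sum => // j _.
apply: integrable_L2inM => //.
have ci := C0infty_partial i cp; have si := C0infty_smooth ci.
have [K K0 pK] := smooth_bounded si (C0infty_bounded_support ci).
have mp := measurable_funTS (smooth_measurable si) : measurable_fun Omega (partial i phi).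
have mv := L2in_measurable oO (Lv j).
apply: (@L2in_le _ _ _ oO _ (fun x => v x j 0) K _ (Lv j) _).1.
  exact: measurable_funM.
by apply: aeW => x _; rewrite normrM ler_wpM2r.
Qed.

Lemma bform_linr (a : R) A phi u y : C0infty Omega phi -> L2mx A ->
  L2vec u.2 -> L2vec y.2 ->
  bform Omega A (with_grad phi) (a *: u + y) =
  a * bform Omega A (with_grad phi) u + bform Omega A (with_grad phi) y.
Proof.
move=> cp LA Lu Ly.
have := dot_integral_linr a (dot_integrable_grad cp LA Lu)
  (dot_integrable_grad cp LA Ly).
move=> <-; apply: eq_Rintegral => x _.
rewrite -[LHS]/(dot (grad phi x) (A x *m (a *: u.2 x + y.2 x))).
by rewrite mulmxDr -scalemxAr.
Qed.

Lemma bform_linmx (a : R) A B C phi y : C0infty Omega phi -> L2mx A -> L2mx B ->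
  (forall x, C x = a *: A x + B x) -> L2vec y.2 ->
  bform Omega C (with_grad phi) y =
  a * bform Omega A (with_grad phi) y + bform Omega B (with_grad phi) y.
Proof.
move=> cp LA LB CAB Ly.
have := dot_integral_linr a (dot_integrable_grad cp LA Ly)
  (dot_integrable_grad cp LB Ly).
by move=> <-; apply: eq_Rintegral => x _ /=; rewrite CAB mulmxDl -scalemxAl.
Qed.

Lemma bform_lin_test (a : R) A phi psi y : C0infty Omega phi ->
  C0infty Omega psi -> L2mx A -> L2vec y.2 ->
  bform Omega A (a *: with_grad phi + with_grad psi) y =
  a * bform Omega A (with_grad phi) y + bform Omega A (with_grad psi) y.
Proof.
move=> cp cq LA Ly.
have E u : bform Omega A u y = dot_integral (fun x => A x *m y.2 x) u.2.
  exact: dot_integralC.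
by rewrite !E; apply: dot_integral_linr => //; apply: dot_integrableC;
  exact: dot_integrable_grad.
Qed.

Lemma with_grad_lin (a : R) phi psi : C0infty Omega phi -> C0infty Omega psi ->
  with_grad ((fun x => a * phi x) + psi) = a *: with_grad phi + with_grad psi.
Proof.
move=> cp cq; congr pair; apply/funext => x.
have [sp sq] := (C0infty_smooth cp, C0infty_smooth cq).
by rewrite gradD ?gradZ//; exact: smoothZ.
Qed.

Lemma H10norm_dist phi psi u : C0infty Omega phi -> C0infty Omega psi ->
  H10 Omega u -> H10norm Omega (with_grad phi - with_grad psi) <=
  2 * (H10norm Omega (with_grad phi - u) + H10norm Omega (with_grad psi - u)).
Proof.
move=> /L2vec_grad Lp /L2vec_grad Lq /H10_L2vec Lu.
have L1 : L2vec (grad phi - u.2) by exact: L2vecB.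
have L2 : L2vec (grad psi - u.2) by exact: L2vecB.
have LN : L2vec (- (grad psi - u.2)) by rewrite -scaleN1r; exact: L2vecZ.
have h := vnormD_le L1 LN; rewrite (vnormN oO L2) in h.
have E : grad phi - u.2 - (grad psi - u.2) = grad phi - grad psi.
  by apply/funext => x; rewrite opprB; exact: subrKA.
by rewrite E in h.
Qed.

(* McShane's formula for the extension of a Lipschitz function replaces the
   limit defining the extension by continuity. *)
Lemma bracket_dist A y : L2mx A -> Dom Omega A y ->
  exists2 C : R, 0 <= C & forall u phi, H10 Omega u -> C0infty Omega phi ->
    `|bform Omega (skew_part A) (with_grad phi) y - bracket Omega A y u| <=
    C * H10norm Omega (with_grad phi - u).
Proof.
move=> LA [Hy [c0 c0P]]; have Ly := H10_L2vec Hy; have LK := L2mx_skew LA.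
pose b phi := bform Omega (skew_part A) (with_grad phi) y.
pose c := `|c0|; have c_ge0 : 0 <= c by exact: normr_ge0.
have cP phi : C0infty Omega phi -> `|b phi| <= c * H10norm Omega (with_grad phi).
  by move=> /c0P h; rewrite (le_trans h)// ler_wpM2r ?sqrtr_ge0// ler_norm.
have bB phi psi : C0infty Omega phi -> C0infty Omega psi ->
    `|b phi - b psi| <= c * H10norm Omega (with_grad phi - with_grad psi).
  move=> cp cq; have cs : C0infty Omega ((fun x => -1 * psi x) + phi).
    by apply: C0inftyD => //; exact: C0inftyZ.
  have -> : b phi - b psi = b ((fun x => -1 * psi x) + phi).
    by rewrite /b (with_grad_lin (-1) cq cp) (bform_lin_test (-1) cq cp LK Ly) mulN1r addrC.
  have -> : with_grad phi - with_grad psi = with_grad ((fun x => -1 * psi x) + phi).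
    by rewrite (with_grad_lin (-1) cq cp) scaleN1r addrC.
  exact: cP.
exists (2 * c); first by rewrite mulr_ge0.
move=> u phi Hu cp.
pose d phi := H10norm Omega (with_grad phi - u).
have d0 psi : 0 <= d psi by exact: sqrtr_ge0.
pose S := [set b t + 2 * c * d t | t in C0infty Omega].
have bd s t : C0infty Omega s -> C0infty Omega t -> b s - 2 * c * d s <= b t + 2 * c * d t.
  move=> cs ct; have h1 := bB _ _ cs ct; have h2 := H10norm_dist cs ct Hu.
  rewrite -/(d s) -/(d t) in h2.
  have h3 := le_trans h1 (ler_wpM2l c_ge0 h2).
  have := le_trans (ler_norm _) h3; clear h1 h2 h3.
  by move: (b s) (b t) (d s) (d t) => p q x z h; lra.
have Slb s : C0infty Omega s -> lbound S (b s - 2 * c * d s).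
  by move=> cs _ [t ct <-]; exact: bd.
pose r := inf S.
have rP s : C0infty Omega s -> `|b s - r| <= 2 * c * d s.
  move=> cs; rewrite ler_norml; apply/andP; split.
    have : r <= b s + 2 * c * d s.
      by apply: ge_inf; [exists (b s - 2 * c * d s); exact: Slb|exists s].
    by move: (b s) (d s) => p x h; lra.
  have : b s - 2 * c * d s <= r by apply: lb_le_inf; [exists (b s + 2 * c * d s), s|exact: Slb].
  by move: (b s) (d s) => p x h; lra.
have /choice[phin phiP] n : exists psi,
    C0infty Omega psi /\ d psi <= n.+1%:R^-1.
  have n0 : 0 < (n.+1%:R : R)^-1 by rewrite invr_gt0.
  by have [psi cq qe] := H10_dense Hu n0; exists psi.
have phi_cvg : d (phin n) @[n --> \oo] --> (0 : R).
  apply: (squeeze_cvgr _ (@cvg_cst _ _ _ _ _) (@cvg_harmonic R)).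
  by near=> n; rewrite d0/=; have [] := phiP n.
have rlim (t : nat -> rV -> R) : (forall n, C0infty Omega (t n)) ->
    d (t n) @[n --> \oo] --> (0 : R) -> b (t n) @[n --> \oo] --> r.
  by move=> ct dt; apply: (cvg_dominated_dist dt) => n; exact: rP.
suff -> : bracket Omega A y u = r by exact: rP.
rewrite /bracket; set T := [set r : R | _].
have Tr : T r by exact: rlim.
have [_ /(_ Tr) Tx] : True /\ (T r -> T (xget 0 T)) by split => // h; exact: (xgetI 0 h).
have ct n : C0infty Omega (phin n) by have [] := phiP n.
have h1 : b (phin n) @[n --> \oo] --> xget 0 T by exact: Tx.
have h2 : b (phin n) @[n --> \oo] --> r by exact: rlim.
by rewrite -(cvg_lim (@norm_hausdorff _ _) h1)// -(cvg_lim (@norm_hausdorff _ _) h2).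
Unshelve. all: by end_near. Qed.

Lemma bracket_test A y phi : L2mx A -> Dom Omega A y -> C0infty Omega phi ->
  bracket Omega A y (with_grad phi) =
  bform Omega (skew_part A) (with_grad phi) y.
Proof.
move=> LA Dy cp; have [C _ CP] := bracket_dist LA Dy.
have := CP _ _ (H10_C0infty cp) cp; rewrite subrr.
rewrite /H10norm Rintegral_eq0 ?sqrtr0 ?mulr0 ?normr_le0 ?subr_eq0 => [/eqP //|x _].
by rewrite sqr_enorm /dot big1// => i _; rewrite mxE mul0r.
Qed.

Lemma Hm1_bracket A y : L2mx A -> Dom Omega A y -> Hm1 Omega (bracket Omega A y).
Proof.
move=> LA Dy; have [C C0 CP] := bracket_dist LA Dy.
have LK := L2mx_skew LA; have Ly := H10_L2vec Dy.1.
have E (p q r : R) : (q * (2 * (p + 1)) + p * q + q) * r =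
    q * (2 * (p * r + r)) + (p * (q * r) + q * r) by ring.
split=> [a u v Hu Hv|].
  apply: (@eq_of_le_eps _ _ _ (C * (2 * (`|a| + 1)) + `|a| * C + C)) => e e0.
  have [t ct te] := H10_dense Hu e0; have [s cs se] := H10_dense Hv e0.
  have cts : C0infty Omega ((fun x => a * t x) + s).
    by apply: C0inftyD => //; exact: C0inftyZ.
  have := CP _ _ (H10_lin oO a Hu Hv) cts.
  rewrite with_grad_lin// bform_lin_test//.
  have := CP _ _ Hu ct; have := CP _ _ Hv cs.
  set x := bracket _ _ _ (a *: u + v); set xu := bracket _ _ _ u; set xv := bracket _ _ _ v.
  set bs := bform _ _ _ _; set bt := bform _ _ _ _ => h1 h2 h3.
  clearbody x xu xv bt bs.
  have h4 : H10norm Omega (a *: with_grad t + with_grad s - (a *: u + v)) <=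
      2 * (`|a| * e + e).
    have L1 : L2vec (grad t - u.2) by apply: L2vecB; [exact: L2vec_grad|exact: H10_L2vec].
    have L2 : L2vec (grad s - v.2) by apply: L2vecB; [exact: L2vec_grad|exact: H10_L2vec].
    have := vnorm_lin_le a L1 L2; rewrite scalerBr addrACA -opprD => h.
    apply: (le_trans h); rewrite ler_wpM2l// lerD//.
    by apply: ler_wpM2l; [exact: normr_ge0|exact: te].
  have -> : x - (a * xu + xv) = - (a * bt + bs - x) + (a * (bt - xu) + (bs - xv)) by ring.
  have g1 := le_trans h3 (ler_wpM2l C0 h4).
  have g2 : `|a * (bt - xu) + (bs - xv)| <= `|a| * (C * e) + C * e.
    rewrite (le_trans (ler_normD _ _))// lerD//.
      by rewrite normrM; apply: ler_wpM2l => //; exact: (le_trans h2 (ler_wpM2l C0 te)).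
    exact: (le_trans h1 (ler_wpM2l C0 se)).
  rewrite E (le_trans (ler_normD _ _))// normrN; exact: lerD.
(* Compared with the zero test function, the distance estimate becomes the bound on the
   functional. *)
have c0 : C0infty Omega (fun=> 0) by exact: C0infty0.
exists C => u Hu; have := CP _ _ Hu c0.
have g0 x : grad (fun=> 0 : R) x = 0 :> 'cV[R]_N.
  by apply/colP => i; rewrite !mxE partial_cst.
rewrite (_ : bform _ _ _ _ = 0); last first.
  by apply: Rintegral_eq0 => x _ /=; rewrite g0 /dot big1// => i _; rewrite mxE mul0r.
rewrite sub0r normrN => h; apply: (le_trans h); rewrite ler_wpM2l//.
rewrite (_ : H10norm _ _ = vnorm (- u.2)); first by rewrite vnormN//; exact: H10_L2vec.
apply: (congr1 (@Num.sqrt R)); apply: eq_Rintegral => x _.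
by rewrite -[(with_grad _ - u).2 x]/(grad _ x - u.2 x) g0 sub0r.
Qed.

End duality.

(** * From integrability exponents to bounds on all translates *)

Section regular_gradients.
Context (R : realType) (N : nat).
Local Notation rV := 'rV[R]_N.
Local Notation mu := (lebesgue_rV R N).
Implicit Types (a b f g : rV -> R).

Lemma ae_translate (P : rV -> Prop) (s : rV) :
  {ae mu, forall x, P x} -> {ae mu, forall x, P (x + s)}.
Proof.
move=> [A [mA A0 PA]]; exists ((fun x => x + s) @^-1` A); split.
- by rewrite -[X in measurable X]setTI; exact: measurable_shift_rV.
- by rewrite lebesgue_rV_shift.
- by move=> x /= nP; exact: PA.
Qed.

Lemma translation_bounded_weight_le a b f : measurable_fun setT a ->
  measurable_fun setT b -> {ae mu, forall x, `|a x| <= `|b x|} ->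
  translation_bounded b f -> translation_bounded a f.
Proof.
move=> ma mb ab [mf [C C0 fC]]; split=> //; exists C => // s.
apply: le_trans (fC s); have mfs := measurable_translate s mf.
apply: ae_ge0_le_integral => //.
- by move=> x _; rewrite lee_fin sqr_ge0.
- by apply: measurable_sqr_EFin; exact: measurable_funM.
- by move=> x _; rewrite lee_fin sqr_ge0.
- by apply: measurable_sqr_EFin; exact: measurable_funM.
- apply: filterS ab => x abx _; rewrite lee_fin !exprMn ler_wpM2r ?sqr_ge0//.
  by rewrite -(real_normK (num_real (a x))) -(real_normK (num_real (b x))) lerXn2r.
Qed.

Lemma translation_bounded_weightD a b f : measurable_fun setT a ->
  measurable_fun setT b -> translation_bounded a f -> translation_bounded b f ->
  translation_bounded (a + b) f.
Proof.
move=> ma mb [mf [C C0 aC]] [_ [D D0 bD]]; split=> //.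
exists (2 * C + 2 * D) => [|s]; first by rewrite addr_ge0// mulr_ge0.
have mfs := measurable_translate s mf.
rewrite (_ : (fun x => _) =
  (fun x => a x * f (x + s)) + (fun x => b x * f (x + s))); last first.
  by apply/funext => x; rewrite mulrDl.
have m1 : measurable_fun setT (fun x => a x * f (x + s)) by exact: measurable_funM.
have m2 : measurable_fun setT (fun x => b x * f (x + s)) by exact: measurable_funM.
apply: (le_trans (sqnD m1 m2)); rewrite [leRHS]EFinD
  [X in (_ <= X + _)%E]EFinM [X in (_ <= _ + X)%E]EFinM.
by apply: leeD; apply: lee_wpmul2l.
Qed.

Lemma translation_bounded_weight_sum (I : Type) (r : seq I) (a : I -> rV -> R) f :
  measurable_fun setT f -> (forall i, measurable_fun setT (a i)) ->
  (forall i, translation_bounded (a i) f) ->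
  translation_bounded (fun x => \sum_(i <- r) a i x) f.
Proof.
move=> mf ma af; elim: r => [|i r IH].
  split=> //; exists 0 => // s; rewrite /sqn integral0_eq// => x _.
  by rewrite big_nil mul0r expr0n.
rewrite (_ : (fun x => _) = a i + (fun x => \sum_(i <- r) a i x)); last first.
  by apply/funext => x; rewrite big_cons.
apply: translation_bounded_weightD => //.
exact: measurable_sum.
Qed.

Lemma translation_bounded_Loo a f : L2fun a -> f \in Lfun mu +oo%E ->
  translation_bounded a f.
Proof.
move=> [ma a2]; rewrite inE => /andP[/[!inE]/= mf foo]; split=> //.
have [M M0 fM] : exists2 M : R, 0 <= M & {ae mu, forall x, `|f x| <= M}.
  move: foo; rewrite /finite_norm unlock; case: ifPn => [_ foo|].
    have [M fM] : exists M, \forall x \ae mu, (Num.norm \o f) x <= M.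
      by apply: ess_supr_bounded; apply: le_lt_trans foo; apply: le_ess_sup; exact: aeW.
    exists `|M|; first exact: normr_ge0.
    by apply: filterS fM => x h; rewrite (le_trans h)// ler_norm.
  (* The norm is 0 by convention when the whole space is null; any bound then holds almost
     everywhere. *)
  rewrite -leNgt => T0 _; exists 0 => //; exists setT; split => //.
  by apply/eqP; rewrite eq_le T0 measure_ge0.
exists (M ^+ 2 * fine (sqn a)) => [|s].
  by rewrite mulr_ge0 ?sqr_ge0// fine_ge0// sqn_ge0.
rewrite EFinM fineK ?ge0_fin_numE ?sqn_ge0//.
rewrite -(sqnZ M ma); have mfs := measurable_translate s mf.
apply: ae_ge0_le_integral => //.
- by move=> x _; rewrite lee_fin sqr_ge0.
- by apply: measurable_sqr_EFin; exact: measurable_funM.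
- by move=> x _; rewrite lee_fin sqr_ge0.
- by apply: measurable_sqr_EFin; exact: measurable_funM.
- apply: filterS (ae_translate s fM) => x fx _; rewrite lee_fin mulrC !exprMn.
  rewrite ler_wpM2r ?sqr_ge0// -(real_normK (num_real (f _))).
  by rewrite lerXn2r ?nnegrE.
Qed.

(** The exponents [1 + 2 / g] and [1 + g / 2] are conjugate, and twice them are [2 + 4 / g] and
    [2 + g]. The factors in Young's inequality are at most 1 and are dropped. *)
Lemma young_sqr (x y g : R) : 0 < g ->
  (x * y) ^+ 2 <= `|x| `^ (2 + 4 / g) + `|y| `^ (2 + g).
Proof.
move=> g0; have p0 : 0 < 1 + 2 / g by rewrite addr_gt0// divr_gt0.
have q0 : 0 < 1 + g / 2 by rewrite addr_gt0// divr_gt0.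
have pq : (1 + 2 / g)^-1 + (1 + g / 2)^-1 = 1.
  have gn : g != 0 by rewrite gt_eqF.
  have g2 : g + 2 != 0 by rewrite gt_eqF// addr_gt0.
  have g3 : 2 + g != 0 by rewrite addrC.
  by field; rewrite ?gn ?g2 ?g3.
have E (z r t : R) : t = 2 * r -> (`|z| ^+ 2) `^ r = `|z| `^ t.
  by move=> ->; rewrite -powR_mulrn// -powRrM.
rewrite exprMn -(real_normK (num_real x)) -(real_normK (num_real y)).
have := conjugate_powR (sqr_ge0 `|x|) (sqr_ge0 `|y|) p0 q0 pq.
rewrite (E x _ (2 + 4 / g)); last by field; rewrite gt_eqF.
rewrite (E y _ (2 + g)); last by field.
move=> h; apply: (le_trans h); apply: lerD.
  by rewrite ler_piMr ?powR_ge0// invf_le1// lerDl divr_ge0// ltW.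
by rewrite ler_piMr ?powR_ge0// invf_le1// lerDl divr_ge0// ltW.
Qed.

(** The pointwise Young inequality bounds the square of the product by a sum of two separate terms;
    the one with [f] has a translation-invariant integral, so the bound does not depend on [s]. *)
Lemma translation_bounded_conjugate a f (g : R) : 0 < g ->
  a \in Lfun mu (2 + 4 / g)%:E -> f \in Lfun mu (2 + g)%:E ->
  translation_bounded a f.
Proof.
move=> g0 La Lf.
have g4 : 0 <= 4 / g by rewrite divr_ge0// ltW.
have ia := Lfun_integrable (ler_wpDr g4 (ler1n R 2)) La.
have jf := Lfun_integrable (ler_wpDr (ltW g0) (ler1n R 2)) Lf.
move: La; rewrite inE => /andP[/[!inE]/= ma _].
move: Lf; rewrite inE => /andP[/[!inE]/= mf _]; split => //.
have mpow (h : rV -> R) (r : R) : measurable_fun setT h ->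
    measurable_fun setT (fun x => (`|h x| `^ r)%:E).
  move=> mh; apply/measurable_EFinP.
  apply: (@measurableT_comp _ _ _ _ _ _ (fun t : R => t `^ r)).
    exact: measurable_powR.
  exact: measurableT_comp.
have [A EA] : exists A, A = (\int[mu]_x (`|a x| `^ (2 + 4 / g))%:E)%E by eexists.
have [B EB] : exists B, B = (\int[mu]_x (`|f x| `^ (2 + g))%:E)%E by eexists; reflexivity.
have A0 : (0 <= A)%E by rewrite EA; apply: integral_ge0 => x _; rewrite lee_fin powR_ge0.
have B0 : (0 <= B)%E by rewrite EB; apply: integral_ge0 => x _; rewrite lee_fin powR_ge0.
have fA : A \is a fin_num by rewrite EA; apply: integrable_fin_num.
have fB : B \is a fin_num by rewrite EB; apply: integrable_fin_num.
exists (fine A + fine B) => [|s]; first by rewrite addr_ge0// fine_ge0.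
rewrite EFinD !fineK//.
rewrite EB -(ge0_integral_shift_rV s (mpow f (2 + g) mf)); last first.
  by move=> x; rewrite lee_fin powR_ge0.
have mfs := measurable_translate s mf.
rewrite EA -ge0_integralD//; try exact: mpow.
- apply: ge0_le_integral => //.
  + by move=> x _; rewrite lee_fin sqr_ge0.
  + by apply: measurable_sqr_EFin; exact: measurable_funM.
  + by apply: emeasurable_funD; exact: mpow.
  + by move=> x _; rewrite -EFinD lee_fin; exact: young_sqr.
Qed.

End regular_gradients.

(** * Gradients that can be paired with an unbounded skew matrix *)

Section bracket_on_regular_gradients.
Context (R : realType) (N : nat).
Local Notation rV := 'rV[R]_N.
Local Notation mu := (lebesgue_rV R N).
Variable Omega : set rV.
Hypothesis oO : open Omega.
Implicit Types (v w z : rV -> 'cV[R]_N) (A K : rV -> 'M[R]_N)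
  (y psi : sobolev R N).

Let mO : measurable Omega. Proof. exact: open_measurable_rV. Qed.

Local Notation intg f := (mu.-integrable Omega (EFin \o f)).
Local Notation L2in := (L2in Omega).
Local Notation L2vec := (L2vec Omega).
Local Notation vnorm := (vnorm Omega).
Local Notation L2mx := (L2mx Omega).

(* What the integrability alternative in hypothesis (iii) is used for: products
   of entries of K with all translates of v are bounded in L^2. *)
Definition regular K v := forall i j l, translation_bounded
  ((fun x => K x i j) \_ Omega) ((fun x => v x l 0) \_ Omega).

Lemma L2mx_restrict A i j : L2mx A ->
  measurable_fun setT ((fun x => A x i j) \_ Omega).
Proof. by move=> LA; have [] := LA i j. Qed.

Lemma regular_of_Lp A v (g : \bar R) : L2mx A -> (0 < g)%E ->
  Lp_vec Omega +oo%E v \/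
    Lp_mx Omega (2%:E + 4%:E / g)%E A /\ Lp_vec Omega (2%:E + g)%E v ->
  regular A v.
Proof.
move=> LA g0 H i j l.
have [voo|] := pselect (Lp_vec Omega +oo%E v).
  by apply: translation_bounded_Loo; [exact: LA|exact: voo].
move=> nv; case: H => // -[Ap vq]; case: g g0 Ap vq => [r|_|//].
- rewrite lte_fin => r0 Ap vq; apply: (@translation_bounded_conjugate _ _ _ _ r) => //.
    by have := Ap i j; rewrite /Lp/= inver gt_eqF.
  exact: vq.
(* For an infinite exponent, [2 + g] is infinite too, which falls back on the first alternative. *)
- by move=> _ vq; case: nv; move: vq; rewrite addey.
Qed.

Lemma regularB K v w : L2mx K -> regular K v -> regular K w -> regular K (v - w).
Proof.
move=> LK rv rw i j l.
have mK := L2mx_restrict i j LK.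
rewrite [X in translation_bounded _ X](_ : _ = (fun x => v x l 0) \_ Omega +
    (fun x => - ((fun x => w x l 0) \_ Omega) x)); last first.
  apply/funext => x; rewrite -[RHS]/(_ + _) !patchE.
  by case: ifP => _; [rewrite !mxE|rewrite subrr].
apply: translation_boundedD => //.
have [mw _] := rw i j l.
apply: (translation_bounded_le mK _ _ (rw i j l)); first exact: measurable_funN.
by move=> x; rewrite normrN.
Qed.

(** The comparison [preceq] concerns the entries above the diagonal only; skew-symmetry reflects it
    below the diagonal and makes the diagonal of [K] zero. *)
Lemma regular_preceq K A v : L2mx K -> L2mx A ->
  (forall x, (K x)^T = - K x) -> ae_in Omega (fun x => (A x)^T = - A x) ->
  preceq Omega K A -> regular A v -> regular K v.
Proof.
move=> LK LA sK sA KA rA i j l.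
apply: (translation_bounded_weight_le _ _ _ (rA i j l)); try exact: L2mx_restrict.
have K0 x : K x i i = 0.
  by have /matrixP/(_ i i) := sK x; rewrite !mxE => /esym/eqP; rewrite eqNr => /eqP.
have [ij|ji|ij] := ltngtP i j.
- have := KA _ _ ij; rewrite /ae_in; apply: filterS => x h; rewrite !patchE.
  by case: ifPn => // /set_mem.
- have h1 := KA _ _ ji; rewrite /ae_in in sA h1.
  apply: filterS2 h1 sA => x h s; rewrite !patchE.
  case: ifPn => // /set_mem Ox; have /matrixP/(_ i j) := s Ox.
  have /matrixP/(_ i j) := sK x; rewrite !mxE => Kji Aji.
  by rewrite -normrN -Kji -[leRHS]normrN -Aji; exact: h.
- have {ij} -> : j = i by exact: val_inj.
  apply: aeW => x; rewrite !patchE; case: ifPn => // _.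
  by rewrite K0 normr0.
Qed.

Lemma regular_L2in K v i j l : regular K v -> L2mx K ->
  L2in (fun x => K x i j * v x l 0).
Proof.
move=> rKv LK; have [mv [C C0 /(_ 0) vC]] := rKv i j l; have mK := L2mx_restrict i j LK.
rewrite -[L2in _]/(L2fun _) (_ : _ \_ _ =
    (fun x => ((fun x => K x i j) \_ Omega) x * ((fun x => v x l 0) \_ Omega) x)); last first.
  by apply/funext => x; rewrite !patchE; case: ifP => _ //; rewrite mulr0.
split; first exact: measurable_funM.
apply: le_lt_trans (ltry C); apply: le_trans vC; rewrite le_eqVlt; apply/orP; left.
by apply/eqP; apply: eq_integral => x _; rewrite addr0.
Qed.

Lemma regular_L2vec K v : regular K v -> L2mx K -> L2vec (fun x => K x *m v x).
Proof.
move=> rKv LK i; under eq_fun do rewrite mxE.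
by apply: L2in_sum => j; exact: regular_L2in.
Qed.

(** Skew-symmetry moves [K] from [w], where the product is merely integrable, onto the regular [v],
    where it is in L^2. *)
Lemma regular_dot_integrable K v w : (forall x, (K x)^T = - K x) ->
  regular K v -> L2mx K -> L2vec w -> dot_integrable Omega v (fun x => K x *m w x).
Proof.
move=> sK rKv LK Lw; rewrite /dot_integrable.
rewrite (_ : EFin \o _ = EFin \o (fun x => dot (w x) (- (K x *m v x)))); last first.
  by apply/funext => x /=; rewrite dot_skew// dotNr.
apply: integrable_dot => // i.
under eq_fun do rewrite mxE; apply: L2inN; exact: regular_L2vec.
Qed.

Lemma dot_integral_le v z (g : 'I_N -> rV -> R) (e : R) :
  dot_integrable Omega v z -> (forall i, measurable_fun setT (g i)) ->
  (forall i, measurable_fun setT ((fun x => z x i 0) \_ Omega)) ->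
  (forall i x, Omega x -> v x i 0 = g i x) ->
  (forall i, \int[mu]_x `|g i x * ((fun x => z x i 0) \_ Omega) x|%:E <= e%:E)%E ->
  `|dot_integral Omega v z| <= N%:R * e.
Proof.
move=> ivz mg mz vg H; apply: (le_trans (le_normr_Rintegral mO ivz)).
rewrite -lee_fin /Rintegral fineK; last first.
  by apply: integrable_fin_num => //; exact: (integrable_abse ivz).
apply: (@le_trans _ _ (\int[mu]_x (\sum_i `|g i x * ((fun x => z x i 0) \_ Omega) x|%:E))%E).
  rewrite integral_mkcond; apply: ge0_le_integral => //.
  - move=> x _; rewrite patchE; case: ifP => _; [by rewrite /= lee_fin|exact: lexx].
  - apply/(measurable_restrictT _ mO).
    by have /integrableP[+ _] := integrable_abse ivz.
  - apply: emeasurable_sum => i; apply/measurable_EFinP.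
    by apply: measurableT_comp => //; exact: measurable_funM.
  - move=> x _; rewrite patchE sumEFin; case: ifPn => [/set_mem Ox|_].
      rewrite lee_fin (le_trans (ler_norm_sum _ _ _))//.
      by apply: ler_sum => i _; rewrite vg// patchE mem_set.
    by rewrite lee_fin sumr_ge0.
rewrite ge0_integral_sum//; last first.
  move=> i; apply/measurable_EFinP.
  by apply: measurableT_comp => //; exact: measurable_funM.
apply: (@le_trans _ _ (\sum_(i < N) e%:E)%E); first by apply: lee_sum => i _; exact: H.
by rewrite sumEFin lee_fin sumr_const card_ord mulr_natl.
Qed.

End bracket_on_regular_gradients.

Section bracket_regular.
Context (R : realType) (N : nat).
Local Notation rV := 'rV[R]_N.
Local Notation mu := (lebesgue_rV R N).
Variable Omega : set rV.
Hypothesis oO : open Omega.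
Hypothesis bO : bounded_set Omega.
Hypothesis lO : lipschitz_boundary Omega.
Implicit Types (v w z : rV -> 'cV[R]_N) (A K : rV -> 'M[R]_N)
  (y psi : sobolev R N).

Let mO : measurable Omega. Proof. exact: open_measurable_rV. Qed.

Local Notation L2in := (L2in Omega).
Local Notation L2vec := (L2vec Omega).
Local Notation L2mx := (L2mx Omega).

Lemma L2fun_abs (f : rV -> R) : L2fun f -> L2fun (fun x => `|f x|).
Proof.
move=> [mf f2]; split; first exact: measurableT_comp.
apply: le_lt_trans f2; rewrite le_eqVlt; apply/orP; left; apply/eqP.
by apply: eq_integral => x _; rewrite real_normK// num_real.
Qed.

(** The density result is stated for scalar weights; here it is applied to the extensions by zero of
    the components of [K] and of the two gradients. *)
Lemma regular_test_dist (i0 : 'I_N) K y psi (e : R) : L2mx K ->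
  (forall x, (K x)^T = - K x) -> H10 Omega y -> H10 Omega psi ->
  regular Omega K psi.2 -> 0 < e ->
  exists phi, [/\ C0infty Omega phi,
    H10norm Omega (with_grad phi - psi) <= N%:R * e &
    `|dot_integral Omega (grad phi - psi.2) (fun x => K x *m y.2 x)| <= N%:R * e].
Proof.
move=> LK sK Hy Hpsi rpsi e0.
have Ly := H10_L2vec Hy; have Lpsi := H10_L2vec Hpsi.
pose k i j := (fun x => K x i j) \_ Omega.
pose yr j := (fun x => y.2 x j 0) \_ Omega.
pose g i := (fun x => psi.2 x i 0) \_ Omega.
pose z x := K x *m y.2 x.
pose F i := (fun x => z x i 0) \_ Omega.
(* One scalar weight dominating all entries of [K], and one L^2 function dominating all components
   of the gradient of [y], so that [F i] is at most their product. *)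
pose a x := \sum_i \sum_j `|k i j x|.
pose w x := \sum_j `|yr j x|.
have mk i j : measurable_fun setT (k i j) by exact: L2mx_restrict.
have mnk i j : measurable_fun setT (fun x => `|k i j x|) by exact: measurableT_comp.
have ma : measurable_fun setT a.
  by apply: measurable_sum => i; exact: measurable_sum.
have mg i : measurable_fun setT (g i) by have [] := Lpsi i.
have w2 : L2fun w.
  rewrite (_ : w = (fun x => \sum_j `|yr j x|) \_ Omega).
    apply: (@L2in_sum _ _ Omega _ _ (fun j x => `|yr j x|)) => j.
    suff : L2fun ((fun x => `|yr j x|) \_ Omega) by [].
    rewrite (_ : _ \_ _ = fun x => `|yr j x|); first by apply: L2fun_abs; exact: Ly.
    apply/funext => x; rewrite patchE; case: ifPn => // nx.
    by rewrite /yr patchE (negbTE nx) normr0.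
  apply/funext => x; rewrite /w patchE; case: ifPn => // nx.
  by apply: big1 => j _; rewrite /yr patchE (negbTE nx) normr0.
have FE i : F i = fun x => \sum_j k i j x * yr j x.
  apply/funext => x; rewrite /F /z /k /yr patchE; case: ifPn => [xO|nx].
    by rewrite mxE; apply: eq_bigr => j _; rewrite !patchE xO.
  by rewrite big1// => j _; rewrite !patchE (negbTE nx) mul0r.
have myr j : measurable_fun setT (yr j) by have [] := Ly j.
have mF i : measurable_fun setT (F i).
  rewrite FE; apply: measurable_sum => j; apply: measurable_funM => //.
have Faw i x : `|F i x| <= `|a x| * `|w x|.
  have w0 : 0 <= w x by apply: sumr_ge0.
  have a0 : 0 <= a x by apply: sumr_ge0 => ? _; apply: sumr_ge0.
  rewrite FE (ger0_norm a0) (ger0_norm w0) (le_trans (ler_norm_sum _ _ _))//.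
  rewrite /w mulr_sumr; apply: ler_sum => j _; rewrite normrM ler_wpM2r//.
  rewrite /a (bigD1 i)//= (bigD1 j)//= -addrA lerDl addr_ge0// sumr_ge0// => l _.
  exact: sumr_ge0.
have F1 i : (\int[mu]_x `|F i x|%:E < +oo)%E.
  have : mu.-integrable Omega (EFin \o (fun x => z x i 0)).
    rewrite (_ : EFin \o _ = (fun x => \sum_j (K x i j * y.2 x j 0)%:E)%E).
      by apply: integrable_sum => // j _; apply: integrable_L2inM.
    by apply/funext => x /=; rewrite mxE sumEFin.
  move=> /(integrable_mkcond _ mO)/integrableP[_]; apply: le_lt_trans.
  rewrite le_eqVlt; apply/orP; left; apply/eqP; apply: eq_integral => x _.
  by rewrite /F !patchE; case: ifP => _ //=; rewrite normr0.
have tb i : translation_bounded a (g i).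
  apply: translation_bounded_weight_sum => // j; first exact: measurable_sum.
  apply: translation_bounded_weight_sum => // l.
  have h1 : {ae mu, forall x, `| `|k j l x| | <= `|k j l x|}.
    by apply: aeW => x; rewrite normr_id.
  exact: (translation_bounded_weight_le (mnk j l) (mk j l) h1 (rpsi j l i)).
have van x : ~ Omega x -> (psi.1 \_ Omega) x = 0 /\ forall i, g i x = 0.
  by move=> nx; split=> [|i]; rewrite /g patchE memNset.
(* The density result bounds squared L^2 norms, which must be at most [e ^ 2], and L^1 norms, which
   must be at most [e]. *)
pose d := Num.min e (e ^+ 2).
have d0 : 0 < d by rewrite lt_min e0 exprn_gt0.
have [phi cp H] := sobolev_test_approximable oO bO lO ma w2 mF Faw F1 i0
  (H10_sobolev_pair oO Hpsi) tb van d0.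
have Lp := L2vec_grad cp; have Ld : L2vec (grad phi - psi.2) by exact: L2vecB.
have vE i x : Omega x -> (grad phi - psi.2) x i 0 = partial i phi x - g i x.
  by move=> /mem_set xO; rewrite /g patchE xO !mxE.
exists phi; split => //.
- rewrite -[H10norm _ _]/(vnorm Omega (grad phi - psi.2)).
  rewrite -(@ler_sqr R) ?nnegrE ?vnorm_ge0 ?mulr_ge0 ?(ltW e0)// sqr_vnorm//.
  apply: (@le_trans _ _ (\sum_(i < N) e ^+ 2)).
    apply: ler_sum => i _; rewrite -lee_fin [leLHS]sqr_L2norm; last exact: Ld.
    have [h _] := H i; apply: (@le_trans _ _ d%:E); last by rewrite lee_fin ge_min lexx orbT.
    have m2 : measurable_fun setT (partial i phi - g i).
      apply: measurable_funB => //; apply: smooth_measurable.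
      exact: (C0infty_smooth (C0infty_partial i cp)).
    apply: le_trans h; apply: (le_sqn (Ld i).1 m2) => x.
    rewrite -[(partial i phi - g i) x]/(partial i phi x - g i x) patchE.
    by case: ifPn => [/set_mem/vE ->//|_]; rewrite normr0.
  rewrite sumr_const card_ord exprMn -[leLHS]mulr_natl; apply: ler_wpM2r; first exact: sqr_ge0.
  have nn (n : nat) : (n <= n ^ 2)%N by case: n => // n; rewrite leq_pmulr.
  by rewrite -natrX ler_nat nn.
- apply: (@dot_integral_le _ _ _ oO _ _ (fun i x => partial i phi x - g i x)) => //.
  + have i1 := regular_dot_integrable oO sK rpsi LK Ly.
    have i2 := dot_integrable_grad oO cp LK Ly.
    have := integrableB mO i2 i1; congr (mu.-integrable _ _).
    apply/funext => x.
    rewrite -[LHS]/((dot (grad phi x) (z x))%:E - (dot (psi.2 x) (z x))%:E)%E -EFinB.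
    rewrite -[RHS]/(dot (grad phi x - psi.2 x) (z x))%:E; congr EFin.
    by rewrite -[- psi.2 x]scaleN1r dotDl dotZl mulN1r.
  + move=> i; apply: measurable_funB => //; apply: smooth_measurable.
    exact: (C0infty_smooth (C0infty_partial i cp)).
  + move=> i; have [_ h] := H i; apply: (le_trans h).
    by rewrite lee_fin ge_min lexx.
Qed.

(** A single test function [phi] is compared with both sides: with the bracket by its continuity in
    H^1_0, with the integral by convergence against the skew product. *)
Lemma bracket_regular (i0 : 'I_N) A y psi : L2mx A -> Dom Omega A y ->
  H10 Omega psi -> regular Omega (skew_part A) psi.2 ->
  bracket Omega A y psi = bform Omega (skew_part A) psi y.
Proof.
move=> LA Dy Hpsi rpsi; have LK := L2mx_skew LA; have Hy := Dy.1.
have Ly := H10_L2vec Hy; have sK := skew_part_tr A.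
have [C C0 CP] := bracket_dist oO LA Dy.
apply: (@eq_of_le_eps _ _ _ (C * N%:R + N%:R)) => e e0.
have [phi [cp h1 h2]] := regular_test_dist i0 LK sK Hy Hpsi rpsi e0.
pose z x := skew_part A x *m y.2 x.
have E : dot_integral Omega (grad phi - psi.2) z =
    bform Omega (skew_part A) (with_grad phi) y - bform Omega (skew_part A) psi y.
  have i1 := dot_integrableC (regular_dot_integrable oO sK rpsi LK Ly).
  have i2 := dot_integrableC (dot_integrable_grad oO cp LK Ly).
  have := dot_integral_linr oO (-1) i1 i2.
  rewrite scaleN1r addrC [in RHS]addrC mulN1r dot_integralC => ->.
  by congr (_ - _); exact: dot_integralC.
rewrite -/z E in h2.
have h3 := le_trans (CP _ _ Hpsi cp) (ler_wpM2l C0 h1).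
move: (bracket _ _ _ _) (bform _ _ (with_grad _) _) (bform _ _ psi _) h2 h3.
move=> b p q h2 h3; rewrite distrC in h3.
rewrite (_ : b - q = (b - p) + (p - q)); last by rewrite addrA subrK.
by rewrite (le_trans (ler_normD _ _))// mulrDl -mulrA; exact: lerD.
Qed.

End bracket_regular.

(** * Admissible coefficients and their forms *)

Section admissible_coefficients.
Context (R : realType) (N : nat).
Local Notation rV := 'rV[R]_N.
Local Notation mu := (lebesgue_rV R N).
Variable Omega : set rV.
Hypothesis oO : open Omega.
Hypothesis bO : bounded_set Omega.
Implicit Types (f g : rV -> R) (A B Astar : rV -> 'M[R]_N)
  (Q : set (rV -> 'M[R]_N)).

Let mO : measurable Omega. Proof. exact: open_measurable_rV. Qed.

Local Notation intg f := (mu.-integrable Omega (EFin \o f)).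
Local Notation L2in := (L2in Omega).
Local Notation L2mx := (L2mx Omega).

Lemma ae_in2 (P P' P'' : rV -> Prop) : (forall x, P x -> P' x -> P'' x) ->
  ae_in Omega P -> ae_in Omega P' -> ae_in Omega P''.
Proof.
rewrite /ae_in => H; apply: filterS2 => x h h' Ox.
by apply: H; [exact: h|exact: h'].
Qed.

Lemma ae_le_Rintegral f g : intg f -> intg g -> ae_in Omega (fun x => f x <= g x) ->
  \int[mu]_(x in Omega) f x <= \int[mu]_(x in Omega) g x.
Proof.
move=> fi gi fg.
rewrite -subr_ge0 -RintegralB//.
have gfi : mu.-integrable Omega (EFin \o (fun x => g x - f x)).
  by have := integrableB mO gi fi.
rewrite /Rintegral (@ae_eq_integral _ _ _ _ _ (fun x => `|(g x - f x)%:E|%E))//.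
- by apply: fine_ge0; apply: integral_ge0 => x _; exact: abse_ge0.
- by have /integrableP[] := gfi.
- by have /integrableP[m _] := gfi; exact: (measurableT_comp _ m).
- rewrite /ae_in in fg; apply: filterS fg => x h Ox.
  by rewrite gee0_abs// lee_fin subr_ge0 h.
Qed.

Lemma L2in_bounded f (K : R) : measurable_fun Omega f -> (forall x, `|f x| <= K) ->
  L2in f.
Proof.
move=> mf fK; have L1 : L2in (fun=> 1).
  apply/(L2inP oO); split; first exact: measurable_cst.
  under eq_integral do rewrite expr1n.
  by rewrite integral_cst// mul1e; exact: bounded_lebesgue_rV_fin.
apply: (L2in_le oO (g := fun=> 1) (M := K) mf L1 _).1.
by apply: aeW => x _; rewrite normr1 mulr1.
Qed.

Lemma L2in_divergence (phi : rV -> 'cV[R]_N) : C01_vec Omega phi ->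
  L2in (divergence phi).
Proof.
move=> [C1phi [/compact_bounded[M [_ MP]] _]].
have bphi i : bounded_support (fun x => phi x i 0).
  exists (`|M| + 1) => x xM; suff -> : phi x = 0 by rewrite mxE.
  apply/eqP; apply: contraTT xM => px; rewrite -leNgt.
  apply: (MP (`|M| + 1)); first by rewrite (le_lt_trans (ler_norm M))// ltrDl.
  apply: subset_closure => /=.
  apply/eqP => e; move/eqP: px; apply.
  apply/matrixP => k l; rewrite mxE; exact: (congr1 (fun h => h k l) e).
rewrite /divergence; apply: L2in_sum => i; have [_ /(_ i) ci] := C1phi i.
have [K _ pK] := bounded_support_bounded ci (bounded_support_partial i (bphi i)).
apply: (@L2in_bounded _ K) => //.
by apply: measurable_funTS; exact: continuous_measurable_rV.
Qed.

(** For each test field the integral is linear, so the bound passes to convex combinations before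
    the supremum is taken. The divergence is in L^2, which makes the integrals additive. *)
Lemma TV_le_lin f g h (c s t : R) : 0 <= s -> 0 <= t -> s + t = 1 ->
  L2in f -> L2in g -> ae_in Omega (fun x => h x = s * f x + t * g x) ->
  measurable_fun Omega h ->
  (TV Omega f <= c%:E)%E -> (TV Omega g <= c%:E)%E -> (TV Omega h <= c%:E)%E.
Proof.
move=> s0 t0 st Lf Lg hE mh /ereal_supP TVf /ereal_supP TVg.
apply: ub_ereal_sup => _ /= [phi Hphi <-].
have Ld := L2in_divergence Hphi.1.
have fc : \int[mu]_(x in Omega) (f x * divergence phi x) <= c.
  by rewrite -lee_fin; apply: TVf; exists phi.
have gc : \int[mu]_(x in Omega) (g x * divergence phi x) <= c.
  by rewrite -lee_fin; apply: TVg; exists phi.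
have i1 := integrable_L2inM oO Lf Ld; have i2 := integrable_L2inM oO Lg Ld.
rewrite lee_fin (_ : \int[mu]_(x in Omega) _ =
    s * (\int[mu]_(x in Omega) (f x * divergence phi x)) +
    t * (\int[mu]_(x in Omega) (g x * divergence phi x))).
  have -> : c = s * c + t * c by rewrite -mulrDl st mul1r.
  by apply: lerD; apply: ler_wpM2l.
have j1 := integrableZl mO s i1; have j2 := integrableZl mO t i2.
rewrite -!RintegralZl// -RintegralD//; rewrite /Rintegral; congr fine.
have md := L2in_measurable oO Ld.
have mf := L2in_measurable oO Lf; have mg := L2in_measurable oO Lg.
apply: ae_eq_integral => //.
- by apply/measurable_EFinP; exact: measurable_funM.
- apply/measurable_EFinP; apply: measurable_funD; apply: measurable_funM => //;
  exact: measurable_funM.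
- rewrite /ae_in in hE; apply: filterS hE => x E Ox.
  by rewrite (E Ox) mulrDl !mulrA.
Qed.

(** Every constraint is convex, so the whole segment [A_theta] is admissible and hypothesis (i) can
    be used along it. *)
Lemma Aad_convex (al be c : R) Astar Q A B (t : R) : admissible_Q Omega Q ->
  Aad Omega al be c Astar Q A -> Aad Omega al be c Astar Q B -> 0 <= t <= 1 ->
  Aad Omega al be c Astar Q (A + t *: (B - A)).
Proof.
move=> [_ _ cQ _ _] [LA [[SA sA] eA TA] [QA pA]] [LB [[SB sB] eB TB] [QB pB]].
move=> /andP[t0 t1].
have s0 : 0 <= 1 - t by rewrite subr_ge0.
have symE x : sym_part (A + t *: (B - A)) x =
    (1 - t) *: sym_part A x + t *: sym_part B x.
  by apply/matrixP => i j; rewrite !mxE; ring.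
have skewE x : skew_part (A + t *: (B - A)) x =
    (1 - t) *: skew_part A x + t *: skew_part B x.
  by apply/matrixP => i j; rewrite !mxE; ring.
have LA2 := (Lp_mx2P _ _).1 LA; have LB2 := (Lp_mx2P _ _).1 LB.
have LSA := L2mx_sym LA2; have LSB := L2mx_sym LB2.
have Lpl (p : \bar R) (F G H : rV -> 'M[R]_N) : (1 <= p)%E ->
    Lp_mx Omega p F -> Lp_mx Omega p G ->
    (forall x, H x = (1 - t) *: F x + t *: G x) -> Lp_mx Omega p H.
  move=> p1 LF LG HE i j.
  have L0 : Lp Omega p (fun=> 0).
    have := Lp_lin (-1) p1 (LF i j) (LF i j).
    by congr (Lp _ _ _); apply/funext => x; ring.
  have L1 := Lp_lin (1 - t) p1 (LF i j) L0.
  have := Lp_lin t p1 (LG i j) L1; congr (Lp _ _ _); apply/funext => x.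
  by rewrite HE !mxE; ring.
split.
- apply: (Lpl _ A B) => //; first by rewrite lee_fin ler1n.
  by move=> x; apply/matrixP => i j; rewrite !mxE; ring.
- split; first split.
  + by apply: (Lpl _ (sym_part A) (sym_part B)) => //; rewrite leey.
  + by apply: aeW => x _; exact: sym_part_tr.
  + apply: (ae_in2 _ eA eB) => x ha hb xi; rewrite symE.
    have -> : dot xi (((1 - t) *: sym_part A x + t *: sym_part B x) *m xi) =
        (1 - t) * dot xi (sym_part A x *m xi) + t * dot xi (sym_part B x *m xi).
      by rewrite mulmxDl -!scalemxAl dotDr !dotZr.
    have /andP[a1 a2] := ha xi; have /andP[b1 b2] := hb xi.
    move: (dot xi xi) (dot xi (_ *m _)) (dot xi (_ *m _)) a1 a2 b1 b2 => d p q a1 a2 b1 b2.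
    have -> : al * d = (1 - t) * (al * d) + t * (al * d) by ring.
    have -> : be * d = (1 - t) * (be * d) + t * (be * d) by ring.
    by apply/andP; split; apply: lerD; apply: ler_wpM2l.
  + move=> i j ij; apply: (@TV_le_lin _ _ _ _ (1 - t) t _ _ _ (LSA i j) (LSB i j)) => //.
    * by rewrite subrK.
    * by apply: aeW => x _; rewrite symE !mxE.
    * rewrite (_ : (fun x => _) = fun x => (1 - t) * sym_part A x i j + t * sym_part B x i j).
        by apply: measurable_funD; apply: measurable_funM => //; exact: (L2in_measurable oO).
      by apply/funext => x; rewrite symE !mxE.
    * exact: TA.
    * exact: TB.
- split.
  + pose l : {i01 R} := Itv01 t0 t1.
    have := cQ (skew_part B) (skew_part A) l (mem_set QB) (mem_set QA).
    rewrite inE; congr Q; apply/funext => x; rewrite skewE addrC.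
    by [].
  + move=> i j ij; apply: (ae_in2 _ (pA _ _ ij) (pB _ _ ij)) => x ha hb.
    rewrite skewE; move: (skew_part A x) (skew_part B x) ha hb => k m ha hb.
    rewrite !mxE (le_trans (ler_normD _ _))// !normrM (ger0_norm t0) (ger0_norm s0).
    have -> : `|Astar x i j| = (1 - t) * `|Astar x i j| + t * `|Astar x i j| by ring.
    by apply: lerD; apply: ler_wpM2l.
Qed.

End admissible_coefficients.

Section elliptic_forms.
Context (R : realType) (N : nat).
Local Notation rV := 'rV[R]_N.
Local Notation mu := (lebesgue_rV R N).
Variable Omega : set rV.
Hypothesis oO : open Omega.
Implicit Types (v w z : rV -> 'cV[R]_N) (A B C : rV -> 'M[R]_N)
  (u y phi : sobolev R N) (f : sobolev R N -> R).

Let mO : measurable Omega. Proof. exact: open_measurable_rV. Qed.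

Local Notation L2vec := (L2vec Omega).
Local Notation L2mx := (L2mx Omega).
Local Notation vnorm := (vnorm Omega).

Definition sym_form A v w := dot_integral Omega v (fun x => sym_part A x *m w x).

Definition skew_form A v w := dot_integral Omega v (fun x => skew_part A x *m w x).

Lemma dot_integrable_lin (a : R) v w z : dot_integrable Omega w v ->
  dot_integrable Omega w z -> dot_integrable Omega w (a *: v + z).
Proof.
move=> iv iz; have := integrableD mO (integrableZl mO a iv) iz.
rewrite /dot_integrable; congr (mu.-integrable _ _); apply/funext => x.
rewrite -[LHS]/(a%:E * (dot (w x) (v x))%:E + (dot (w x) (z x))%:E)%E.
by rewrite -EFinM -EFinD -dotZr -dotDr.
Qed.

Lemma skew_formN A v w : dot_integrable Omega v (fun x => skew_part A x *m w x) ->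
  skew_form A w v = - skew_form A v w.
Proof.
move=> ivw; rewrite -mulN1r /skew_form /dot_integral -RintegralZl//.
by apply: eq_Rintegral => x _; rewrite mulN1r (dot_skew _ _ (skew_part_tr A _)).
Qed.

Lemma sym_formC A v w : sym_form A v w = sym_form A w v.
Proof.
apply: eq_Rintegral => x _.
by rewrite -{1}(sym_part_tr A x) dot_trmx.
Qed.

Section ellipticity.
Variables al be : R.
Hypothesis al0 : 0 < al.
Hypothesis be0 : 0 <= be.

(** The upper bound is recorded entrywise, the form in which it bounds the matrix as an operator on
    L^2 fields. *)
Definition elliptic A := [/\ L2mx A,
  ae_in Omega (fun x => forall i j, `|sym_part A x i j| <= be) &
  ae_in Omega (fun x => forall xi, al * dot xi xi <= dot xi (sym_part A x *m xi))].

Lemma elliptic_mulmx A v : elliptic A -> L2vec v ->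
  L2vec (fun x => sym_part A x *m v x) /\
  vnorm (fun x => sym_part A x *m v x) <= N%:R * (N%:R * be) * vnorm v.
Proof.
move=> [LA bA _] Lv; apply: L2vec_mulmx_bounded => //.
by move=> i j; apply: (L2in_measurable oO); exact: L2mx_sym.
Qed.

Lemma sym_form_integrable A v w : elliptic A -> L2vec v -> L2vec w ->
  dot_integrable Omega v (fun x => sym_part A x *m w x).
Proof.
by move=> eA Lv Lw; apply: integrable_dot => //; have [] := elliptic_mulmx eA Lw.
Qed.

Lemma sym_form_linr A (a : R) v w z : elliptic A -> L2vec v -> L2vec w -> L2vec z ->
  sym_form A v (a *: w + z) = a * sym_form A v w + sym_form A v z.
Proof.
move=> eA Lv Lw Lz.
rewrite -(dot_integral_linr oO a (sym_form_integrable eA Lv Lw) (sym_form_integrable eA Lv Lz)).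
apply: eq_Rintegral => x _.
rewrite -[LHS]/(dot (v x) (sym_part A x *m (a *: w x + z x))).
by rewrite mulmxDr -scalemxAr.
Qed.

Lemma sym_formD A v w z : elliptic A -> L2vec v -> L2vec w -> L2vec z ->
  sym_form A v (w + z) = sym_form A v w + sym_form A v z.
Proof.
by move=> eA Lv Lw Lz; rewrite -[w]scale1r sym_form_linr// scale1r mul1r.
Qed.

Lemma sym_form_combination A B C (t : R) v w : elliptic A -> elliptic B ->
  (forall x, sym_part C x = (1 - t) *: sym_part A x + t *: sym_part B x) ->
  L2vec v -> L2vec w ->
  sym_form C v w = sym_form A v w + t * (sym_form B v w - sym_form A v w).
Proof.
move=> eA eB CE Lv Lw.
have iA := sym_form_integrable eA Lv Lw; have iB := sym_form_integrable eB Lv Lw.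
have iD := dot_integrable_lin (-1) iA iB.
have E : sym_form B v w - sym_form A v w = dot_integral Omega v
    (-1 *: (fun x => sym_part A x *m w x) + (fun x => sym_part B x *m w x)).
  by rewrite (dot_integral_linr oO (-1) iA iB) mulN1r addrC.
rewrite E [RHS]addrC -(dot_integral_linr oO t iD iA); apply: eq_Rintegral => x _.
rewrite CE -[RHS]/(dot (v x) (t *: (-1 *: (sym_part A x *m w x) +
  sym_part B x *m w x) + sym_part A x *m w x)); congr dot.
by rewrite mulmxDl -!scalemxAl; apply/colP => i; rewrite !mxE; ring.
Qed.

Lemma sym_form_le A v w : elliptic A -> L2vec v -> L2vec w ->
  `|sym_form A v w| <= N%:R * (N%:R * (N%:R * be)) * (vnorm v * vnorm w).
Proof.
move=> eA Lv Lw; have [LS Sw] := elliptic_mulmx eA Lw.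
apply: (le_trans (vnorm_cauchy_schwarz oO Lv LS)).
rewrite -mulrA ler_wpM2l// mulrCA ler_wpM2l ?vnorm_ge0//.
Qed.

Lemma sym_form_ge A v : elliptic A -> L2vec v ->
  al * vnorm v ^+ 2 <= sym_form A v v.
Proof.
move=> eA Lv; have iS := sym_form_integrable eA Lv Lv.
have [_ _ ge] := eA; have ivv := integrable_dot oO Lv Lv.
rewrite /vnorm sqr_sqrtr; last by apply: Rintegral_ge0 => x _; exact: sqr_ge0.
under eq_Rintegral do rewrite sqr_enorm.
rewrite -RintegralZl//; apply: ae_le_Rintegral => //.
  by have := integrableZl mO al ivv.
by rewrite /ae_in in ge *; apply: filterS ge => x h Ox; exact: h.
Qed.

Lemma Dom_lin A (a : R) u y : L2mx A -> Dom Omega A u -> Dom Omega A y ->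
  Dom Omega A (a *: u + y).
Proof.
move=> LA [Hu [c cP]] [Hy [d dP]]; split; first exact: H10_lin.
exists (`|a| * c + d) => g cg; have LK := L2mx_skew LA.
rewrite (bform_linr oO a cg LK (H10_L2vec Hu) (H10_L2vec Hy)).
rewrite (le_trans (ler_normD _ _))// mulrDl normrM -mulrA.
by apply: lerD; [apply: ler_wpM2l; [|exact: cP]|exact: dP].
Qed.

Lemma bracket_linr A (a : R) u y phi : L2mx A -> Dom Omega A u -> Dom Omega A y ->
  H10 Omega phi ->
  bracket Omega A (a *: u + y) phi = a * bracket Omega A u phi + bracket Omega A y phi.
Proof.
move=> LA Du Dy Hphi; have DL := Dom_lin a LA Du Dy.
apply: (Hm1_ext oO (Hm1_bracket oO LA DL)
  (Hm1_lin a (Hm1_bracket oO LA Du) (Hm1_bracket oO LA Dy)) _ Hphi).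
move=> g cg; rewrite !(bracket_test oO)//.
by rewrite (bform_linr oO a cg (L2mx_skew LA) (H10_L2vec Du.1) (H10_L2vec Dy.1)).
Qed.

Lemma bracketD A u y phi : L2mx A -> Dom Omega A u -> Dom Omega A y ->
  H10 Omega phi ->
  bracket Omega A (u + y) phi = bracket Omega A u phi + bracket Omega A y phi.
Proof.
by move=> LA Du Dy Hp; rewrite -[u]scale1r bracket_linr// scale1r mul1r.
Qed.

Lemma bracket_combination A B C (t : R) y phi : L2mx A -> L2mx B -> L2mx C ->
  (forall x, skew_part C x = (1 - t) *: skew_part A x + t *: skew_part B x) ->
  Dom Omega A y -> Dom Omega B y -> Dom Omega C y -> H10 Omega phi ->
  bracket Omega C y phi = bracket Omega A y phi +
    t * (bracket Omega B y phi - bracket Omega A y phi).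
Proof.
move=> LA LB LC CE DA DB DC Hphi.
(* [Hm1_lin] forms [a * f + g] only, so the multiple [(1 - t) * p] is completed by the zero
   functional, written [-1 * p + p]. *)
have E (p q : R) : p + t * (q - p) = t * q + ((1 - t) * p + (-1 * p + p)).
  by ring.
have E' (p q : R) : t * (-1 * p + q) + p = t * q + ((1 - t) * p + (-1 * p + p)).
  by ring.
have HA := Hm1_bracket oO LA DA; have HB := Hm1_bracket oO LB DB.
have H0 := Hm1_lin (-1) HA HA; have HA' := Hm1_lin (1 - t) HA H0.
rewrite E; apply: (Hm1_ext oO (Hm1_bracket oO LC DC) (Hm1_lin t HB HA') _ Hphi) => g cg.
rewrite !(bracket_test oO)//.
have LK := L2mx_skew LA; have LK' := L2mx_skew LB; have Ly := H10_L2vec DA.1.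
pose D x := -1 *: skew_part A x + skew_part B x.
have LD : L2mx D by exact: (L2mx_lin (-1) LK LK').
have CE' x : skew_part C x = t *: D x + skew_part A x.
  by rewrite CE /D; apply/matrixP => i j; rewrite !mxE; ring.
rewrite (bform_linmx oO cg LD LK CE' Ly).
by rewrite (bform_linmx oO cg LK LK' (fun=> erefl) Ly) E'.
Qed.

(** Both sides are bounded functionals that agree on test functions. The skew part enters as a
    bracket because its integral against a general element of H^1_0 need not exist. *)
Lemma weak_solution_H10 A f y phi : elliptic A -> Hm1 Omega f -> Dom Omega A y ->
  weak_solution Omega f A y -> H10 Omega phi ->
  sym_form A phi.2 y.2 + bracket Omega A y phi = f phi.
Proof.
move=> eA fm DA [Hy yf] Hphi; have [LA _ _] := eA.
have Ly := H10_L2vec Hy; have [LSy _] := elliptic_mulmx eA Ly.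
have := Hm1_lin 1 (Hm1_dot_integral oO LSy) (Hm1_bracket oO LA DA).
move=> H; have := Hm1_ext oO H fm _ Hphi; rewrite mul1r; apply.
move=> g cg; rewrite (bracket_test oO)// -(yf _ cg) /sym_form.
apply/esym; apply: (bform_linmx oO cg (L2mx_sym LA) (L2mx_skew LA) _ Ly) => x.
by rewrite scale1r sym_skew_partD.
Qed.

End ellipticity.
End elliptic_forms.

(** * The first variation *)

Section first_variation.
Context (R : realType) (N : nat).
Local Notation rV := 'rV[R]_N.
Local Notation mu := (lebesgue_rV R N).
Variable Omega : set rV.
Hypothesis oO : open Omega.
Hypothesis bO : bounded_set Omega.
Hypothesis lO : lipschitz_boundary Omega.
Implicit Types (A : rV -> 'M[R]_N) (u y psi phi w chi : sobolev R N).

Let mO : measurable Omega. Proof. exact: open_measurable_rV. Qed.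

Local Notation L2in := (L2in Omega).
Local Notation L2vec := (L2vec Omega).
Local Notation vnorm := (vnorm Omega).
Local Notation norm := (H10norm Omega).
Local Notation sym_form := (sym_form Omega).
Local Notation skew_form := (skew_form Omega).
Local Notation bracket := (bracket Omega).

Variables al be : R.
Hypothesis al0 : 0 < al.
Hypothesis be0 : 0 <= be.
Local Notation elliptic := (elliptic Omega al be).

Definition scalar_integral (f g : rV -> R) := \int[mu]_(x in Omega) (f x * g x).

Definition adjoint_form A phi psi := dot_integral Omega phi.2
  (fun x => sym_part A x *m psi.2 x - skew_part A x *m psi.2 x).

Lemma adjoint_formE A phi psi : elliptic A -> H10 Omega phi -> H10 Omega psi ->
  regular Omega (skew_part A) psi.2 ->
  adjoint_form A phi psi = sym_form A phi.2 psi.2 - skew_form A phi.2 psi.2.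
Proof.
move=> eA Hphi Hpsi rpsi; have [LA _ _] := eA.
have Lp := H10_L2vec Hphi; have Lq := H10_L2vec Hpsi.
have LK := regular_L2vec rpsi (L2mx_skew LA).
have i1 := integrable_dot oO Lp LK.
have i2 := sym_form_integrable oO be0 eA Lp Lq.
have E := dot_integral_linr oO (-1) i1 i2; rewrite mulN1r in E.
rewrite [RHS]addrC -E.
by apply: eq_Rintegral => x _; rewrite -scaleN1r addrC.
Qed.

Lemma bracket_skew_form (i0 : 'I_N) A w psi : elliptic A -> Dom Omega A w ->
  H10 Omega psi -> regular Omega (skew_part A) psi.2 ->
  bracket A w psi = - skew_form A w.2 psi.2.
Proof.
move=> eA Dw Hpsi rpsi; have [LA _ _] := eA.
rewrite (bracket_regular oO bO lO i0 LA Dw Hpsi rpsi).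
apply: (skew_formN oO).
have [Hw _] := Dw.
exact: (integrable_dot oO (H10_L2vec Hw) (regular_L2vec rpsi (L2mx_skew LA))).
Qed.

Lemma skew_form0 A u : skew_form A u.2 u.2 = 0.
Proof. by apply: Rintegral_eq0 => x _; rewrite dot_skew0// skew_part_tr. Qed.

(** The link between the two equations: the adjoint equation of [psi] tested with [w] and the state
    equation of [w] tested with [psi] have the same left-hand side. *)
Lemma adjoint_form_bracket (i0 : 'I_N) A w psi : elliptic A -> Dom Omega A w ->
  H10 Omega psi -> regular Omega (skew_part A) psi.2 ->
  adjoint_form A w psi = sym_form A psi.2 w.2 + bracket A w psi.
Proof.
move=> eA Dw Hpsi rpsi.
have Hw : H10 Omega w by case: Dw.
rewrite (bracket_skew_form i0 eA Dw Hpsi rpsi) (adjoint_formE eA Hw Hpsi rpsi).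
by rewrite [X in X - _]sym_formC.
Qed.

Lemma scalar_integral_le (P : R) u y : 0 <= P ->
  (forall v, H10 Omega v -> L2norm Omega v.1 <= P * norm v) ->
  H10 Omega u -> H10 Omega y ->
  `|scalar_integral u.1 y.1| <= P ^+ 2 * (norm u * norm y).
Proof.
move=> P0 PP Hu Hy.
have Lu := H10_L2in Hu; have Ly := H10_L2in Hy.
apply: (le_trans (L2in_cauchy_schwarz oO Lu Ly)).
have -> : P ^+ 2 * (norm u * norm y) = (P * norm u) * (P * norm y) by ring.
by apply: ler_pM; rewrite ?sqrtr_ge0//; exact: PP.
Qed.

(** Elimination of [X]: the second bound gives [a * X <= T * W], and inserted into the first it
    leaves one factor [W] to cancel. The cases [X = 0] and [W = 0] are separate because these
    factors are divided out. *)
Lemma increment_arith (a H T W X t : R) : 0 < a -> 0 <= H -> 0 <= T -> 0 <= W ->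
  0 <= X -> 0 <= t -> 2 * (a * W ^+ 2) <= t * (H * X) ->
  a * X ^+ 2 <= T * (W * X) -> W <= t * (H * T / (2 * a ^+ 2)).
Proof.
move=> a0 H0 T0 W0 X0 t0 h1 h2.
have aX : a * X <= T * W.
  move: X0; rewrite le_eqVlt => /predU1P[<-|X0]; first by rewrite mulr0 mulr_ge0.
  by rewrite -(ler_pM2r X0) -!mulrA -expr2.
have : W * (2 * a ^+ 2) <= t * (H * T).
  move: W0; rewrite le_eqVlt => /predU1P[<-|W0]; first by rewrite mul0r !mulr_ge0.
  rewrite -(ler_pM2r W0); apply: (@le_trans _ _ (t * (H * (a * X)))).
    have := ler_wpM2l (ltW a0) h1; lra.
  rewrite -!mulrA; apply: ler_wpM2l => //; exact: ler_wpM2l.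
rewrite -ler_pdivlMr ?mulr_gt0 ?exprn_gt0//.
by rewrite -!mulrA.
Qed.

(* The two bounds on w and chi come from testing the equation of chi with w
   and with chi itself. *)
Lemma increment_le (i0 : 'I_N) A (t P H : R) w chi (h : sobolev R N -> R) :
  elliptic A -> 0 <= t -> 0 <= P -> 0 <= H ->
  (forall v, H10 Omega v -> L2norm Omega v.1 <= P * norm v) ->
  (forall v, H10 Omega v -> `|h v| <= H * norm v) ->
  Dom Omega A w -> H10 Omega chi -> regular Omega (skew_part A) chi.2 ->
  (forall phi, H10 Omega phi ->
    sym_form A phi.2 w.2 + bracket A w phi = - (t * h phi)) ->
  (forall phi, H10 Omega phi -> adjoint_form A phi chi =
    - 2 * scalar_integral w.1 phi.1 - 2 * sym_form A phi.2 w.2) ->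
  norm w <= t * (H * (2 * P ^+ 2 + 2 * (N%:R * (N%:R * (N%:R * be)))) / (2 * al ^+ 2)).
Proof.
move=> eA t0 P0 H0 PP hH Dw Hchi rchi weq chieq; have [Hw _] := Dw.
have Lw := H10_L2vec Hw; have Lchi := H10_L2vec Hchi.
have k0 : 0 <= N%:R * (N%:R * (N%:R * be)) by rewrite !mulr_ge0.
apply: (@increment_arith al H _ _ (norm chi)) => //; try exact: sqrtr_ge0.
- by rewrite addr_ge0 ?mulr_ge0 ?sqr_ge0.
(* Tested with [w]: twice the squared L^2 norm of [w] plus twice its symmetric energy equals
   [t * h chi], the bracket having been absorbed by the state equation. *)
- have := chieq _ Hw; rewrite (adjoint_form_bracket i0 eA Dw Hchi rchi) (weq _ Hchi).
  have : al * norm w ^+ 2 <= sym_form A w.2 w.2 by exact: (sym_form_ge oO be0 eA Lw).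
  have ww : 0 <= scalar_integral w.1 w.1.
    by apply: Rintegral_ge0 => x _; rewrite -expr2 sqr_ge0.
  have := ler_wpM2l t0 (le_trans (ler_norm _) (hH _ Hchi)).
  move: (norm w) (norm chi) (h chi) (scalar_integral _ _) (sym_form _ _ _) ww.
  by move=> W X hX s q s0 h1 h2 h3; lra.
(* Tested with [chi]: the skew term vanishes pointwise, and ellipticity bounds [chi] by a multiple
   of [w]. *)
- have := chieq _ Hchi; rewrite (adjoint_formE eA Hchi Hchi rchi) skew_form0 subr0.
  have : al * norm chi ^+ 2 <= sym_form A chi.2 chi.2.
    exact: (sym_form_ge oO be0 eA Lchi).
  have := scalar_integral_le P0 PP Hw Hchi.
  have : `|sym_form A chi.2 w.2| <=
      N%:R * (N%:R * (N%:R * be)) * (norm chi * norm w).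
    exact: (sym_form_le oO be0 eA Lchi Lw).
  rewrite !ler_norml => /andP[h1 _] /andP[h2 _].
  move: (norm w) (norm chi) (sym_form _ _ w.2) (sym_form _ _ chi.2) (scalar_integral _ _) k0 h1 h2.
  move: (N%:R * _) => M W X q q' s M0 h1 h2 h3 h4; nra.
Qed.

End first_variation.

(** In the names, [s] followed by [0] or [h] is a symmetric form for A_0 or A^ with its two
    arguments, [q0] and [qh] are the skew forms of [w] and psi, and [W], [X], [Y] are the norms of
    [w], psi and y_0. The two equations turn the first-order part [2 * s + 2 * s0wy] into [t * hpsi]
    plus [t] times terms linear in [W]; what remains is quadratic in [W] or of order [t * W]. *)
Lemma cost_increment_arith (R : realDomainType)
    (t l l' s shwy s0wy shpw s0pw sww shyy s0yy q0 qh n0 nh W X Y M n P hpsi : R) :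
  0 <= t -> s0pw + - q0 = -2 * s - 2 * s0wy ->
  s0pw + t * (shpw - s0pw) + (- q0 + t * (- qh - - q0)) = - (t * hpsi) ->
  l <= P * W ^+ 2 -> sww <= M * (W * W) ->
  `|shwy| <= M * (W * Y) -> `|s0wy| <= M * (W * Y) ->
  `|shpw| <= M * (X * W) -> `|s0pw| <= M * (X * W) ->
  `|q0| <= n * (W * n0) -> `|qh| <= n * (W * nh) ->
  l' + s0yy <= l + 2 * s + l' +
    (sww + 2 * (s0wy + t * (shwy - s0wy)) + (s0yy + t * (shyy - s0yy))) ->
  0 <= t * (shyy - s0yy + hpsi) +
    t * ((4 * M * Y + 2 * M * X + n * (n0 + nh)) * W) + (P + M) * W ^+ 2.
Proof.
rewrite !ler_norml => t0 adj weq w1 ww /andP[a1 a2] /andP[b1 b2] /andP[c1 c2].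
move=> /andP[d1 d2] /andP[f1 f2] /andP[g1 g2] H.
have z1 : t * (2 * (shwy - s0wy)) <= t * (4 * (M * (W * Y))).
  by apply: ler_wpM2l => //; lra.
have z2 : t * (shpw - s0pw) <= t * (2 * (M * (X * W))).
  by apply: ler_wpM2l => //; lra.
have z3 : t * (q0 - qh) <= t * (n * (W * n0) + n * (W * nh)).
  by apply: ler_wpM2l => //; lra.
have z2' : - (t * (shpw - s0pw)) <= t * (2 * (M * (X * W))).
  by rewrite -mulrN; apply: ler_wpM2l => //; lra.
have z3' : - (t * (q0 - qh)) <= t * (n * (W * n0) + n * (W * nh)).
  by rewrite -mulrN; apply: ler_wpM2l => //; lra.
lra.
Qed.

(** * Expansion of the cost along the increment *)

Section cost_variation.
Context (R : realType) (N : nat).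
Local Notation rV := 'rV[R]_N.
Local Notation mu := (lebesgue_rV R N).
Variable Omega : set rV.
Hypothesis oO : open Omega.
Hypothesis bO : bounded_set Omega.
Hypothesis lO : lipschitz_boundary Omega.
Implicit Types (A : rV -> 'M[R]_N) (u y psi phi w chi : sobolev R N).

Let mO : measurable Omega. Proof. exact: open_measurable_rV. Qed.

Local Notation L2in := (L2in Omega).
Local Notation L2vec := (L2vec Omega).
Local Notation vnorm := (vnorm Omega).
Local Notation norm := (H10norm Omega).
Local Notation sym_form := (sym_form Omega).
Local Notation skew_form := (skew_form Omega).
Local Notation bracket := (bracket Omega).
Local Notation scalar_integral := (scalar_integral Omega).
Local Notation adjoint_form := (adjoint_form Omega).

Variables al be : R.
Hypothesis al0 : 0 < al.
Hypothesis be0 : 0 <= be.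
Local Notation elliptic := (elliptic Omega al be).

Lemma L2norm_sqr f : L2norm Omega f ^+ 2 = scalar_integral f f.
Proof.
rewrite /L2norm sqr_sqrtr; first by apply: eq_Rintegral => x _; rewrite expr2.
by apply: Rintegral_ge0 => x _; exact: sqr_ge0.
Qed.

Lemma L2norm_sqrD f g : L2in f -> L2in g ->
  L2norm Omega (fun x => f x + g x) ^+ 2 =
  L2norm Omega f ^+ 2 + 2 * scalar_integral g f + L2norm Omega g ^+ 2.
Proof.
move=> Lf Lg; rewrite !L2norm_sqr /scalar_integral.
have iff := integrable_L2inM oO Lf Lf; have igg := integrable_L2inM oO Lg Lg.
have igf := integrable_L2inM oO Lg Lf.
have i2 : mu.-integrable Omega (EFin \o (fun x => 2 * (g x * f x))).
  by have := integrableZl mO 2 igf.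
have i3 : mu.-integrable Omega (EFin \o (fun x => f x * f x + 2 * (g x * f x))).
  by have := integrableD mO iff i2.
rewrite -RintegralZl// -RintegralD// -RintegralD//.
by apply: eq_Rintegral => x _; ring.
Qed.

Lemma costE A yd y : cost Omega yd (A, y) =
  L2norm Omega (fun x => y.1 x - yd x) ^+ 2 + sym_form A y.2 y.2.
Proof. by []. Qed.

Lemma sym_formDD A (v w : rV -> 'cV[R]_N) : elliptic A -> L2vec v -> L2vec w ->
  sym_form A (v + w) (v + w) =
  sym_form A v v + 2 * sym_form A v w + sym_form A w w.
Proof.
move=> eA Lv Lw; have Lvw : L2vec (v + w) by exact: L2vecD.
rewrite (sym_formD oO be0 eA Lvw Lv Lw) ![sym_form A (v + w) _]sym_formC.
rewrite (sym_formD oO be0 eA Lv Lv Lw) (sym_formD oO be0 eA Lw Lv Lw).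
by rewrite [sym_form A w v]sym_formC; ring.
Qed.

(** The cost is quadratic in the state, so its expansion at y_0 is exact. The remainder is left in
    terms of the norm of [w]; the products of the skew matrices with the gradient of [psi] are in
    L^2 by regularity, so their norms are finite constants. *)
Lemma cost_increment (i0 : 'I_N) (A0 Ah At : rV -> 'M[R]_N) (t P hpsi : R)
    (yd : rV -> R) w y0 psi :
  elliptic A0 -> elliptic Ah -> elliptic At ->
  (forall x, sym_part At x = (1 - t) *: sym_part A0 x + t *: sym_part Ah x) ->
  (forall x, skew_part At x = (1 - t) *: skew_part A0 x + t *: skew_part Ah x) ->
  0 <= t -> t <= 1 -> 0 <= P ->
  (forall v, H10 Omega v -> L2norm Omega v.1 <= P * norm v) ->
  L2in yd -> Dom Omega A0 w -> Dom Omega Ah w -> Dom Omega At w ->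
  H10 Omega y0 -> H10 Omega psi ->
  regular Omega (skew_part A0) psi.2 -> regular Omega (skew_part Ah) psi.2 ->
  adjoint_form A0 w psi = - 2 * scalar_integral (fun x => y0.1 x - yd x) w.1 -
    2 * sym_form A0 w.2 y0.2 ->
  sym_form At psi.2 w.2 + bracket At w psi = - (t * hpsi) ->
  cost Omega yd (A0, y0) <= cost Omega yd (At, w + y0) ->
  0 <= t * (sym_form Ah y0.2 y0.2 - sym_form A0 y0.2 y0.2 + hpsi) +
    t * ((4 * (N%:R * (N%:R * (N%:R * be))) * norm y0 +
          2 * (N%:R * (N%:R * (N%:R * be))) * norm psi +
          N%:R * (vnorm (fun x => skew_part A0 x *m psi.2 x) +
                  vnorm (fun x => skew_part Ah x *m psi.2 x))) * norm w) +
    (P ^+ 2 + N%:R * (N%:R * (N%:R * be))) * norm w ^+ 2.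
Proof.
move=> e0 eh et symE skewE t0 t1 P0 PP Lyd D0 Dh Dt Hy Hpsi r0 rh adj weq.
have [Hw _] := D0; have Lw := H10_L2vec Hw; have Ly := H10_L2vec Hy.
have Lpsi := H10_L2vec Hpsi.
have [[LA0 _ _] [LAh _ _] [LAt _ _]] := And3 e0 eh et.
have [Lw1 Ly1] := (H10_L2in Hw, H10_L2in Hy).
have Ld : L2in (fun x => y0.1 x - yd x) by apply: L2inD => //; exact: L2inN.
rewrite !costE.
have -> : L2norm Omega (fun x => (w + y0).1 x - yd x) ^+ 2 =
    L2norm Omega w.1 ^+ 2 + 2 * scalar_integral (fun x => y0.1 x - yd x) w.1 +
    L2norm Omega (fun x => y0.1 x - yd x) ^+ 2.
  rewrite -(L2norm_sqrD Lw1 Ld); congr (L2norm _ _ ^+ 2); apply/funext => x.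
  by rewrite -[(w + y0).1 x]/(w.1 x + y0.1 x) addrA.
rewrite [sym_form At (w + y0).2 _](sym_formDD et Lw Ly).
have c00 := sym_form_combination oO be0 e0 eh symE Ly Ly.
have cw0 := sym_form_combination oO be0 e0 eh symE Lw Ly.
have cpw := sym_form_combination oO be0 e0 eh symE Lpsi Lw.
have bt := bracket_combination oO LA0 LAh LAt skewE D0 Dh Dt Hpsi.
have aE := adjoint_form_bracket oO bO lO be0 i0 e0 D0 Hpsi r0.
have b0 := bracket_skew_form oO bO lO i0 e0 D0 Hpsi r0.
have bh := bracket_skew_form oO bO lO i0 eh Dh Hpsi rh.
have w1 : L2norm Omega w.1 ^+ 2 <= P ^+ 2 * norm w ^+ 2.
  rewrite -exprMn lerXn2r ?nnegrE ?sqrtr_ge0 ?mulr_ge0 ?sqrtr_ge0//; exact: PP.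
have sle A v z : elliptic A -> L2vec v -> L2vec z -> `|sym_form A v z| <=
    N%:R * (N%:R * (N%:R * be)) * (vnorm v * vnorm z).
  by move=> eA; exact: (sym_form_le oO be0 eA).
have ww := le_trans (ler_norm _) (sle _ _ _ et Lw Lw).
have hw0 := sle _ _ _ eh Lw Ly; have h0w0 := sle _ _ _ e0 Lw Ly.
have hpw := sle _ _ _ eh Lpsi Lw; have h0pw := sle _ _ _ e0 Lpsi Lw.
have k0 : `|skew_form A0 w.2 psi.2| <= N%:R * (vnorm w.2 * _) :=
  vnorm_cauchy_schwarz oO Lw (regular_L2vec r0 (L2mx_skew LA0)).
have kh : `|skew_form Ah w.2 psi.2| <= N%:R * (vnorm w.2 * _) :=
  vnorm_cauchy_schwarz oO Lw (regular_L2vec rh (L2mx_skew LAh)).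
rewrite -[norm w]/(vnorm w.2) -[norm y0]/(vnorm y0.2) -[norm psi]/(vnorm psi.2).
rewrite -[norm w]/(vnorm w.2) in w1.
rewrite c00 cw0; rewrite aE in adj; rewrite cpw bt in weq; rewrite b0 in adj.
rewrite b0 bh in weq; clear - t0 t1 adj weq w1 ww hw0 h0w0 hpw h0pw k0 kh.
exact: (cost_increment_arith t0 adj weq w1 ww hw0 h0w0 hpw h0pw k0 kh).
Qed.

Lemma ge0_of_increment (E C : R) :
  (\forall t \near 0^'+, 0 <= t * E + t * (C * t)) -> 0 <= E.
Proof.
move=> H; rewrite leNgt; apply/negP => E0.
have C1 : 0 < `|C| + 1 by rewrite ltr_wpDl.
have d0 : 0 < - E / (`|C| + 1) by rewrite divr_gt0// oppr_gt0.
near (0 : R)^'+ => t.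
have t0 : 0 < t by near: t; exact: nbhs_right_gt.
have td : t < - E / (`|C| + 1) by near: t; exact: nbhs_right_lt.
have : 0 <= t * E + t * (C * t) by near: t; exact: H.
rewrite -mulrDr pmulr_rge0// => h.
rewrite ltr_pdivlMr// in td.
have : C * t <= `|C| * t by rewrite ler_wpM2r ?(ltW t0)// ler_norm.
by lra.
Unshelve. all: by end_near. Qed.

End cost_variation.

(** * Equations satisfied by the increments *)

Section increment_equations.
Context (R : realType) (N : nat).
Local Notation rV := 'rV[R]_N.
Local Notation mu := (lebesgue_rV R N).
Variable Omega : set rV.
Hypothesis oO : open Omega.
Implicit Types (A : rV -> 'M[R]_N) (y z psi phi w : sobolev R N).

Let mO : measurable Omega. Proof. exact: open_measurable_rV. Qed.

Local Notation sym_form := (sym_form Omega).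
Local Notation bracket := (bracket Omega).
Local Notation scalar_integral := (scalar_integral Omega).
Local Notation adjoint_form := (adjoint_form Omega).

Variables al be : R.
Hypothesis al0 : 0 < al.
Hypothesis be0 : 0 <= be.
Local Notation elliptic := (elliptic Omega al be).

Lemma Aad_elliptic (c : R) Astar Q A : Aad Omega al be c Astar Q A -> elliptic A.
Proof.
move=> [LA [_ eA _] _]; split; first exact/Lp_mx2P.
- rewrite /ae_in in eA *; apply: filterS eA => x h Ox.
  exact: (sym_entry_le (sym_part_tr A x) (ltW al0) (h Ox)).
- by rewrite /ae_in in eA *; apply: filterS eA => x h Ox xi; have /andP[] := h Ox xi.
Qed.

Lemma cost_ge0 A yd y : elliptic A -> H10 Omega y -> 0 <= cost Omega yd (A, y).
Proof.
move=> eA Hy; rewrite addr_ge0 ?sqr_ge0//.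
apply: le_trans (sym_form_ge oO be0 eA (H10_L2vec Hy)).
by rewrite mulr_ge0 ?sqr_ge0// ltW.
Qed.

(** The derivative in theta of the left-hand side of the state equation along the segment from [A0]
    to [Ah], the state [y] being held fixed. *)
Definition state_residual A0 Ah y phi := sym_form Ah phi.2 y.2 -
  sym_form A0 phi.2 y.2 + (bracket Ah y phi - bracket A0 y phi).

Lemma state_residual_bound A0 Ah y : elliptic A0 -> elliptic Ah ->
  Dom Omega A0 y -> Dom Omega Ah y -> exists2 H : R, 0 <= H &
  forall phi, H10 Omega phi ->
    `|state_residual A0 Ah y phi| <= H * H10norm Omega phi.
Proof.
move=> e0 eh D0 Dh; have Ly := H10_L2vec D0.1.
have [L0 _] := elliptic_mulmx oO be0 e0 Ly; have [Lh _] := elliptic_mulmx oO be0 eh Ly.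
have [[LA0 _ _] [LAh _ _]] := (e0, eh).
have [_ [C hC]] := Hm1_lin 1
  (Hm1_lin (-1) (Hm1_dot_integral oO L0) (Hm1_dot_integral oO Lh))
  (Hm1_lin (-1) (Hm1_bracket oO LA0 D0) (Hm1_bracket oO LAh Dh)).
exists `|C|; first exact: normr_ge0.
move=> phi Hphi; have := hC _ Hphi; rewrite mul1r !mulN1r.
rewrite addrC [X in X + _]addrC [X in _ + X]addrC addrC => h.
by apply: (le_trans h); rewrite ler_wpM2r ?sqrtr_ge0 ?ler_norm.
Qed.

Lemma increment_state (A0 Ah At : rV -> 'M[R]_N) (t : R) f y w phi :
  elliptic A0 -> elliptic Ah -> elliptic At ->
  (forall x, sym_part At x = (1 - t) *: sym_part A0 x + t *: sym_part Ah x) ->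
  (forall x, skew_part At x = (1 - t) *: skew_part A0 x + t *: skew_part Ah x) ->
  Hm1 Omega f -> Dom Omega A0 y -> Dom Omega Ah y -> Dom Omega At y ->
  Dom Omega At w -> weak_solution Omega f A0 y ->
  weak_solution Omega f At (w + y) -> H10 Omega phi ->
  sym_form At phi.2 w.2 + bracket At w phi = - (t * state_residual A0 Ah y phi).
Proof.
move=> e0 eh et symE skewE fm D0 Dh Dt Dw ws0 wst Hphi.
have [[LA0 _ _] [LAh _ _] [LAt _ _]] := And3 e0 eh et.
have Ly := H10_L2vec D0.1; have Lw := H10_L2vec Dw.1; have Lp := H10_L2vec Hphi.
have Dwy : Dom Omega At (w + y) by rewrite -[w]scale1r; exact: Dom_lin.
have := weak_solution_H10 oO be0 et fm Dwy wst Hphi.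
rewrite -(weak_solution_H10 oO be0 e0 fm D0 ws0 Hphi).
rewrite (bracketD oO LAt Dw Dt Hphi).
rewrite [sym_form At phi.2 (w + y).2](sym_formD oO be0 et Lp Lw Ly).
rewrite (sym_form_combination oO be0 e0 eh symE Lp Ly).
rewrite (bracket_combination oO LA0 LAh LAt skewE D0 Dh Dt Hphi) /state_residual.
move: (sym_form At phi.2 w.2) (bracket At w phi) => a b.
move: (sym_form Ah phi.2 y.2) (sym_form A0 phi.2 y.2) => sh s0.
move: (bracket Ah y phi) (bracket A0 y phi) => bh b0 E; lra.
Qed.

Lemma quasi_adjointE yd A y psi : quasi_adjoint Omega 1 yd A y psi ->
  forall phi, H10 Omega phi -> adjoint_form A phi psi =
  - 2 * scalar_integral (fun x => y.1 x - yd x) phi.1 - 2 * sym_form A phi.2 y.2.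
Proof. by move=> [_ qa] phi Hphi; have := qa phi Hphi; rewrite !mulr1. Qed.

(** Subtracting the two equations removes [yd] and [y], and leaves an adjoint equation driven by [w]
    alone. *)
Lemma increment_adjoint A yd y w psi1 psi0 : elliptic A ->
  Lp Omega 2%:E yd -> H10 Omega y -> H10 Omega w ->
  regular Omega (skew_part A) psi1.2 -> regular Omega (skew_part A) psi0.2 ->
  quasi_adjoint Omega 1 yd A (w + y) psi1 -> quasi_adjoint Omega 1 yd A y psi0 ->
  forall phi, H10 Omega phi -> adjoint_form A phi (psi1 - psi0) =
    - 2 * scalar_integral w.1 phi.1 - 2 * sym_form A phi.2 w.2.
Proof.
move=> eA /Lp2P Lyd Hy Hw r1 r0 q1 q0 phi Hphi.
have [LA _ _] := eA; have LK := L2mx_skew LA.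
have [Lp L1] := (H10_L2vec Hphi, H10_L2in Hphi).
have [Ly Lw] := (H10_L2vec Hy, H10_L2vec Hw).
have [H1 _] := q1; have [H0 _] := q0.
have LF psi : H10 Omega psi -> regular Omega (skew_part A) psi.2 ->
    L2vec Omega (fun x => sym_part A x *m psi.2 x - skew_part A x *m psi.2 x).
  move=> Hpsi rpsi; apply: L2vecB; last exact: regular_L2vec.
  by have [] := elliptic_mulmx oO be0 eA (H10_L2vec Hpsi).
have i1 := integrable_dot oO Lp (LF _ H1 r1).
have i0 := integrable_dot oO Lp (LF _ H0 r0).
have -> : adjoint_form A phi (psi1 - psi0) = -1 * adjoint_form A phi psi0 + adjoint_form A phi psi1.
  rewrite -(dot_integral_linr oO (-1) i0 i1); apply: eq_Rintegral => x _.
  rewrite -[(psi1 - psi0).2 x]/(psi1.2 x - psi0.2 x) !mulmxBr; congr dot.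
  rewrite -[RHS]/(-1 *: (sym_part A x *m psi0.2 x - skew_part A x *m psi0.2 x) +
    (sym_part A x *m psi1.2 x - skew_part A x *m psi1.2 x)).
  by apply/colP => i; rewrite !mxE; ring.
rewrite (quasi_adjointE q1 Hphi) (quasi_adjointE q0 Hphi).
rewrite [sym_form A phi.2 (w + y).2](sym_formD oO be0 eA Lp Lw Ly).
have Ld : L2in Omega (fun x => y.1 x - yd x).
  by apply: L2inD; [exact: H10_L2in|exact: L2inN].
have j1 := integrable_L2inM oO (H10_L2in Hw) L1; have j2 := integrable_L2inM oO Ld L1.
have -> : scalar_integral (fun x => (w + y).1 x - yd x) phi.1 =
    scalar_integral w.1 phi.1 + scalar_integral (fun x => y.1 x - yd x) phi.1.
  rewrite -RintegralD//; apply: eq_Rintegral => x _.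
  by rewrite -[(w + y).1 x]/(w.1 x + y.1 x) -addrA mulrDl.
move: (scalar_integral w.1 _) (scalar_integral _ _) => a b.
by move: (sym_form _ _ w.2) (sym_form _ _ _) => d e; ring.
Qed.

End increment_equations.

Theorem theorem4p6 (R : realType) (N : nat) (hN : (2 <= N)%N)
  (Omega : set 'rV[R]_N) (hOmega : lipschitz_domain Omega)
  (alpha beta c : R) (halpha : 0 < alpha) (hbeta : alpha <= beta) (hc : 0 < c)
  (Astar : 'rV[R]_N -> 'M[R]_N) (hAstar : L2_skew Omega Astar)
  (hAstar0 : ~ ae_in Omega (fun x => Astar x = 0))
  (Q : set ('rV[R]_N -> 'M[R]_N)) (hQ : admissible_Q Omega Q)
  (f : sobolev R N -> R) (hf : Hm1 Omega f)
  (yd : 'rV[R]_N -> R) (hyd : Lp Omega 2%:E yd)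
  (A0 : 'rV[R]_N -> 'M[R]_N) (y0 : sobolev R N)
  (hXi : Xi Omega f (Aad Omega alpha beta c Astar Q) (A0, y0))
  (hopt : cost Omega yd (A0, y0) =
    inf [set cost Omega yd p |
         p in Xi Omega f (Aad Omega alpha beta c Astar Q)])
  (hy0 : Dom Omega Astar y0)
  (* (i) *)
  (hi : forall A, Aad Omega alpha beta c Astar Q A ->
    Dom Omega Astar `<=` Dom Omega A)
  (* (ii) and, for the same solutions y theta = y(A_theta), (iii) *)
  (hii_iii : forall Ahat, Aad Omega alpha beta c Astar Q Ahat ->
    let A_ (theta : R) := A0 + theta *: (Ahat - A0) in
    exists y : R -> sobolev R N,
      [/\ forall theta : R, 0 <= theta <= 1 ->
            weak_solution Omega f (A_ theta) (y theta),
          weak_cvg0 Omega y y0,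
          \forall theta \near 0^'+, Dom Omega Astar (y theta) &
          forall (lambda : R) (eps : R -> R), 0 <= lambda ->
            (forall theta : R, 0 <= theta <= 1 -> 0 <= eps theta <= 1) ->
            exists psi : R -> sobolev R N,
              (forall theta : R, 0 <= theta <= 1 ->
                 quasi_adjoint Omega lambda yd (A_ theta)
                   (y0 + eps theta *: (y theta - y0)) (psi theta) /\
                 exists gamma : \bar R, (0 < gamma)%E /\
                   (Lp_vec Omega +oo%E (psi theta).2 \/
                    Lp_mx Omega (2%:E + 4%:E / gamma)%E Astar /\
                    Lp_vec Omega (2%:E + gamma)%E (psi theta).2)) /\
              relatively_compact0 Omega psi]) :
  exists (lambda : R) (psi : sobolev R N),
    [/\ 0 <= lambda, H10 Omega psi &
        ~ (lambda = 0 /\ ae_in Omega (fun x => psi.1 x = 0))] /\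
    [/\ forall phi, C0infty Omega phi ->
          bform Omega A0 (with_grad phi) y0 = f (with_grad phi),
        forall phi, C0infty Omega phi ->
          bform Omega (fun x => (A0 x)^T) (with_grad phi) psi =
          - 2 * lambda *
            (\int[lebesgue_rV R N]_(x in Omega) ((y0.1 x - yd x) * phi x))
          - 2 * lambda * bform Omega (sym_part A0) (with_grad phi) y0 &
        forall A, Aad Omega alpha beta c Astar Q A ->
          \int[lebesgue_rV R N]_(x in Omega)
            dot (y0.2 x) ((sym_part A x - sym_part A0 x) *m
                          (lambda *: y0.2 x + psi.2 x))
          >= bracket Omega A0 y0 psi - bracket Omega A y0 psi].
Proof.
have [oO _ bO lO] := hOmega; have i0 : 'I_N := Ordinal (ltnW hN).
have be0 : 0 <= beta by rewrite (le_trans (ltW halpha)).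
have [hA0 D0 W0] := hXi; rewrite /= in hA0 D0 W0.
have ell A : Aad Omega alpha beta c Astar Q A -> elliptic Omega alpha beta A.
  exact: Aad_elliptic.
have LAs : L2mx Omega Astar by apply/Lp_mx2P; have [] := hAstar.
have regA A v : Aad Omega alpha beta c Astar Q A ->
    regular Omega Astar v -> regular Omega (skew_part A) v.
  move=> hA; have [LA _ _] := ell A hA; have [_ _ [_ pA]] := hA.
  by apply: (regular_preceq (L2mx_skew LA) LAs (skew_part_tr A) _ pA); have [] := hAstar.
have e0 := ell _ hA0; have Hy0 := D0.1.
have i01 : 0 <= (0 : R) <= 1 by rewrite lexx ler01.
(* For A^ = A_0 and eps = 0 the data reduce to [A0] and [y0]. This [psi] is fixed before the
   competitor [Ah], so the same multiplier serves every admissible coefficient. *)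
have [psi [Hpsi rpsi qpsi]] : exists psi, [/\ H10 Omega psi,
    regular Omega Astar psi.2 & quasi_adjoint Omega 1 yd A0 y0 psi].
  have [y [_ _ _ adj]] := hii_iii _ hA0.
  have [psi [psiP _]] := adj 1 (fun=> 0) ler01 (fun _ _ => i01).
  have [qa [g [g0 hg]]] := psiP 0 i01; exists (psi 0).
  move: qa; rewrite !scale0r !addr0 => qa.
  by split; [case: qa|exact: (regular_of_Lp LAs g0 hg)|exact: qa].
have qE := quasi_adjointE qpsi.
exists 1, psi; split; first by split=> // -[/eqP]; rewrite oner_eq0.
split=> [phi cp|phi cp|Ah hAh]; first exact: W0.2.
  have [_ /(_ _ (H10_C0infty cp)) <-] := qpsi.
  by apply: eq_Rintegral => x _; rewrite -mulmxBl sym_skew_partB.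
have eh := ell _ hAh; have Dh := hi _ hAh _ hy0.
have [Ly Lpsi] := (H10_L2vec Hy0, H10_L2vec Hpsi).
have [P P0 PP] := H10_poincare oO bO i0.
have [H H0 hH] := state_residual_bound oO be0 e0 eh D0 Dh.
(* The mixed terms in [y0] and [psi] of the third conclusion, brackets included, are exactly
   [state_residual] at [psi]. *)
suff E0 : 0 <= sym_form Omega Ah y0.2 y0.2 - sym_form Omega A0 y0.2 y0.2 +
    state_residual Omega A0 Ah y0 psi.
  have LyP : L2vec Omega (y0.2 + psi.2) by exact: L2vecD.
  have -> : \int[lebesgue_rV R N]_(x in Omega) dot (y0.2 x)
      ((sym_part Ah x - sym_part A0 x) *m (1 *: y0.2 x + psi.2 x)) =
      -1 * sym_form Omega A0 y0.2 (y0.2 + psi.2) +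
        sym_form Omega Ah y0.2 (y0.2 + psi.2).
    rewrite -(dot_integral_linr oO (-1) (sym_form_integrable oO be0 e0 Ly LyP)
      (sym_form_integrable oO be0 eh Ly LyP)).
    apply: eq_Rintegral => x _; rewrite scale1r mulmxBl addrC; congr dot.
    by rewrite -scaleN1r.
  rewrite (sym_formD oO be0 e0 Ly Ly Lpsi) (sym_formD oO be0 eh Ly Ly Lpsi).
  move: E0; rewrite /state_residual !(sym_formC _ _ psi.2).
  move: (sym_form _ _ _ _) (sym_form _ _ _ _) (sym_form _ _ _ _) (sym_form _ _ _ _).
  by move: (bracket _ _ _ _) (bracket _ _ _ _) => *; lra.
have [y [ysol _ yD adj]] := hii_iii _ hAh.
(* With eps = 1 the adjoint equation is driven by [y theta], with eps = 0 by [y0]; at each theta the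
   two states satisfy equations with the same matrix. *)
have [psi1 [psi1P _]] := adj 1 (fun=> 1) ler01 (fun _ _ => ltac:(by rewrite ler01 lexx)).
have [psi0 [psi0P _]] := adj 1 (fun=> 0) ler01 (fun _ _ => i01).
pose M := N%:R * (N%:R * (N%:R * beta)).
pose K := H * (2 * P ^+ 2 + 2 * M) / (2 * alpha ^+ 2).
pose C := 4 * M * H10norm Omega y0 + 2 * M * H10norm Omega psi +
  N%:R * (vnorm Omega (fun x => skew_part A0 x *m psi.2 x) +
          vnorm Omega (fun x => skew_part Ah x *m psi.2 x)).
(* Once the norm of [w] is at most [t * K], the remainder of the cost expansion is at most [t ^ 2]
   times this constant. *)
apply: (@ge0_of_increment _ _ (C * K + (P ^+ 2 + M) * K ^+ 2)); near=> t.
have t0 : 0 < t by near: t; exact: nbhs_right_gt.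
have t1 : t <= 1 by near: t; exact: nbhs_right_le.
have Dy : Dom Omega Astar (y t) by near: t; exact: yD.
have t01 : 0 <= t <= 1 by rewrite (ltW t0) t1.
pose At := A0 + t *: (Ah - A0).
have hAt : Aad Omega alpha beta c Astar Q At by exact: Aad_convex.
have et := ell _ hAt.
have symE x : sym_part At x = (1 - t) *: sym_part A0 x + t *: sym_part Ah x.
  by apply/matrixP => i j; rewrite !mxE; ring.
have skewE x : skew_part At x = (1 - t) *: skew_part A0 x + t *: skew_part Ah x.
  by apply/matrixP => i j; rewrite !mxE; ring.
pose w := y t - y0; have wE : y t = w + y0 by rewrite subrK.
have Dw : Dom Omega Astar w.
  by rewrite /w addrC -scaleN1r; apply: Dom_lin.
have Hw := Dw.1.
have DwA A : Aad Omega alpha beta c Astar Q A -> Dom Omega A w.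
  by move=> hA; exact: hi.
have wst : weak_solution Omega f At (w + y0) by rewrite -wE; exact: ysol.
have weq phi Hphi := increment_state oO be0 e0 eh et symE skewE hf D0 Dh
  (hi _ hAt _ hy0) (DwA _ hAt) W0 wst (phi := phi) Hphi.
have [q1 [g1 [g10 h1]]] := psi1P _ t01; have [q0 [g0 [g00 h0]]] := psi0P _ t01.
rewrite scale1r -/w [y0 + w]addrC in q1; rewrite scale0r addr0 in q0.
have r1 := regular_of_Lp LAs g10 h1; have r0 := regular_of_Lp LAs g00 h0.
have [Hp1 _] := q1; have [Hp0 _] := q0; have Hchi := H10B oO Hp1 Hp0.
have chieq := increment_adjoint oO be0 et hyd Hy0 Hw (regA _ _ hAt r1)
  (regA _ _ hAt r0) q1 q0.
have wK : H10norm Omega w <= t * K.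
  apply: (increment_le oO bO lO halpha be0 i0 et (ltW t0) P0 H0 PP hH (DwA _ hAt)
    Hchi _ weq chieq).
  exact: (regA _ _ hAt (regularB LAs r1 r0)).
have cle : cost Omega yd (A0, y0) <= cost Omega yd (At, w + y0).
  (* The infimum is a lower bound because costs are nonnegative, by ellipticity. *)
  rewrite hopt; apply: ge_inf.
    exists 0 => _ [[A z] [hA [Hz _] _] <-].
    exact: (cost_ge0 oO halpha be0 yd (ell _ hA) Hz).
  exists (At, w + y0); last by [].
  by split; [exact: hAt|rewrite -wE; exact: (hi _ hAt _ Dy)|exact: wst].
have := cost_increment oO bO lO be0 i0 e0 eh et symE skewE (ltW t0) t1 P0 PP
  ((Lp2P _ _).1 hyd) (DwA _ hA0) (DwA _ hAh) (DwA _ hAt) Hy0 Hpsi (regA _ _ hA0 rpsi)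
  (regA _ _ hAh rpsi) (qE _ Hw) (weq _ Hpsi) cle.
rewrite -/M -/C; move/le_trans; apply.
have M0 : 0 <= M by rewrite !mulr_ge0.
have C0 : 0 <= C by rewrite !addr_ge0 ?mulr_ge0 ?addr_ge0 ?vnorm_ge0 ?sqrtr_ge0.
have W2 : H10norm Omega w ^+ 2 <= (t * K) ^+ 2.
  by rewrite lerXn2r ?nnegrE ?sqrtr_ge0// (le_trans _ wK) ?sqrtr_ge0.
have PM : 0 <= P ^+ 2 + M by rewrite addr_ge0// sqr_ge0.
rewrite -addrA lerD2l; apply: (@le_trans _ _ (t * (C * (t * K)) + (P ^+ 2 + M) * (t * K) ^+ 2)).
  apply: lerD; last exact: ler_wpM2l.
  by apply: ler_wpM2l; [exact: ltW|exact: ler_wpM2l].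
by rewrite le_eqVlt; apply/orP; left; apply/eqP; ring.
Unshelve. all: by end_near. Qed.
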